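(* Let $\alpha\in\mathbb{C}\setminus\{0,-1\}$ and $\mathfrak{g}=D(2,1,\alpha)$. For every set of positive roots $\Delta^{+}\subset\Delta$ and every $\lambda\in\mathfrak{h}^{*}$, the Verma module $M(\lambda)$ of highest weight $\lambda$ with respect to $\Delta^{+}$ is bounded; moreover $M(\lambda)$ has degree $8$ and graded degree $(8,8)$.
   Context: The ground field is $\mathbb{C}$. For $\alpha\in\mathbb{C}\setminus\{0,-1\}$, $\mathfrak{g}=\mathfrak{g}_{\bar 0}\oplus\mathfrak{g}_{\bar 1}=D(2,1,\alpha)$ is the contragredient Lie superalgebra $\mathfrak{g}(A)$ with Cartan matrix $$A=\begin{pmatrix}0&1&\alpha\\1&0&-\alpha-1\\ \alpha&-\alpha-1&0\end{pmatrix}$$ and three simple roots $\beta_1,\beta_2,\beta_3$, all odd: it is generated by odd $e_i,f_i$ and even $h_i$ ($i=1,2,3$), where the $h_i$ form a basis of the Cartan subalgebra $\mathfrak{h}$, with relations $[h_i,h_j]=0$, $[e_i,f_j]=\delta_{ij}h_i$, $[h_i,e_j]=a_{ij}e_j$, $[h_i,f_j]=-a_{ij}f_j$, modulo the maximal ideal intersecting $\mathfrak{h}$ trivially. Its even part is $\mathfrak{g}_{\bar 0}\cong\mathfrak{sl}_2\times\mathfrak{sl}_2\times\mathfrak{sl}_2$ and $\mathfrak{g}_{\bar 1}$ is the tensor product of the three standard representations (dimension $8$). The set of roots with respect to $\mathfrak{h}$ is denoted $\Delta=\Delta_{\bar 0}\cup\Delta_{\bar 1}$. Each set of simple roots $\Pi\subset\Delta$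 gives a set of positive roots $\Delta^{+}$ and a triangular decomposition $\mathfrak{g}=\mathfrak{n}^-\oplus\mathfrak{h}\oplus\mathfrak{n}^+$. The Verma module is $M(\lambda)=U(\mathfrak{g})\otimes_{U(\mathfrak{h}\oplus\mathfrak{n}^+)}\mathbb{C}_\lambda$, where $\mathfrak{h}$ acts on $\mathbb{C}_\lambda$ by $\lambda$ and $\mathfrak{n}^+$ acts by $0$. All modules $M=M_{\bar 0}\oplus M_{\bar 1}$ are $\mathbb{Z}/2\mathbb{Z}$-graded. A weight module is one with $M=\bigoplus_{\mu\in\mathfrak{h}^*}M_\mu$, $M_\mu=\{m: h m=\mu(h)m\ \forall h\in\mathfrak{h}\}$. A weight module $M$ is bounded if there is a constant $c$ with $\dim M_\mu<c$ for all $\mu\in\mathfrak{h}^*$; its degree is $\deg M=\max_{\mu}\dim M_\mu$; its graded degree is $(d_0,d_1)$ with $d_i=\max_\mu\dim (M_{\bar i})_\mu$. *)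

(* Defs.v *)
From HB Require Import structures.
From mathcomp Require Import all_boot all_order all_algebra.
From mathcomp Require Import complex.
From mathcomp Require Import boolp classical_sets reals.

Set Implicit Arguments.
Unset Strict Implicit.
Unset Printing Implicit Defensive.

Import Order.TTheory GRing.Theory Num.Theory.
Local Open Scope quotient_scope.
Local Open Scope classical_set_scope.
Local Open Scope ring_scope.

Declare Scope super_scope.
Delimit Scope super_scope with super.

Section Subspaces.
Variables (K : pzRingType) (V : lmodType K).
Implicit Types (W S : set V) (u v w : V).

Definition subspace W :=
  W 0 /\ forall (a : K) u v, W u -> W v -> W (a *: u + v).

Definition lspan S : set V := smallest subspace S.

Definition has_dim W (n : nat) :=
  exists e : 'I_n -> V,
    [/\ forall i, W (e i),
        forall a : 'I_n -> K, \sum_i a i *: e i = 0 -> forall i, a i = 0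
      & forall w, W w -> exists a : 'I_n -> K, w = \sum_i a i *: e i].

Lemma subspaceD W u v : subspace W -> W u -> W v -> W (u + v).
Proof. by move=> [_ h] hu hv; rewrite -[u]scale1r; apply: h. Qed.

Lemma subspaceZ W a u : subspace W -> W u -> W (a *: u).
Proof. by move=> [h0 h] hu; rewrite -[X in W X]addr0; apply: h. Qed.

Lemma subspaceN W u : subspace W -> W u -> W (- u).
Proof. by move=> hW hu; rewrite -scaleN1r; apply: subspaceZ. Qed.

Lemma subspaceB W u v : subspace W -> W u -> W v -> W (u - v).
Proof. by move=> hW hu hv; apply: subspaceD => //; apply: subspaceN. Qed.

Lemma subspace_sum W (I : Type) (r : seq I) (F : I -> V) :
  subspace W -> (forall i, W (F i)) -> W (\sum_(i <- r) F i).
Proof.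
move=> hW hF; elim/big_rec: _ => [|i x _ hx]; first by case: hW.
exact: subspaceD.
Qed.

Lemma lspan_subspace S : subspace (lspan S).
Proof.
split=> [W [[h0 _] _] //|a u v hu hv W [hW hS]].
by case: (hW) => _; apply; [apply: hu | apply: hv].
Qed.

Lemma sub_lspan S u : S u -> lspan S u.
Proof. by move=> hu W [_]; apply. Qed.

Lemma lspan_min S W : subspace W -> S `<=` W -> lspan S `<=` W.
Proof. by move=> hW hS u; apply. Qed.

End Subspaces.

Section Quotient.
Variables (K : pzRingType) (V : lmodType K) (S : set V).

Definition quo_rel (u v : V) : bool := `[< lspan S (u - v) >].

Lemma quo_rel_equiv : equiv_class_of quo_rel.
Proof.
have hW := lspan_subspace S.
split=> [u|u v|v u w].
- by apply/asboolP; rewrite subrr; case: hW.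
- by apply/asboolP/asboolP => h; rewrite -opprB; apply: (subspaceN hW).
- move=> /asboolP h1 /asboolP h2; apply/asboolP.
  by rewrite -(subrK v u) -addrA; apply: (subspaceD hW).
Qed.

Canonical quo_equiv := EquivRelPack quo_rel_equiv.

(** The quotient of [V] by the span of [S]. *)
Definition quo : Type := {eq_quot quo_equiv}.
HB.instance Definition _ := Choice.on quo.
HB.instance Definition _ : EqQuotient V quo_equiv quo := EqQuotient.on quo.

Definition cls (u : V) : quo := \pi_quo u.

Lemma clsP u v : cls u = cls v <-> lspan S (u - v).
Proof.
split; last by move=> h; apply/eqmodP; apply/asboolP.
by move=> /eqmodP /asboolP.
Qed.

Lemma cls_ind (P : quo -> Prop) : (forall u, P (cls u)) -> forall x, P x.
Proof. by move=> h x; rewrite -[x]reprK; apply: h. Qed.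

Lemma cls_repr u : lspan S (repr (cls u) - u).
Proof. by apply/clsP; rewrite /cls reprK. Qed.

Definition quo_add (x y : quo) := cls (repr x + repr y).
Definition quo_opp (x : quo) := cls (- repr x).
Definition quo_scale (a : K) (x : quo) := cls (a *: repr x).

Let hW := lspan_subspace S.

Lemma quo_addE u v : quo_add (cls u) (cls v) = cls (u + v).
Proof.
apply/clsP; rewrite opprD addrACA.
by apply: (subspaceD hW); apply: cls_repr.
Qed.

Lemma quo_oppE u : quo_opp (cls u) = cls (- u).
Proof. by apply/clsP; rewrite -opprD; apply: (subspaceN hW); apply: cls_repr. Qed.

Lemma quo_scaleE a u : quo_scale a (cls u) = cls (a *: u).
Proof. by apply/clsP; rewrite -scalerBr; apply: (subspaceZ _ hW); apply: cls_repr. Qed.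

Fact quo_addA : associative quo_add.
Proof.
by do 3 elim/cls_ind => ?; rewrite !quo_addE addrA.
Qed.
Fact quo_addC : commutative quo_add.
Proof. by do 2 elim/cls_ind => ?; rewrite !quo_addE addrC. Qed.
Fact quo_add0 : left_id (cls 0) quo_add.
Proof. by elim/cls_ind => ?; rewrite quo_addE add0r. Qed.
Fact quo_addN : left_inverse (cls 0) quo_opp quo_add.
Proof. by elim/cls_ind => ?; rewrite quo_oppE quo_addE addNr. Qed.

HB.instance Definition _ :=
  GRing.isZmodule.Build quo quo_addA quo_addC quo_add0 quo_addN.

Fact quo_scaleA a b x : quo_scale a (quo_scale b x) = quo_scale (a * b) x.
Proof. by elim/cls_ind: x => ?; rewrite !quo_scaleE scalerA. Qed.
Fact quo_scale1 : left_id 1 quo_scale.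
Proof. by elim/cls_ind => ?; rewrite quo_scaleE scale1r. Qed.
Fact quo_scaleDr : right_distributive quo_scale +%R.
Proof.
move=> a; do 2 elim/cls_ind => ?.
by rewrite [cls _ + cls _]quo_addE !quo_scaleE [RHS]quo_addE scalerDr.
Qed.
Fact quo_scaleDl x : {morph quo_scale^~ x : a b / a + b}.
Proof.
move=> a b; elim/cls_ind: x => ?.
by rewrite !quo_scaleE [RHS]quo_addE scalerDl.
Qed.

HB.instance Definition _ :=
  GRing.Zmodule_isLmodule.Build K quo quo_scaleA quo_scale1 quo_scaleDr
    quo_scaleDl.

Lemma clsD u v : cls (u + v) = cls u + cls v.
Proof. by rewrite -quo_addE. Qed.
Lemma clsZ a u : cls (a *: u) = a *: cls u.
Proof. by rewrite -quo_scaleE. Qed.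
Lemma clsN u : cls (- u) = - cls u.
Proof. by rewrite -quo_oppE. Qed.
Lemma clsB u v : cls (u - v) = cls u - cls v.
Proof. by rewrite clsD clsN. Qed.
Lemma cls0 : cls 0 = 0. Proof. by []. Qed.
Lemma cls_eq0 u : cls u = 0 <-> lspan S u.
Proof. by rewrite -cls0 clsP subr0. Qed.

End Quotient.
Arguments quo {K V} S.
Arguments cls {K V} S u.

(** [homog false] and [homog true] are the even and the odd part. *)

HB.mixin Record Lmodule_isSuper (K : pzRingType) V of GRing.Lmodule K V := {
  homog : bool -> set V;
  homog_subspace : forall b, subspace (homog b);
  homog_sum : forall v, exists v0 v1,
    [/\ homog false v0, homog true v1 & v = v0 + v1];
  homog_cap : forall v, homog false v -> homog true v -> v = 0
}.

#[short(type="superModType")]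
HB.structure Definition SuperLmodule (K : pzRingType) :=
  {V of GRing.Lmodule K V & Lmodule_isSuper K V}.

HB.mixin Record SuperLmodule_isLieSuper (K : pzRingType) g
    of SuperLmodule K g := {
  bracket : g -> g -> g;
  bracket_linearl : forall (a : K) (x y z : g),
    bracket (a *: x + y) z = a *: bracket x z + bracket y z;
  bracket_linearr : forall (a : K) (x y z : g),
    bracket z (a *: x + y) = a *: bracket z x + bracket z y;
  bracket_homog : forall (a b : bool) (x y : g),
    homog a x -> homog b y -> homog (a (+) b) (bracket x y);
  bracket_skew : forall (a b : bool) (x y : g), homog a x -> homog b y ->
    bracket x y = - ((-1) ^+ (a && b) *: bracket y x);
  bracket_jacobi : forall (a b : bool) (x y z : g), homog a x -> homog b y ->
    bracket x (bracket y z) =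
    bracket (bracket x y) z + (-1) ^+ (a && b) *: bracket y (bracket x z)
}.

#[short(type="lieSuperType")]
HB.structure Definition LieSuper (K : pzRingType) :=
  {g of SuperLmodule K g & SuperLmodule_isLieSuper K g}.

Arguments bracket_homog {K s a b x y}.
Arguments bracket_skew {K s a b x y}.
Arguments bracket_jacobi {K s a b x y} z.

Notation "[< x , y >]" := (bracket x y)
  (at level 0, format "[<  x ,  y  >]") : super_scope.
Local Open Scope super_scope.

HB.mixin Record SuperLmodule_isLieSuperModule (K : pzRingType)
    (g : lieSuperType K) M of SuperLmodule K M := {
  act : g -> M -> M;
  act_linearl : forall (a : K) (x y : g) (m : M),
    act (a *: x + y) m = a *: act x m + act y m;
  act_linearr : forall (a : K) (x : g) (m m' : M),
    act x (a *: m + m') = a *: act x m + act x m';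
  act_homog : forall (a b : bool) (x : g) (m : M),
    homog a x -> homog b m -> homog (a (+) b) (act x m);
  act_bracket : forall (a b : bool) (x y : g) (m : M),
    homog a x -> homog b y ->
    act [< x, y >] m = act x (act y m) - (-1) ^+ (a && b) *: act y (act x m)
}.

#[short(type="lieSuperModType")]
HB.structure Definition LieSuperModule (K : pzRingType) (g : lieSuperType K) :=
  {M of SuperLmodule K M & SuperLmodule_isLieSuperModule K g M}.

Section Parts.
Variables (K : pzRingType) (V : superModType K).
Implicit Types (u v : V) (W S : set V).

Lemma homog_pair v : exists p : V * V,
  [/\ homog false p.1, homog true p.2 & v = p.1 + p.2].
Proof. by have [v0 [v1 h]] := homog_sum v; exists (v0, v1). Qed.

Definition part (b : bool) v : V :=
  let p := sval (cid (homog_pair v)) in if b then p.2 else p.1.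

Lemma part_homog b v : homog b (part b v).
Proof. by rewrite /part; case: cid => -[v0 v1] /= [h0 h1 _]; case: b. Qed.

Lemma part_sum v : v = part false v + part true v.
Proof. by rewrite /part; case: cid => -[v0 v1] /= []. Qed.

Lemma homog_split_uniq u0 u1 v0 v1 :
  homog false u0 -> homog true u1 -> homog false v0 -> homog true v1 ->
  u0 + u1 = v0 + v1 -> u0 = v0 /\ u1 = v1 :> V.
Proof.
move=> hu0 hu1 hv0 hv1 e.
have e1 : u0 - v0 = v1 - u1.
  have -> : u0 = v0 + v1 - u1 by rewrite -e addrK.
  by rewrite [v0 + v1]addrC addrAC addrK.
have /eqP : u0 - v0 = 0.
  apply: homog_cap; first by apply: subspaceB => //; apply: homog_subspace.
  by rewrite e1; apply: subspaceB => //; apply: homog_subspace.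
rewrite subr_eq0 => /eqP e2; split=> //.
by move: e; rewrite e2 => /addrI.
Qed.

Lemma part_unique v0 v1 : homog false v0 -> homog true v1 ->
  part false (v0 + v1) = v0 /\ part true (v0 + v1) = v1 :> V.
Proof.
move=> h0 h1; apply: homog_split_uniq => //; try exact: part_homog.
by rewrite -part_sum.
Qed.

Lemma part_homogE b v : homog b v ->
  part false v = (if b then 0 else v) /\ part true v = (if b then v else 0).
Proof.
have z c : homog c (0 : V) by case: (homog_subspace (s := V) c).
case: b => h.
  by have [] := part_unique (z false) h; rewrite add0r.
by have [] := part_unique h (z true); rewrite addr0.
Qed.

Lemma part_linear b a u v : part b (a *: u + v) = a *: part b u + part b v.
Proof.
have h c : homog c (a *: part c u + part c v).
  by case: (homog_subspace (s := V) c) => _; apply; apply: part_homog.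
have [] := part_unique (h false) (h true).
rewrite addrACA -scalerDr -!part_sum.
by case: b.
Qed.

Definition graded W := forall b v, W v -> W (part b v).

Lemma lspan_graded S : (forall b v, S v -> lspan S (part b v)) -> graded (lspan S).
Proof.
move=> h b v; apply: (@lspan_min _ _ S [set w | lspan S (part b w)]); last first.
  by move=> w /h; apply.
have [s0 s] := lspan_subspace S.
split=> /= [|a u w hu hw]; last by rewrite part_linear; apply: s.
have -> : part b (0 : V) = 0 :> V; last by [].
have := part_linear b 0 0 (0 : V).
by rewrite !scale0r !add0r => _; have := part_linear b (-1) 0 (0 : V);
  rewrite scaleN1r oppr0 addr0 scaleN1r addNr.
Qed.

Definition quo_homog S (b : bool) : set (quo S) := [set cls S v | v in homog b].

Lemma quo_homog_subspace S b : subspace (quo_homog (S := S) b).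
Proof.
have [h0 h] := homog_subspace (s := V) b.
split=> [|a _ _ [u hu <-] [v hv <-]]; first by exists 0.
by exists (a *: u + v); [exact: h | rewrite clsD clsZ].
Qed.

Lemma quo_homog_sum S (x : quo S) : exists x0 x1,
  [/\ quo_homog false x0, quo_homog true x1 & x = x0 + x1].
Proof.
elim/cls_ind: x => v; exists (cls S (part false v)), (cls S (part true v)).
split; [exists (part false v) | exists (part true v) |] => //;
  try exact: part_homog.
by rewrite -clsD -part_sum.
Qed.

Lemma quo_homog_cap S (x : quo S) : graded (lspan S) ->
  quo_homog false x -> quo_homog true x -> x = 0.
Proof.
move=> hS [u hu <-] [v hv /clsP hvu]; apply/cls_eq0.
have := hS false _ hvu.
have [z1 z2] := homog_subspace (s := V) false.
have -> : part false (v - u) = - u; last first.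
  by move=> /(subspaceN (lspan_subspace S)); rewrite opprK.
rewrite addrC; apply: (proj1 (part_unique _ hv)).
exact: subspaceN.
Qed.

End Parts.

Inductive term (K : Type) (G : Type) : Type :=
| tgen of G
| tzero
| tadd of term K G & term K G
| tscale of K & term K G
| tmul of term K G & term K G.
Arguments tgen {K G}.
Arguments tzero {K G}.

Section Terms.
Variables (K : pzRingType) (G : Type) (gpar : bool -> G -> Prop).
Variable rel : term K G -> term K G -> Prop.

Inductive thomog : bool -> term K G -> Prop :=
| thomog_gen b x : gpar b x -> thomog b (tgen x)
| thomog_zero b : thomog b tzero
| thomog_add b s t : thomog b s -> thomog b t -> thomog b (tadd s t)
| thomog_scale b c t : thomog b t -> thomog b (tscale c t)
| thomog_mul a b s t : thomog a s -> thomog b t ->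
    thomog (a (+) b) (tmul s t).

Inductive tcong : term K G -> term K G -> Prop :=
| tcong_rel s t : rel s t -> tcong s t
| tcong_refl s : tcong s s
| tcong_sym s t : tcong s t -> tcong t s
| tcong_trans t s u : tcong s t -> tcong t u -> tcong s u
| tcong_add s s' t t' : tcong s s' -> tcong t t' ->
    tcong (tadd s t) (tadd s' t')
| tcong_scale c t t' : tcong t t' -> tcong (tscale c t) (tscale c t')
| tcong_mul s s' t t' : tcong s s' -> tcong t t' ->
    tcong (tmul s t) (tmul s' t')
| tcong_addA s t u : tcong (tadd s (tadd t u)) (tadd (tadd s t) u)
| tcong_addC s t : tcong (tadd s t) (tadd t s)
| tcong_add0 t : tcong (tadd tzero t) t
| tcong_addN t : tcong (tadd (tscale (-1) t) t) tzero
| tcong_scaleA a b t : tcong (tscale a (tscale b t)) (tscale (a * b) t)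
| tcong_scale1 t : tcong (tscale 1 t) t
| tcong_scaleDr a s t :
    tcong (tscale a (tadd s t)) (tadd (tscale a s) (tscale a t))
| tcong_scaleDl a b t :
    tcong (tscale (a + b) t) (tadd (tscale a t) (tscale b t))
| tcong_mulDl s t u : tcong (tmul (tadd s t) u) (tadd (tmul s u) (tmul t u))
| tcong_mulDr s t u : tcong (tmul u (tadd s t)) (tadd (tmul u s) (tmul u t))
| tcong_mulZl a s t : tcong (tmul (tscale a s) t) (tscale a (tmul s t))
| tcong_mulZr a s t : tcong (tmul s (tscale a t)) (tscale a (tmul s t)).

Fixpoint tsubst (f : G -> term K G) (t : term K G) : term K G :=
  match t with
  | tgen x => f x
  | tzero => tzero
  | tadd s t => tadd (tsubst f s) (tsubst f t)
  | tscale c t => tscale c (tsubst f t)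
  | tmul s t => tmul (tsubst f s) (tsubst f t)
  end.

End Terms.

(** The last two fields say that the relations are compatible with the parity;
    they only serve to prove that the presented algebra is graded. *)
Record presentation (K : pzRingType) := Presentation {
  gen : Type;
  gpar : bool -> gen -> Prop;
  prel : term K gen -> term K gen -> Prop;
  gen_split : forall x : gen, exists t0 t1,
    [/\ thomog gpar false t0, thomog gpar true t1
      & tcong prel (tgen x) (tadd t0 t1)];
  gen_parity_aut : exists f : gen -> term K gen,
    [/\ forall b x, gpar b x -> thomog gpar b (f x),
        forall b x, gpar b x -> tcong prel (f x) (tscale ((-1) ^+ b) (tgen x))
      & forall s t, prel s t -> tcong prel (tsubst f s) (tsubst f t)]
}.

Section Presented.
Variables (K : numFieldType) (P : presentation K).
Local Notation T := (term K (gen P)).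
Local Notation cong := (tcong (prel (p := P))).
Local Notation hom := (thomog (gpar (p := P))).

HB.instance Definition _ := gen_eqMixin T.
HB.instance Definition _ := gen_choiceMixin T.

Definition cong_rel (s t : T) : bool := `[< cong s t >].

Lemma cong_rel_equiv : equiv_class_of cong_rel.
Proof.
split=> [s|s t|t s u].
- by apply/asboolP; apply: tcong_refl.
- by apply/asboolP/asboolP; apply: tcong_sym.
- by move=> /asboolP h1 /asboolP h2; apply/asboolP; apply: tcong_trans h1 h2.
Qed.

Canonical cong_equiv := EquivRelPack cong_rel_equiv.

Definition presented : Type := {eq_quot cong_equiv}.
HB.instance Definition _ := Choice.on presented.
HB.instance Definition _ : EqQuotient T cong_equiv presented :=
  EqQuotient.on presented.

Definition tcls (t : T) : presented := \pi_presented t.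

Lemma tclsP s t : tcls s = tcls t <-> cong s t.
Proof.
split; last by move=> h; apply/eqmodP; apply/asboolP.
by move=> /eqmodP /asboolP.
Qed.

Lemma tcls_ind (Q : presented -> Prop) : (forall t, Q (tcls t)) -> forall x, Q x.
Proof. by move=> h x; rewrite -[x]reprK; apply: h. Qed.

Lemma tcls_repr t : cong (repr (tcls t)) t.
Proof. by apply/tclsP; rewrite /tcls reprK. Qed.

Definition pres_add (x y : presented) := tcls (tadd (repr x) (repr y)).
Definition pres_scale (a : K) (x : presented) := tcls (tscale a (repr x)).
Definition pres_mul (x y : presented) := tcls (tmul (repr x) (repr y)).

Lemma pres_addE s t : pres_add (tcls s) (tcls t) = tcls (tadd s t).
Proof. by apply/tclsP; apply: tcong_add; apply: tcls_repr. Qed.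
Lemma pres_scaleE a t : pres_scale a (tcls t) = tcls (tscale a t).
Proof. by apply/tclsP; apply: tcong_scale; apply: tcls_repr. Qed.
Lemma pres_mulE s t : pres_mul (tcls s) (tcls t) = tcls (tmul s t).
Proof. by apply/tclsP; apply: tcong_mul; apply: tcls_repr. Qed.

Fact pres_addA : associative pres_add.
Proof.
do 3 elim/tcls_ind => ?; rewrite !pres_addE.
by apply/tclsP; apply: tcong_addA.
Qed.
Fact pres_addC : commutative pres_add.
Proof.
by do 2 elim/tcls_ind => ?; rewrite !pres_addE; apply/tclsP; apply: tcong_addC.
Qed.
Fact pres_add0 : left_id (tcls tzero) pres_add.
Proof.
by elim/tcls_ind => ?; rewrite !pres_addE; apply/tclsP; apply: tcong_add0.
Qed.
Fact pres_addN : left_inverse (tcls tzero) (pres_scale (-1)) pres_add.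
Proof.
elim/tcls_ind => ?; rewrite pres_scaleE pres_addE.
by apply/tclsP; apply: tcong_addN.
Qed.

HB.instance Definition _ :=
  GRing.isZmodule.Build presented pres_addA pres_addC pres_add0 pres_addN.

Fact pres_scaleA a b x : pres_scale a (pres_scale b x) = pres_scale (a * b) x.
Proof.
elim/tcls_ind: x => ?; rewrite !pres_scaleE.
by apply/tclsP; apply: tcong_scaleA.
Qed.
Fact pres_scale1 : left_id 1 pres_scale.
Proof.
by elim/tcls_ind => ?; rewrite pres_scaleE; apply/tclsP; apply: tcong_scale1.
Qed.
Fact pres_scaleDr : right_distributive pres_scale +%R.
Proof.
move=> a; do 2 elim/tcls_ind => ?.
rewrite [tcls _ + tcls _]pres_addE !pres_scaleE [RHS]pres_addE.
by apply/tclsP; apply: tcong_scaleDr.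
Qed.
Fact pres_scaleDl x : {morph pres_scale^~ x : a b / a + b}.
Proof.
move=> a b; elim/tcls_ind: x => ?; rewrite !pres_scaleE [RHS]pres_addE.
by apply/tclsP; apply: tcong_scaleDl.
Qed.

HB.instance Definition _ :=
  GRing.Zmodule_isLmodule.Build K presented pres_scaleA pres_scale1
    pres_scaleDr pres_scaleDl.

Lemma tclsD s t : tcls (tadd s t) = tcls s + tcls t.
Proof. by rewrite -pres_addE. Qed.
Lemma tclsZ a t : tcls (tscale a t) = a *: tcls t.
Proof. by rewrite -pres_scaleE. Qed.
Lemma tcls0 : tcls tzero = 0. Proof. by []. Qed.
Lemma tclsM s t : tcls (tmul s t) = pres_mul (tcls s) (tcls t).
Proof. by rewrite pres_mulE. Qed.

Lemma pres_mul_linearl a x y z :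
  pres_mul (a *: x + y) z = a *: pres_mul x z + pres_mul y z.
Proof.
elim/tcls_ind: x => x; elim/tcls_ind: y => y; elim/tcls_ind: z => z.
rewrite -tclsZ -tclsD -3!tclsM -tclsZ -tclsD; apply/tclsP.
apply: tcong_trans (tcong_mulDl _ _ _ _) _.
by apply: tcong_add; [apply: tcong_mulZl | apply: tcong_refl].
Qed.

Lemma pres_mul_linearr a x y z :
  pres_mul z (a *: x + y) = a *: pres_mul z x + pres_mul z y.
Proof.
elim/tcls_ind: x => x; elim/tcls_ind: y => y; elim/tcls_ind: z => z.
rewrite -tclsZ -tclsD -3!tclsM -tclsZ -tclsD; apply/tclsP.
apply: tcong_trans (tcong_mulDr _ _ _ _) _.
by apply: tcong_add; [apply: tcong_mulZr | apply: tcong_refl].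
Qed.

Lemma pres_mulDl x y z : pres_mul (x + y) z = pres_mul x z + pres_mul y z.
Proof. by have := pres_mul_linearl 1 x y z; rewrite !scale1r. Qed.
Lemma pres_mulDr x y z : pres_mul z (x + y) = pres_mul z x + pres_mul z y.
Proof. by have := pres_mul_linearr 1 x y z; rewrite !scale1r. Qed.
Lemma pres_mul0l z : pres_mul 0 z = 0.
Proof. by apply: (addIr (pres_mul 0 z)); rewrite -pres_mulDl !add0r. Qed.
Lemma pres_mul0r z : pres_mul z 0 = 0.
Proof. by apply: (addIr (pres_mul z 0)); rewrite -pres_mulDr !add0r. Qed.
Lemma pres_mulZl a x z : pres_mul (a *: x) z = a *: pres_mul x z.
Proof.
by have := pres_mul_linearl a x 0 z; rewrite pres_mul0l !addr0.
Qed.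
Lemma pres_mulZr a x z : pres_mul z (a *: x) = a *: pres_mul z x.
Proof.
by have := pres_mul_linearr a x 0 z; rewrite pres_mul0r !addr0.
Qed.

Definition pres_homog (b : bool) : set presented := [set tcls t | t in hom b].

Lemma pres_homog_subspace b : subspace (pres_homog b).
Proof.
split=> [|a _ _ [s hs <-] [t ht <-]]; first by exists tzero => //; constructor.
by exists (tadd (tscale a s) t); rewrite ?tclsD ?tclsZ //; do !constructor.
Qed.

Lemma pres_homog_mul a b x y :
  pres_homog a x -> pres_homog b y -> pres_homog (a (+) b) (pres_mul x y).
Proof.
move=> [s hs <-] [t ht <-]; exists (tmul s t); last by rewrite tclsM.
by constructor.
Qed.

Lemma pres_homog_sum x : exists x0 x1,
  [/\ pres_homog false x0, pres_homog true x1 & x = x0 + x1].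
Proof.
elim/tcls_ind: x => t.
have hD b := subspaceD (pres_homog_subspace b).
elim: t => [x||s [s0 [s1 [hs0 hs1 es]]] t [t0 [t1 [ht0 ht1 et]]]|
  c t [t0 [t1 [ht0 ht1 et]]]|s [s0 [s1 [hs0 hs1 es]]] t [t0 [t1 [ht0 ht1 et]]]].
- have [t0 [t1 [h0 h1 /tclsP e]]] := gen_split x.
  by exists (tcls t0), (tcls t1); split; [exists t0 | exists t1 | rewrite -tclsD].
- have z b : pres_homog b 0 by exists tzero => //; constructor.
  by exists 0, 0; rewrite tcls0 addr0.
- exists (s0 + t0), (s1 + t1); split; [exact: hD | exact: hD |].
  by rewrite tclsD es et addrACA.
- exists (c *: t0), (c *: t1); split; try exact/subspaceZ/pres_homog_subspace.
    by apply: subspaceZ => //; apply: pres_homog_subspace.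
  by apply: subspaceZ => //; apply: pres_homog_subspace.
  by rewrite tclsZ et scalerDr.
- exists (pres_mul s0 t0 + pres_mul s1 t1), (pres_mul s0 t1 + pres_mul s1 t0).
  split.
  + by apply: hD; [apply: (pres_homog_mul hs0 ht0) |
      apply: (pres_homog_mul hs1 ht1)].
  + by apply: hD; [apply: (pres_homog_mul hs0 ht1) |
      apply: (pres_homog_mul hs1 ht0)].
  + rewrite tclsM es et.
    by rewrite pres_mulDl !pres_mulDr [pres_mul s1 t0 + _]addrC addrACA.
Qed.

Lemma pres_homog_cap x : pres_homog false x -> pres_homog true x -> x = 0.
Proof.
move=> [s hs <-] [t ht /esym].
have [f [fh fs fr]] := gen_parity_aut P.
have hsub u v : cong u v -> cong (tsubst f u) (tsubst f v).
  elim=> //=; try by [move=> *; constructor].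
  - by move=> u0 u1 u2 _ h1 _ h2; apply: tcong_trans h1 h2.
have sgn b u : hom b u -> tcls (tsubst f u) = (-1) ^+ b *: tcls u.
  elim=> {b u} /=.
  - by move=> b y /fs /tclsP; rewrite tclsZ.
  - by move=> b; rewrite tcls0 scaler0.
  - by move=> b u v _ e1 _ e2; rewrite !tclsD e1 e2 scalerDr.
  - by move=> b c u _ e; rewrite !tclsZ e !scalerA mulrC.
  - move=> a b u v _ e1 _ e2; rewrite !tclsM e1 e2 pres_mulZl pres_mulZr.
    by rewrite scalerA -signr_addb.
move=> e; have /tclsP := hsub _ _ ((proj1 (tclsP _ _)) e).
rewrite (sgn _ _ hs) (sgn _ _ ht) expr0 scale1r expr1 scaleN1r e => /eqP.
rewrite -subr_eq0 opprK -mulr2n -scaler_nat scaler_eq0 pnatr_eq0 /=.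
by move=> /eqP.
Qed.

HB.instance Definition _ := Lmodule_isSuper.Build K presented
  pres_homog_subspace pres_homog_sum pres_homog_cap.

End Presented.

Lemma tsubst_homog (K : pzRingType) (G : Type) (gp : bool -> G -> Prop)
    (f : G -> term K G) b t :
  (forall c x, gp c x -> thomog gp c (f x)) ->
  thomog gp b t -> thomog gp b (tsubst f t).
Proof.
move=> hf; elim=> {b t} /= *; [exact: hf | exact: thomog_zero |
  exact: thomog_add | exact: thomog_scale | exact: thomog_mul].
Qed.

Definition is_ideal (K : pzRingType) (g : lieSuperType K) (I : set g) :=
  [/\ subspace I, graded I
    & forall x y, I y -> I [< x, y >] /\ I [< y, x >]].

Inductive cgen (n : nat) := gen_e of 'I_n | gen_f of 'I_n | gen_h of 'I_n.

Definition cgen_par n (b : bool) (x : cgen n) : Prop :=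
  if x is gen_h _ then b = false else b = true.

(** The generators [gen_e i] and [gen_f i] are all odd. The Cartan subalgebra is
    taken to be spanned by the [h_i], as is right for an invertible matrix. *)
Section Contragredient.
Variables (K : numFieldType) (n : nat) (A : 'M[K]_n).
Local Notation T := (term K (cgen n)).
Local Notation hom := (thomog (@cgen_par n)).
Local Notation e i := (@tgen K _ (gen_e i)).
Local Notation f i := (@tgen K _ (gen_f i)).
Local Notation h i := (@tgen K _ (gen_h i)).

Inductive crel : T -> T -> Prop :=
| crel_skew a b s t : hom a s -> hom b t ->
    crel (tmul s t) (tscale (- (-1) ^+ (a && b)) (tmul t s))
| crel_jacobi a b s t u : hom a s -> hom b t ->
    crel (tmul s (tmul t u))
         (tadd (tmul (tmul s t) u)
               (tscale ((-1) ^+ (a && b)) (tmul t (tmul s u))))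
| crel_hh i j : crel (tmul (h i) (h j)) tzero
| crel_ef i j : crel (tmul (e i) (f j)) (if i == j then h i else tzero)
| crel_he i j : crel (tmul (h i) (e j)) (tscale (A i j) (e j))
| crel_hf i j : crel (tmul (h i) (f j)) (tscale (- A i j) (f j)).

Fact cgen_split (x : cgen n) : exists t0 t1,
  [/\ hom false t0, hom true t1 & tcong crel (tgen x) (tadd t0 t1)].
Proof.
have c0 (t : T) : tcong crel t (tadd tzero t).
  by apply: tcong_sym; apply: tcong_add0.
case: x => i; [exists tzero, (e i) | exists tzero, (f i) | exists (h i), tzero];
  split; try exact: c0; try exact: thomog_zero; try exact: thomog_gen.
by apply: tcong_trans (c0 _) _; apply: tcong_addC.
Qed.

Fact cgen_parity_aut : exists s : cgen n -> T,
  [/\ forall b x, cgen_par b x -> hom b (s x),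
      forall b x, cgen_par b x ->
        tcong crel (s x) (tscale ((-1) ^+ b) (tgen x))
    & forall t u, crel t u -> tcong crel (tsubst s t) (tsubst s u)].
Proof.
pose s (x : cgen n) : T :=
  if x is gen_h _ then tgen x else tscale (-1) (tgen x).
have hs b x : cgen_par b x -> hom b (s x).
  by case: x => i /= h; try apply: thomog_scale; apply: thomog_gen.
exists s; split=> // [b [i|i|i] /= ->|t u]; rewrite ?expr1 ?expr0.
- exact: tcong_refl.
- exact: tcong_refl.
- by apply: tcong_sym; apply: tcong_scale1.
have N (c : K) (w : T) : tcong crel (tscale (-1) (tscale c w))
                                    (tscale c (tscale (-1) w)).
  apply: tcong_trans (tcong_scaleA _ _ _ _) _.
  by rewrite mulrC; apply: tcong_sym; apply: tcong_scaleA.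
case=> [a b {}t {}u ht hu|a b {}t {}u v ht hu|i j|i j|i j|i j] /=.
- by apply: tcong_rel; apply: crel_skew; apply: tsubst_homog.
- by apply: tcong_rel; apply: crel_jacobi; apply: tsubst_homog.
- by apply: tcong_rel; apply: crel_hh.
- apply: tcong_trans (tcong_mulZl _ _ _ _) _.
  apply: tcong_trans (tcong_scale _ (tcong_mulZr _ _ _ _)) _.
  apply: tcong_trans (tcong_scaleA _ _ _ _) _.
  rewrite mulrNN mulr1; apply: tcong_trans (tcong_scale1 _ _) _.
  by apply: tcong_trans (tcong_rel (crel_ef i j)) _; case: eqP => _ /=;
    apply: tcong_refl.
- apply: tcong_trans (tcong_mulZr _ _ _ _) _.
  by apply: tcong_trans (tcong_scale _ (tcong_rel (crel_he i j))) _; apply: N.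
- apply: tcong_trans (tcong_mulZr _ _ _ _) _.
  by apply: tcong_trans (tcong_scale _ (tcong_rel (crel_hf i j))) _; apply: N.
Qed.

Definition cpres : presentation K := Presentation cgen_split cgen_parity_aut.

(** The Lie superalgebra presented by the [e_i], [f_i], [h_i] and the
    relations of the Cartan matrix, before dividing by the maximal ideal. *)
Definition pre_contragredient : Type := presented cpres.
Local Notation gt := pre_contragredient.
HB.instance Definition _ := SuperLmodule.on gt.

Fact cpres_skew (a b : bool) (x y : gt) : homog a x -> homog b y ->
  pres_mul x y = - ((-1) ^+ (a && b) *: pres_mul y x).
Proof.
move=> [s hs <-] [t ht <-].
rewrite -!tclsM -scaleNr -tclsZ; apply/tclsP.
by apply: tcong_rel; apply: crel_skew.
Qed.

Fact cpres_jacobi (a b : bool) (x y z : gt) : homog a x -> homog b y ->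
  pres_mul x (pres_mul y z) =
  pres_mul (pres_mul x y) z + (-1) ^+ (a && b) *: pres_mul y (pres_mul x z).
Proof.
move=> [s hs <-] [t ht <-]; elim/tcls_ind: z => u.
rewrite -[pres_mul (tcls t) (tcls u)]tclsM -[pres_mul (tcls s) (tcls t)]tclsM.
rewrite -[pres_mul (tcls s) (tcls u)]tclsM -3!tclsM.
transitivity (tcls (P := cpres) (tadd (tmul (tmul s t) u)
    (tscale ((-1) ^+ (a && b)) (tmul t (tmul s u))))).
  by apply/tclsP; apply: tcong_rel; apply: crel_jacobi.
by rewrite tclsD tclsZ.
Qed.

HB.instance Definition _ := SuperLmodule_isLieSuper.Build K gt
  (@pres_mul_linearl _ _) (@pres_mul_linearr _ _)
  (fun a b x y => @pres_homog_mul _ _ a b x y) cpres_skew cpres_jacobi.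

Definition pre_cartan (c : 'cV[K]_n) : gt :=
  \sum_i c i 0 *: (tcls (P := cpres) (h i) : gt).

Definition cartan_free (I : set gt) := I `&` range pre_cartan `<=` [set 0].

(** [contragredient A] is the quotient by the sum of all the ideals that
    intersect the Cartan subalgebra trivially. *)
Definition null_ideals : set gt :=
  \bigcup_(I in [set I | is_ideal I /\ cartan_free I]) I.

Definition contragredient : Type := quo null_ideals.
Local Notation g := contragredient.
HB.instance Definition _ := GRing.Lmodule.on g.

Lemma null_ideals_graded : graded (lspan null_ideals).
Proof.
apply: lspan_graded => b v [I [hI hc] hv]; apply: sub_lspan.
by exists I => //; case: hI => _ hg _; apply: hg.
Qed.

HB.instance Definition _ := Lmodule_isSuper.Build K g
  (@quo_homog_subspace _ _ null_ideals) (@quo_homog_sum _ _ null_ideals)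
  (fun x => @quo_homog_cap _ _ null_ideals x null_ideals_graded).

Definition contra_bracket (x y : g) : g :=
  cls null_ideals [< repr x, repr y >].

Let N := lspan_subspace null_ideals.

Lemma null_ideals_ideal (x y : gt) : lspan null_ideals y ->
  lspan null_ideals [< x, y >] /\ lspan null_ideals [< y, x >].
Proof.
apply: (@lspan_min _ _ null_ideals [set y |
  lspan null_ideals [< x, y >] /\ lspan null_ideals [< y, x >]]); last first.
  move=> u [I [hI hc] hu]; have [_ _ /(_ x u hu) [h1 h2]] := hI.
  by split; apply: sub_lspan; exists I.
have z1 : [< x, 0 >] = 0 by apply: pres_mul0r.
have z2 : [< 0, x >] = 0 by apply: pres_mul0l.
split=> /= [|a u v [hu hu'] [hv hv']].
  by rewrite z1 z2; case: N.
by rewrite bracket_linearr bracket_linearl; split; case: N => _; apply.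
Qed.

Lemma contra_bracketE u v :
  contra_bracket (cls null_ideals u) (cls null_ideals v) =
  cls null_ideals [< u, v >].
Proof.
apply/clsP; set u' := repr _; set v' := repr _.
have -> : [< u', v' >] - [< u, v >] = [< u' - u, v' >] + [< u, v' - v >].
  have BN x y : [< - x, y >] = - [< x, y >] :> gt.
    by rewrite -[- x]scaleN1r -scaleN1r; apply: pres_mulZl.
  have NB x y : [< y, - x >] = - [< y, x >] :> gt.
    by rewrite -[- x]scaleN1r -scaleN1r; apply: pres_mulZr.
  have -> : [< u' - u, v' >] = [< u', v' >] - [< u, v' >].
    by rewrite -BN; apply: pres_mulDl.
  have -> : [< u, v' - v >] = [< u, v' >] - [< u, v >].
    by rewrite -NB; apply: pres_mulDr.
  by rewrite addrA subrK.
apply: (subspaceD N).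
  by apply: (proj2 (null_ideals_ideal _ _)); apply: cls_repr.
by apply: (proj1 (null_ideals_ideal _ _)); apply: cls_repr.
Qed.

Fact contra_bracket_linearl (a : K) (x y z : g) :
  contra_bracket (a *: x + y) z =
  a *: contra_bracket x z + contra_bracket y z.
Proof.
elim/cls_ind: x => x; elim/cls_ind: y => y; elim/cls_ind: z => z.
rewrite -[a *: cls _ x]clsZ -[cls _ (a *: x) + _]clsD !contra_bracketE.
by rewrite bracket_linearl [LHS]clsD clsZ.
Qed.

Fact contra_bracket_linearr (a : K) (x y z : g) :
  contra_bracket z (a *: x + y) =
  a *: contra_bracket z x + contra_bracket z y.
Proof.
elim/cls_ind: x => x; elim/cls_ind: y => y; elim/cls_ind: z => z.
rewrite -[a *: cls _ x]clsZ -[cls _ (a *: x) + _]clsD !contra_bracketE.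
by rewrite bracket_linearr [LHS]clsD clsZ.
Qed.

Fact contra_bracket_homog (a b : bool) (x y : g) :
  homog a x -> homog b y -> homog (a (+) b) (contra_bracket x y).
Proof.
move=> [u hu <-] [v hv <-]; rewrite contra_bracketE.
by exists [< u, v >] => //; apply: bracket_homog.
Qed.

Fact contra_bracket_skew (a b : bool) (x y : g) : homog a x -> homog b y ->
  contra_bracket x y = - ((-1) ^+ (a && b) *: contra_bracket y x).
Proof.
move=> [u hu <-] [v hv <-]; rewrite !contra_bracketE.
by rewrite (bracket_skew hu hv) [LHS]clsN clsZ.
Qed.

Fact contra_bracket_jacobi (a b : bool) (x y z : g) : homog a x -> homog b y ->
  contra_bracket x (contra_bracket y z) =
  contra_bracket (contra_bracket x y) z +
  (-1) ^+ (a && b) *: contra_bracket y (contra_bracket x z).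
Proof.
move=> [u hu <-] [v hv <-]; elim/cls_ind: z => w; have e := contra_bracketE.
rewrite (e v w) (e u v) (e u w) (e _ w) (e u) (e v).
by rewrite (bracket_jacobi w hu hv) [LHS]clsD clsZ.
Qed.

HB.instance Definition _ := SuperLmodule_isLieSuper.Build K g
  contra_bracket_linearl contra_bracket_linearr contra_bracket_homog
  contra_bracket_skew contra_bracket_jacobi.

(** The element [\sum_i c_i h_i] of the Cartan subalgebra. Functionals on the
    Cartan subalgebra are row vectors, [mu] taking the value [mu *m c] on it. *)
Definition cartan (c : 'cV[K]_n) : g := cls null_ideals (pre_cartan c).

Lemma pre_cartan_even c : homog false (pre_cartan c).
Proof.
apply: (subspace_sum _ (homog_subspace (s := gt) false)) => i.
apply: (subspaceZ _ (homog_subspace (s := gt) false)).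
by exists (h i) => //; constructor.
Qed.

Lemma cartan_even c : homog false (cartan c).
Proof. by exists (pre_cartan c) => //; apply: pre_cartan_even. Qed.

End Contragredient.

Section Enveloping.
Variables (K : numFieldType) (g : lieSuperType K).
Local Notation T := (term K (option g)).
Local Notation i x := (@tgen K (option g) (Some x)).
Local Notation one := (@tgen K (option g) None).

Definition upar (b : bool) (x : option g) : Prop :=
  if x is Some y then homog b y else b = false.

Inductive urel : T -> T -> Prop :=
| urel_mulA s t u : urel (tmul s (tmul t u)) (tmul (tmul s t) u)
| urel_mul1l t : urel (tmul one t) t
| urel_mul1r t : urel (tmul t one) t
| urel_linear a x y : urel (i (a *: x + y)) (tadd (tscale a (i x)) (i y))
| urel_bracket a b x y : homog a x -> homog b y ->
    urel (i [< x, y >])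
         (tadd (tmul (i x) (i y))
               (tscale (- (-1) ^+ (a && b)) (tmul (i y) (i x)))).

Fact ugen_split (x : option g) : exists t0 t1,
  [/\ thomog upar false t0, thomog upar true t1
    & tcong urel (tgen x) (tadd t0 t1)].
Proof.
case: x => [x|]; last first.
  exists one, tzero; split; try by constructor.
  apply: tcong_trans (tcong_addC _ _ _).
  by apply: tcong_sym; apply: tcong_add0.
exists (i (part false x)), (i (part true x)); split.
- by constructor; apply: part_homog.
- by constructor; apply: part_homog.
rewrite {1}[x]part_sum -[part false x in X in tcong _ X _]scale1r.
apply: tcong_trans (tcong_rel (urel_linear _ _ _)) _.
by apply: tcong_add; [apply: tcong_scale1 | apply: tcong_refl].
Qed.

Definition parity_map (x : g) : g := part false x - part true x.

Lemma parity_map_linear a x y :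
  parity_map (a *: x + y) = a *: parity_map x + parity_map y.
Proof. by rewrite /parity_map !part_linear scalerBr opprD addrACA. Qed.

Lemma parity_map_homog b x : homog b x -> parity_map x = (-1) ^+ b *: x.
Proof.
move=> /part_homogE [e0 e1]; rewrite /parity_map e0 e1.
by case: b {e0 e1}; rewrite ?sub0r ?subr0 ?scaleN1r ?expr0 ?scale1r.
Qed.

Fact ugen_parity_aut : exists s : option g -> T,
  [/\ forall b x, upar b x -> thomog upar b (s x),
      forall b x, upar b x -> tcong urel (s x) (tscale ((-1) ^+ b) (tgen x))
    & forall t u, urel t u -> tcong urel (tsubst s t) (tsubst s u)].
Proof.
pose s (x : option g) : T :=
  if x is Some y then i (parity_map y) else one.
have iZ a x : tcong urel (i (a *: x)) (tscale a (i x)).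
  have i0 : tcong urel (i 0) tzero.
    have := tcong_rel (urel_linear (-1) 0 0).
    rewrite scaler0 addr0 => h.
    by apply: tcong_trans h _; apply: tcong_addN.
  have := tcong_rel (urel_linear a x 0); rewrite addr0 => h.
  apply: tcong_trans h _.
  apply: tcong_trans (tcong_add (tcong_refl _ _) i0) _.
  by apply: tcong_trans (tcong_addC _ _ _) _; apply: tcong_add0.
have Zpar b x : homog b x -> homog b (parity_map x).
  move=> hx; rewrite (parity_map_homog hx).
  by apply: (subspaceZ _ (homog_subspace (s := g) b)).
exists s; split.
- by move=> b [x /Zpar hx|hb]; constructor.
- move=> b [x|] /= => [hx|->].
    by rewrite (parity_map_homog hx); apply: iZ.
  by rewrite expr0; apply: tcong_sym; apply: tcong_scale1.
move=> t u; case=> [{}t {}u v|{}t|{}t|a x y|a b x y hx hy] /=.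
- by apply: tcong_rel; apply: urel_mulA.
- by apply: tcong_rel; apply: urel_mul1l.
- by apply: tcong_rel; apply: urel_mul1r.
- by rewrite parity_map_linear; apply: tcong_rel; apply: urel_linear.
have -> : parity_map [< x, y >] = [< parity_map x, parity_map y >].
  rewrite (parity_map_homog (bracket_homog hx hy)).
  rewrite (parity_map_homog hx) (parity_map_homog hy) signr_addb -scalerA.
  have z1 (z : g) : [< z, 0 >] = 0.
    have := bracket_linearr (-1) 0 0 z.
    by rewrite scaler0 addr0 scaleN1r addNr.
  have z2 (z : g) : [< 0, z >] = 0.
    have := bracket_linearl (-1) 0 0 z.
    by rewrite scaler0 addr0 scaleN1r addNr.
  have := bracket_linearl ((-1) ^+ a) x 0 ((-1) ^+ b *: y).
  rewrite z2 !addr0 => ->.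
  by have := bracket_linearr ((-1) ^+ b) y 0 x; rewrite z1 !addr0 => ->.
by apply: tcong_rel; apply: urel_bracket; apply: Zpar.
Qed.

Definition upres : presentation K := Presentation ugen_split ugen_parity_aut.

Definition enveloping : Type := presented upres.
Local Notation U := enveloping.
HB.instance Definition _ := SuperLmodule.on U.

Definition uone : U := tcls (P := upres) one.

Fact umulA : associative (@pres_mul K upres).
Proof.
elim/tcls_ind => s; elim/tcls_ind => t; elim/tcls_ind => u.
rewrite !pres_mulE; apply/tclsP; apply: tcong_rel; exact: urel_mulA.
Qed.
Fact umul1l : left_id uone (@pres_mul K upres).
Proof.
elim/tcls_ind => t; rewrite pres_mulE.
by apply/tclsP; apply: tcong_rel; apply: urel_mul1l.
Qed.
Fact umul1r : right_id uone (@pres_mul K upres).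
Proof.
elim/tcls_ind => t; rewrite pres_mulE.
by apply/tclsP; apply: tcong_rel; apply: urel_mul1r.
Qed.
Fact umulDl : left_distributive (@pres_mul K upres) +%R.
Proof. by move=> x y z; apply: pres_mulDl. Qed.
Fact umulDr : right_distributive (@pres_mul K upres) +%R.
Proof. by move=> x y z; apply: pres_mulDr. Qed.

(** Only used to see that [enveloping] is not the zero ring. *)
Fixpoint counit (t : T) : K :=
  match t with
  | tgen x => if x is Some _ then 0 else 1
  | tzero => 0
  | tadd s t => counit s + counit t
  | tscale c t => c * counit t
  | tmul s t => counit s * counit t
  end.

Fact uone_neq0 : uone != 0.
Proof.
apply/eqP => /tclsP h.
suff : counit one = counit tzero by move=> /eqP; rewrite oner_eq0.
elim: h => {} //=.
- move=> s t; case=> //= *; rewrite ?mulrA ?mul1r ?mulr1 ?mulr0 ?addr0 //.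
- by move=> t s u _ -> _ ->.
- by move=> s s' t t' _ -> _ ->.
- by move=> c t t' _ ->.
- by move=> s s' t t' _ -> _ ->.
- by move=> *; rewrite addrA.
- by move=> *; rewrite addrC.
- by move=> *; rewrite add0r.
- by move=> *; rewrite mulN1r addNr.
- by move=> *; rewrite mulrA.
- by move=> *; rewrite mul1r.
- by move=> *; rewrite mulrDr.
- by move=> *; rewrite mulrDl.
- by move=> *; rewrite mulrDl.
- by move=> *; rewrite mulrDr.
- by move=> *; rewrite mulrA.
- by move=> *; rewrite mulrCA.
Qed.

HB.instance Definition _ := GRing.Zmodule_isNzRing.Build U
  umulA umul1l umul1r umulDl umulDr uone_neq0.

Fact uscaleAl (a : K) (x y : U) : a *: (x * y) = (a *: x) * y.
Proof. by rewrite [RHS](@pres_mulZl K upres a x y). Qed.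
HB.instance Definition _ := GRing.Lmodule_isLalgebra.Build K U uscaleAl.

Fact uscaleAr (a : K) (x y : U) : a *: (x * y) = x * (a *: y).
Proof. by rewrite [RHS](@pres_mulZr K upres a y x). Qed.
HB.instance Definition _ := GRing.Lalgebra_isAlgebra.Build K U uscaleAr.

Definition iota (x : g) : U := tcls (P := upres) (i x).

Lemma iota_linear a x y : iota (a *: x + y) = a *: iota x + iota y.
Proof.
rewrite /iota -[RHS]/(a *: tcls (P := upres) (i x) + tcls (P := upres) (i y)).
rewrite -tclsZ -tclsD; apply/tclsP; apply: tcong_rel; exact: urel_linear.
Qed.

Lemma iota_homog b x : homog b x -> homog b (iota x).
Proof. by move=> hx; exists (i x) => //; constructor. Qed.

Lemma iota_bracket a b x y : homog a x -> homog b y ->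
  iota [< x, y >] = iota x * iota y - (-1) ^+ (a && b) *: (iota y * iota x).
Proof.
move=> hx hy; transitivity (tcls (P := upres) (tadd (tmul (i x) (i y))
    (tscale (- (-1) ^+ (a && b)) (tmul (i y) (i x))))).
  by apply/tclsP; apply: tcong_rel; apply: urel_bracket.
by rewrite tclsD tclsZ !tclsM scaleNr.
Qed.

Lemma umul_homog a b (x y : U) : homog a x -> homog b y -> homog (a (+) b) (x * y).
Proof. exact: (@pres_homog_mul K upres a b x y). Qed.

End Enveloping.

Section Verma.
Variables (K : numFieldType) (n : nat) (A : 'M[K]_n).
Local Notation g := (contragredient A).
Local Notation U := (enveloping g).
Implicit Types (mu lam : 'rV[K]_n) (P : set 'rV[K]_n) (Pi : seq 'rV[K]_n).

Definition root_space mu : set g :=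
  [set x | forall c, [< cartan A c, x >] = (mu *m c) 0 0 *: x].

Definition is_root : set 'rV[K]_n :=
  [set mu | mu != 0 /\ exists2 x : g, x != 0 & root_space mu x].

Definition nat_span Pi : set 'rV[K]_n :=
  [set mu | exists k : 'rV[K]_n -> nat, mu = \sum_(b <- Pi) b *+ k b].

Definition is_simple_roots Pi :=
  [/\ free Pi, forall b, b \in Pi -> is_root b
    & forall mu, is_root mu -> nat_span Pi mu \/ nat_span Pi (- mu)].

Definition is_positive_roots P :=
  exists2 Pi, is_simple_roots Pi & P = is_root `&` nat_span Pi.

Definition n_plus P : set g := lspan (\bigcup_(mu in P) root_space mu).

(** In [U(g) \otimes_{U(h + n^+)} C_lam] the second factor is a line on which
    [cartan c + y], with [y] in [n^+], acts by the scalar [lam *m c]; the tensor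
    product over [C] is thus [U(g)], and [verma_rel] consists of the relations
    [u x \otimes 1 = u \otimes x 1] for [x] in [h + n^+]. *)
Definition verma_rel P lam : set U :=
  [set w | exists u c y, n_plus P y /\
     w = u * iota (cartan A c + y) - (lam *m c) 0 0 *: u].

Definition verma P lam : Type := quo (verma_rel P lam).
HB.instance Definition _ P lam := GRing.Lmodule.on (verma P lam).

Lemma root_space_subspace mu : subspace (root_space mu).
Proof.
split=> [c|a x y hx hy c].
  have := bracket_linearr (-1) 0 0 (cartan A c).
  by rewrite !scaler0 addr0 scaleN1r addNr.
by rewrite bracket_linearr hx hy scalerDr !scalerA mulrC.
Qed.

Lemma root_space_graded mu : graded (root_space mu).
Proof.
move=> b v hv c; have hh := cartan_even A c.
have e : [< cartan A c, v >] =
  [< cartan A c, part false v >] + [< cartan A c, part true v >].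
  rewrite {1}[v]part_sum -[X in [< _, X + _ >]]scale1r.
  by rewrite bracket_linearr scale1r.
have [] : [< cartan A c, part false v >] = (mu *m c) 0 0 *: part false v /\
          [< cartan A c, part true v >] = (mu *m c) 0 0 *: part true v.
  apply: homog_split_uniq.
  - exact: (bracket_homog hh (part_homog false v)).
  - exact: (bracket_homog hh (part_homog true v)).
  - exact: (subspaceZ _ (homog_subspace (s := g) _) (part_homog _ _)).
  - exact: (subspaceZ _ (homog_subspace (s := g) _) (part_homog _ _)).
  by rewrite -e hv -scalerDr -part_sum.
by case: b.
Qed.

Lemma n_plus_graded P : graded (n_plus P).
Proof.
apply: lspan_graded => b v [mu hmu hv]; apply: sub_lspan.
by exists mu => //; apply: root_space_graded.
Qed.

Lemma verma_rel_graded P lam : graded (lspan (verma_rel P lam)).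
Proof.
apply: lspan_graded => b _ [u [c [y [hy ->]]]].
set X := lspan _; have hX : subspace X by apply: lspan_subspace.
have iD (x z : g) : iota (x + z) = iota x + iota z.
  by rewrite -[x in LHS]scale1r iota_linear scale1r.
set h := iota (cartan A c); set l := (lam *m c) 0 0.
have hh : homog false h by apply/iota_homog/cartan_even.
pose y' b := part b y; pose u' b := part b u.
have i0 : iota (0 : g) = 0.
  by have := iota_linear (-1) (0 : g) 0; rewrite scaler0 addr0 scaleN1r addNr.
have hy' b' : n_plus P (y' b') by apply: n_plus_graded.
have X1 b' : X (u' b' * h - l *: u' b').
  apply: sub_lspan; exists (u' b'), c, 0; split; last by rewrite addr0.
  by case: (lspan_subspace (\bigcup_(mu in P) root_space mu)).
have c0 : cartan A 0 = 0.
  rewrite /cartan /pre_cartan big1 ?cls0 // => j _.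
  by rewrite mxE scale0r.
have X2 a b' : X (u' a * iota (y' b')).
  apply: sub_lspan; exists (u' a), 0, (y' b'); split=> //.
  by rewrite c0 add0r mulmx0 mxE scale0r subr0.
pose w b := u' b * h - l *: u' b +
  (u' b * iota (y' false) + u' (~~ b) * iota (y' true)).
have hw a : homog a (w a).
  have hW : subspace (@homog _ U a) by apply: homog_subspace.
  have hu d : homog d (u' d) by apply: part_homog.
  have hiy d : homog d (iota (y' d)) by apply/iota_homog/part_homog.
  apply: (subspaceD hW); first apply: (subspaceB hW).
  - by have := umul_homog (hu a) hh; rewrite addbF.
  - exact: (subspaceZ _ hW).
  apply: (subspaceD hW).
  - by have := umul_homog (hu a) (hiy false); rewrite addbF.
  - by have := umul_homog (hu (~~ a)) (hiy true); rewrite addbT negbK.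
have Xw a : X (w a).
  apply: (subspaceD hX); first exact: X1.
  by apply: (subspaceD hX); apply: X2.
have -> : u * iota (cartan A c + y) - l *: u = w false + w true.
  have eu : u = u' false + u' true by apply: part_sum.
  have ey : iota y = iota (y' false) + iota (y' true).
    by rewrite -iD -part_sum.
  have e1 : u * h - l *: u =
      (u' false * h - l *: u' false) + (u' true * h - l *: u' true).
    by rewrite {1 2}eu mulrDl scalerDr opprD addrACA.
  have e2 : u * iota y =
      (u' false * iota (y' false) + u' true * iota (y' true)) +
      (u' true * iota (y' false) + u' false * iota (y' true)).
    rewrite ey {1}eu mulrDl !mulrDr.
    by rewrite [u' true * _ + _ in LHS]addrC addrACA [X in _ + X]addrC.
  by rewrite iD mulrDr addrAC e1 e2 addrACA.
have [e0 e1] := part_unique (hw false) (hw true).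
by case: b; rewrite ?e0 ?e1; apply: Xw.
Qed.

HB.instance Definition _ P lam := Lmodule_isSuper.Build K (verma P lam)
  (@quo_homog_subspace _ _ (verma_rel P lam))
  (@quo_homog_sum _ _ (verma_rel P lam))
  (fun x => @quo_homog_cap _ _ (verma_rel P lam) x
              (verma_rel_graded (P := P) (lam := lam))).

Section Action.
Variables (P : set 'rV[K]_n) (lam : 'rV[K]_n).
Local Notation V := (verma P lam).
Local Notation S := (verma_rel P lam).

Definition verma_act (x : g) (m : V) : V := cls S (iota x * repr m).

Lemma verma_rel_mul (w v : U) : lspan S v -> lspan S (w * v).
Proof.
have hX := lspan_subspace S.
apply: (@lspan_min _ _ S [set v | lspan S (w * v)]) => /=.
  split=> [|a x y hx hy]; first by rewrite /= mulr0; case: hX.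
  by rewrite /= mulrDr -scalerAr; case: hX => _; apply.
move=> _ [u [c [y [hy ->]]]]; apply: sub_lspan; exists (w * u), c, y.
by split=> //; rewrite mulrBr mulrA -scalerAr.
Qed.

Lemma verma_actE x u : verma_act x (cls S u) = cls S (iota x * u).
Proof.
by apply/clsP; rewrite -mulrBr; apply: verma_rel_mul; apply: cls_repr.
Qed.

Fact verma_act_linearl (a : K) (x y : g) (m : V) :
  verma_act (a *: x + y) m = a *: verma_act x m + verma_act y m.
Proof.
elim/cls_ind: m => u; rewrite !verma_actE iota_linear mulrDl -scalerAl.
by rewrite [LHS]clsD clsZ.
Qed.

Fact verma_act_linearr (a : K) (x : g) (m m' : V) :
  verma_act x (a *: m + m') = a *: verma_act x m + verma_act x m'.
Proof.
elim/cls_ind: m => u; elim/cls_ind: m' => v.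
rewrite -[a *: cls _ u]clsZ -[cls _ (a *: u) + _]clsD !verma_actE.
by rewrite mulrDr -scalerAr [LHS]clsD clsZ.
Qed.

Fact verma_act_homog (a b : bool) (x : g) (m : V) :
  homog a x -> homog b m -> homog (a (+) b) (verma_act x m).
Proof.
move=> hx [u hu <-]; rewrite verma_actE; exists (iota x * u) => //.
by apply: umul_homog => //; apply: iota_homog.
Qed.

Fact verma_act_bracket (a b : bool) (x y : g) (m : V) :
  homog a x -> homog b y ->
  verma_act [< x, y >] m = verma_act x (verma_act y m)
    - (-1) ^+ (a && b) *: verma_act y (verma_act x m).
Proof.
move=> hx hy; elim/cls_ind: m => u; have e := verma_actE.
rewrite (e _ u) (e y u) (e x u) (e x) (e y) (iota_bracket hx hy) mulrBl.
by rewrite -scalerAl -!mulrA [LHS]clsB clsZ.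
Qed.

HB.instance Definition _ := SuperLmodule_isLieSuperModule.Build K g V
  verma_act_linearl verma_act_linearr verma_act_homog verma_act_bracket.

End Action.

Section WeightModules.
Variable M : lieSuperModType g.

Definition weight_space mu : set M :=
  [set m | forall c, act (cartan A c) m = (mu *m c) 0 0 *: m].

Definition graded_weight_space (i : bool) mu : set M :=
  homog i `&` weight_space mu.

(** [M] is the (internal) direct sum of its weight spaces. *)
Definition weight_module :=
  (forall m : M, exists (s : seq 'rV[K]_n) (v : 'rV[K]_n -> M),
     (forall mu, weight_space mu (v mu)) /\ m = \sum_(mu <- s) v mu) /\
  (forall (s : seq 'rV[K]_n) (v : 'rV[K]_n -> M), uniq s ->
     (forall mu, weight_space mu (v mu)) -> \sum_(mu <- s) v mu = 0 ->
     forall mu, mu \in s -> v mu = 0).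

Definition bounded_module :=
  weight_module /\
  exists c : nat, forall mu, exists2 d, has_dim (weight_space mu) d & (d < c)%N.

Definition max_dim (W : 'rV[K]_n -> set M) (d : nat) :=
  (forall mu, exists2 k, has_dim (W mu) k & (k <= d)%N) /\
  (exists mu, has_dim (W mu) d).

Definition has_degree (d : nat) := max_dim weight_space d.

Definition has_graded_degree (d0 d1 : nat) :=
  max_dim (graded_weight_space false) d0 /\
  max_dim (graded_weight_space true) d1.

End WeightModules.

End Verma.

Definition D21_matrix (K : fieldType) (alpha : K) : 'M[K]_3 :=
  \matrix_(i, j) nth 0 (nth [::]
    [:: [:: 0;     1;            alpha       ];
        [:: 1;     0;            - alpha - 1 ];
        [:: alpha; - alpha - 1;  0           ]] i) j.

(* Main.v *)
Require Import Defs.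
From mathcomp Require Import all_boot all_order all_algebra.
From mathcomp Require Import complex ring zify.
From mathcomp Require Import boolp classical_sets reals.
Import Defs.

(** The even and odd low (negative) root vectors, in a fixed order, give by the
    PBW theorem a basis of the Verma module: a product of powers of the three
    even ones times a product over a subset [S] of the four odd ones. In
    coordinates where the even roots are [2 eps_k] and [- 2 eps_k] and the odd ones
    [(+-1, +-1, +-1)], the weight and [S] determine the three exponents, and the
    weight determines the parity of [#|S|]. So a weight space has dimension at most
    8, is purely even or purely odd, and has dimension 8 deep inside the cone.

    PBW is proved by Bergman's diamond lemma, dually: every functional on the
    normal words extends to one on all words that respects the relations of the
    enveloping algebra. The contragredient superalgebra is computed from an
    explicit 17-dimensional model: by the triangular decomposition of the presented
    superalgebra and the nondegeneracy of the pairing of opposite root vectors of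
    the model, the kernel of the map to the model is the sum of the ideals meeting
    the Cartan subalgebra trivially. *)

Set Implicit Arguments.
Unset Strict Implicit.
Unset Printing Implicit Defensive.

Import Order.TTheory GRing.Theory Num.Theory.
Local Open Scope classical_set_scope.
Local Open Scope ring_scope.
Local Open Scope super_scope.

(** * Words and redexes *)

(** Two objects come without a basis: the enveloping algebra, a quotient of terms, and the
    contragredient superalgebra, a quotient by a sum of unspecified ideals. Independence is
    therefore shown by maps out of the quotient. Scalar functionals suffice for this, so confluence
    becomes an identity between numbers, with the super Jacobi identity as its content. A functional
    that reads off one low word and evaluates the other letters by the highest weight descends to
    the Verma module because that weight defines a character of the Borel subalgebra. The structure
    constants of the model are integral polynomials in [alpha], so one computation checks its
    identities for all parameters; the conditions on [alpha] enter through the determinant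
    $-2\alpha(\alpha+1)$ of the Cartan matrix and through the pairings of opposite root vectors. An
    arbitrary set of positive roots is controlled by two facts: it contains exactly one of any two
    opposite roots, and it is closed under sums that are roots. The value 8 is $2^4/2$, the number
    of subsets of given parity of the four odd low letters. *)

Section Words.
Variables (I : finType) (r : I -> nat) (par : I -> bool).
Implicit Types (i j k : I) (u v w : seq I).

Definition is_redex i j := (r j < r i)%N || ((i == j) && par i).

Fixpoint normal w :=
  if w is i :: w' then (if w' is j :: _ then ~~ is_redex i j else true) && normal w'
  else true.

Fixpoint first_redex w : option (seq I * I * I * seq I) :=
  if w is i :: w' then
    if w' is j :: v then
      if is_redex i j then Some ([::], i, j, v)
      else if first_redex w' is Some (u, a, b, v') then Some (i :: u, a, b, v')
      else None
    else None
  else None.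

Fixpoint inversions w :=
  if w is i :: w' then (count (fun j => r j < r i)%N w' + inversions w')%N else 0%N.

(** One number in place of the lexicographic order by length and inversions: a word of length [n]
    has at most [n * n] inversions, so the summand [(n * n).+1] gained with one more letter
    outweighs them. *)
Definition wmeasure w :=
  (\sum_(k < size w) (k * k).+1 + inversions w)%N.

Lemma first_redex_cons i j v : first_redex [:: i, j & v] =
  if is_redex i j then Some ([::], i, j, v)
  else if first_redex (j :: v) is Some (u, a, b, v') then Some (i :: u, a, b, v')
  else None.
Proof. by []. Qed.

Lemma normal_cons i j v :
  normal [:: i, j & v] = ~~ is_redex i j && normal (j :: v).
Proof. by []. Qed.

Lemma first_redexS w u i j v : first_redex w = Some (u, i, j, v) ->
  w = u ++ i :: j :: v /\ is_redex i j.
Proof.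
elim: w u => [//|a [//|b w] IH] u; rewrite first_redex_cons.
case: ifP => [h|_]; first by case=> <- <- <- <-.
case: (first_redex (b :: w)) IH => [[[[u' a'] b'] v']|//] IH.
case=> <- e1 e2 e3; rewrite e1 e2 e3 in IH.
by have [-> h] := IH _ erefl.
Qed.

Lemma first_redexN w : first_redex w = None -> normal w.
Proof.
elim: w => [//|a [//|b w] IH]; rewrite first_redex_cons normal_cons.
case: ifP => [//|h]; case: (first_redex (b :: w)) IH => [[[[u' a'] b'] v']|] //.
Qed.

Lemma normal_first_redex w : normal w -> first_redex w = None.
Proof.
elim: w => [//|a [//|b w] IH]; rewrite first_redex_cons normal_cons.
by move=> /andP [/negbTE -> /IH ->].
Qed.

Lemma normal_cat u v : normal (u ++ v) -> normal u /\ normal v.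
Proof.
elim: u => [//|a u IH] /= /andP [h /IH [hu hv]]; split=> //.
by case: u {IH} h hu => //= b u ->.
Qed.

Lemma inversions_size w : (inversions w <= size w * size w)%N.
Proof.
elim: w => //= i w IH; rewrite mulSn mulnS addSn.
apply: leq_trans (leq_add (count_size _ _) IH) _.
by rewrite leqW ?leq_addl.
Qed.

Lemma wmeasure_size u w : (size u < size w)%N -> (wmeasure u < wmeasure w)%N.
Proof.
rewrite /wmeasure => h; apply: leq_trans (leq_addr _ _).
apply: (@leq_trans (\sum_(k < (size u).+1) (k * k).+1)%N).
  by rewrite big_ord_recr /= addnS ltnS leq_add2l inversions_size.
rewrite -(subnKC h); move: (_ - _)%N => d.
elim: d => [|d IH]; first by rewrite addn0.
by rewrite addnS [leqRHS]big_ord_recr /=; apply: leq_trans IH (leq_addr _ _).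
Qed.

Lemma wmeasure_swap u i j v : (r j < r i)%N ->
  (wmeasure (u ++ j :: i :: v) < wmeasure (u ++ i :: j :: v))%N.
Proof.
rewrite /wmeasure !size_cat /= ltn_add2l => h.
elim: u => [|a u IH] /=.
  by rewrite h (ltnNge (r i)) (ltnW h) /=; lia.
by rewrite !count_cat /=; lia.
Qed.

Lemma wmeasure_merge u i j k v :
  (wmeasure (u ++ k :: v) < wmeasure (u ++ i :: j :: v))%N.
Proof. by apply: wmeasure_size; rewrite !size_cat /= ltn_add2l. Qed.

(** Induction along rewriting: at a redex the claim is available for the swapped word and for every
    word with one letter in place of the redex, as in the bracket term. For a repeated odd letter
    the swapped word is the word itself, hence the condition [i != j]. *)
Lemma word_ind (Q : seq I -> Prop) :
  (forall w, normal w -> Q w) ->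
  (forall u i j v, is_redex i j -> (i != j -> Q (u ++ j :: i :: v)) ->
     (forall k, Q (u ++ k :: v)) -> Q (u ++ i :: j :: v)) ->
  forall w, Q w.
Proof.
move=> hn hr w; have [n] := ubnP (wmeasure w).
elim: n => // n IH in w *; rewrite ltnS => hw.
case e : (first_redex w) => [[[[u i] j] v]|]; last by apply/hn/first_redexN.
have [ew hij] := first_redexS e; move: hw; rewrite {}ew => hw.
apply: hr => // [neq|k]; apply: IH; apply: leq_trans hw.
  by apply: wmeasure_swap; case/orP: hij => // /andP [/eqP eij]; rewrite eij eqxx in neq.
exact: wmeasure_merge.
Qed.

End Words.

(** * Functionals respecting the relations of the enveloping algebra *)

Section BracketLinear.
Variables (K : pzRingType) (g : lieSuperType K).
Implicit Types x y z : g.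

Lemma bracketDl x y z : [< x + y, z >] = [< x, z >] + [< y, z >].
Proof. by have := bracket_linearl 1 x y z; rewrite !scale1r. Qed.
Lemma bracketDr x y z : [< z, x + y >] = [< z, x >] + [< z, y >].
Proof. by have := bracket_linearr 1 x y z; rewrite !scale1r. Qed.
Lemma bracket0l z : [< 0, z >] = 0.
Proof. by apply: (addIr [< 0, z >]); rewrite -bracketDl !add0r. Qed.
Lemma bracket0r z : [< z, 0 >] = 0.
Proof. by apply: (addIr [< z, 0 >]); rewrite -bracketDr !add0r. Qed.
Lemma bracketZl a x z : [< a *: x, z >] = a *: [< x, z >].
Proof. by have := bracket_linearl a x 0 z; rewrite bracket0l !addr0. Qed.
Lemma bracketZr a x z : [< z, a *: x >] = a *: [< z, x >].
Proof. by have := bracket_linearr a x 0 z; rewrite bracket0r !addr0. Qed.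
Lemma bracket_suml (J : Type) (s : seq J) (F : J -> g) z :
  [< \sum_(i <- s) F i, z >] = \sum_(i <- s) [< F i, z >].
Proof. exact: (big_morph (fun y => [< y, z >]) (fun x y =>
  bracketDl x y z) (bracket0l z)). Qed.
Lemma bracket_sumr (J : Type) (s : seq J) (F : J -> g) z :
  [< z, \sum_(i <- s) F i >] = \sum_(i <- s) [< z, F i >].
Proof. exact: (big_morph (fun y => [< z, y >]) (fun x y =>
  bracketDr x y z) (bracket0r z)). Qed.
End BracketLinear.

Section PBW.
Variables (K : numFieldType) (g : lieSuperType K) (I : finType).
Variables (x : I -> g) (par : I -> bool) (coord : g -> I -> K) (r : I -> nat).
Hypothesis x_homog : forall i, homog (par i) (x i).
Hypothesis coordE : forall y, y = \sum_i coord y i *: x i.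
Hypothesis coord_linear :
  forall a y z i, coord (a *: y + z) i = a * coord y i + coord z i.
Hypothesis coord_x : forall i j, coord (x i) j = (i == j)%:R.
Hypothesis r_inj : injective r.
Implicit Types (i j k : I) (u v w : seq I) (y z : g) (phi : seq I -> K).

Local Notation redex := (is_redex r par).
Local Notation normal := (normal r par).
Local Notation wmeasure := (wmeasure r).

Lemma coordD y z i : coord (y + z) i = coord y i + coord z i.
Proof. by rewrite -[y]scale1r coord_linear mul1r scale1r. Qed.
Lemma coord0 i : coord 0 i = 0.
Proof. by apply: (addIr (coord 0 i)); rewrite -coordD !add0r. Qed.
Lemma coordZ a y i : coord (a *: y) i = a * coord y i.
Proof. by rewrite -[a *: y]addr0 coord_linear coord0 addr0. Qed.
Lemma coord_sum (J : Type) (s : seq J) (Q : pred J) (F : J -> g) i :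
  coord (\sum_(j <- s | Q j) F j) i = \sum_(j <- s | Q j) coord (F j) i.
Proof. exact: (big_morph (fun y => coord y i) (fun y z => coordD y z i) (coord0 i)). Qed.

(** The terms of the expansion of [y] with the wrong parity sum to [y] minus the other terms; this
    vector lies in both graded parts and vanishes. *)
Lemma coord_par b y i : homog b y -> coord y i != 0 -> par i = b.
Proof.
move=> hy hi; apply/eqP; apply: contraR hi => hb.
have hs c (Q : pred I) : (forall j, Q j -> par j = c) ->
    homog c (\sum_(j | Q j) coord y j *: x j).
  have hc := homog_subspace (s := g) c.
  move=> hQ; elim/big_rec: _ => [|j z /hQ e hz]; first by case: hc.
  by apply: subspaceD => //; apply: subspaceZ => //; rewrite -e.
have h1 : homog b (\sum_(j | par j == b) coord y j *: x j).
  by apply: hs => j /eqP.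
have h2 : homog (~~ b) (\sum_(j | par j != b) coord y j *: x j).
  by apply: hs => j; case: (par j) (b) => -[].
have e : \sum_(j | par j != b) coord y j *: x j =
    y - \sum_(j | par j == b) coord y j *: x j.
  rewrite {2}[y]coordE [X in X - _](bigID (fun j => par j == b)) /=.
  by rewrite addrAC subrr add0r.
have z0 : \sum_(j | par j != b) coord y j *: x j = 0.
  have h3 : homog b (\sum_(j | par j != b) coord y j *: x j).
    by rewrite e; apply: subspaceB => //; apply: homog_subspace.
  by case: (b) h2 h3 => h2 h3; apply: homog_cap.
have := congr1 (fun y => coord y i) z0; rewrite /= coord0 coord_sum.
rewrite (bigD1 i) //= coordZ coord_x eqxx mulr1 big1 ?addr0 => [->|j /andP [_ hj]] //.
by rewrite coordZ coord_x (negbTE hj) mulr0.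
Qed.

(** The linear extension of [phi] in one position, where an arbitrary element takes the place of a
    letter. *)
Definition slot phi u y v := \sum_k coord y k * phi (u ++ k :: v).

Lemma slotD phi u y z v : slot phi u (y + z) v = slot phi u y v + slot phi u z v.
Proof. by rewrite /slot -big_split; apply: eq_bigr => k _; rewrite coordD mulrDl. Qed.
Lemma slotZ phi u a y v : slot phi u (a *: y) v = a * slot phi u y v.
Proof. by rewrite /slot mulr_sumr; apply: eq_bigr => k _; rewrite coordZ mulrA. Qed.
Lemma slot_sum phi u v (s : seq I) (F : I -> g) :
  slot phi u (\sum_(j <- s) F j) v = \sum_(j <- s) slot phi u (F j) v.
Proof.
apply: (big_morph (fun y => slot phi u y v) (fun y z => slotD phi u y z v)).
by rewrite /slot big1 // => k _; rewrite coord0 mul0r.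
Qed.
Lemma slot_x phi u i v : slot phi u (x i) v = phi (u ++ i :: v).
Proof.
rewrite /slot (bigD1 i) //= coord_x eqxx mul1r big1 ?addr0 // => j hj.
by rewrite coord_x eq_sym (negbTE hj) mul0r.
Qed.

Definition sg i j : K := (-1) ^+ (par i && par j).

(** The relation [x_i x_j = (-1)^(p_i p_j) x_j x_i + [x_i, x_j]] of the enveloping
    algebra, read in the middle of a word by a linear functional. *)
Definition respects_at phi u i j v :=
  phi (u ++ i :: j :: v) =
    sg i j * phi (u ++ j :: i :: v) + slot phi u [< x i, x j >] v.

Definition respects phi := forall u i j v, respects_at phi u i j v.

(** The value that the relation forces on [u ++ i :: j :: v]. For a repeated odd letter the relation
    reads $2x_i^2=[x_i,x_i]$, hence the factor $1/2$. *)
Definition reduct phi u i j v : K :=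
  if i == j then 2^-1 * slot phi u [< x i, x i >] v
  else sg i j * phi (u ++ j :: i :: v) + slot phi u [< x i, x j >] v.

Lemma sgK i j : sg i j * sg i j = 1.
Proof. by rewrite /sg -expr2 sqrr_sign. Qed.
Lemma sgC i j : sg i j = sg j i.
Proof. by rewrite /sg andbC. Qed.
Lemma skewx i j : [< x i, x j >] = - sg i j *: [< x j, x i >].
Proof. by rewrite (bracket_skew (x_homog i) (x_homog j)) scaleNr. Qed.

Lemma redex_reduct phi u i j v : redex i j ->
  phi (u ++ i :: j :: v) = reduct phi u i j v <-> respects_at phi u i j v.
Proof.
move=> h; rewrite /reduct /respects_at; case: eqP h => // -> h.
have hp : par j by move: h; rewrite /is_redex ltnn eqxx.
rewrite /sg hp /= expr1 mulN1r; set s := slot _ _ _ _; set p := phi _.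
have n2 : (2 : K) != 0 by rewrite pnatr_eq0.
split=> [->|e]; first by field.
have -> : s = p + p by rewrite {2}e addrA subrr add0r.
by field.
Qed.

(** By super skew-symmetry the relation for [j], [i] is a multiple of the one for [i], [j], so it is
    enough to impose the relations at redexes. *)
Lemma respects_atC phi u i j v : respects_at phi u i j v -> respects_at phi u j i v.
Proof.
rewrite /respects_at => ->; rewrite mulrDr mulrA sgC sgK mul1r -addrA.
by rewrite (skewx j i) slotZ (sgC j i) mulNr subrr addr0.
Qed.

Lemma respects_at_diag phi u i v : ~~ par i -> respects_at phi u i i v.
Proof.
move=> h; rewrite /respects_at; have e := skewx i i.
rewrite /sg (negbTE h) expr0 scaleN1r in e.
have : (2 : K) *: [< x i, x i >] = 0 by rewrite scaler_nat mulr2n {1}e addNr.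
move=> /eqP; rewrite scaler_eq0 pnatr_eq0 /= => /eqP ->.
rewrite /sg (negbTE h) expr0 mul1r /slot big1 ?addr0 // => k _.
by rewrite coord0 mul0r.
Qed.

Lemma redex_total i j : [|| redex i j, redex j i | (i == j) && ~~ par i].
Proof.
rewrite /is_redex; case: eqVneq => [->|h] /=.
  by rewrite ltnn /=; case: (par j).
rewrite !orbF.
by case: ltngtP => // /r_inj e; rewrite e eqxx in h.
Qed.

Definition respects_below phi m := forall u i j v, redex i j ->
  (wmeasure (u ++ i :: j :: v) < m)%N -> respects_at phi u i j v.

Lemma respects_at_below phi m u i j v : respects_below phi m ->
  (wmeasure (u ++ i :: j :: v) < m)%N -> (wmeasure (u ++ j :: i :: v) < m)%N ->
  respects_at phi u i j v.
Proof.
move=> h h1 h2; case/or3P: (redex_total i j) => hr.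
- exact: h.
- by apply: respects_atC; apply: h.
- by case/andP: hr => /eqP <-; apply: respects_at_diag.
Qed.

(** Homogeneity of [y] gives all letters in its expansion the same sign against [x k], so a whole
    bracket can be moved past a letter. *)
Lemma slot_comm phi b u y k v : homog b y ->
  (forall a, respects_at phi u a k v) ->
  slot phi u y (k :: v) = (-1) ^+ (b && par k) * slot phi (u ++ [:: k]) y v
                          + slot phi u [< y, x k >] v.
Proof.
move=> hy h; rewrite [in RHS](coordE y) bracket_suml slot_sum.
rewrite -[X in slot phi (u ++ _) X v]coordE /slot mulr_sumr -big_split /=.
apply: eq_bigr => a _; rewrite -/(slot phi u _ v) h mulrDr bracketZl slotZ -catA /=.
have [->|hn] := eqVneq (coord y a) 0; first by rewrite !(mul0r, mulr0).
by rewrite -(coord_par hy hn) /sg; ring.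
Qed.

(** The Jacobi identity with all inner brackets in the order of the letters [i], [j], [k] of an
    overlap, which is the form in which double brackets arise there. *)
Lemma jacobi_sorted i j k : [< [< x i, x j >], x k >] =
  - (-1) ^+ (par i && (par j (+) par k)) *: [< [< x j, x k >], x i >]
  + ((-1) ^+ (par i && par j) * (-1) ^+ (par j && (par i (+) par k)))
      *: [< [< x i, x k >], x j >].
Proof.
have hB a b := bracket_homog (x_homog a) (x_homog b).
have := bracket_jacobi (x k) (x_homog i) (x_homog j).
rewrite (bracket_skew (x_homog i) (hB j k)) (bracket_skew (x_homog j) (hB i k)).
move=> /eqP; rewrite -subr_eq => /eqP <-.
by rewrite scaleNr scalerN scalerA opprK.
Qed.

(** * Confluence: any two redexes of a word force the same value *)

Section Confluence.
Variables (phi : seq I -> K) (m : nat).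
Hypothesis hm : respects_below phi m.

(** After one redex is reduced, the other is still present in every resulting word, and these words
    are smaller, so it can be reduced too. Both orders give the same double expansion. *)
Lemma reduct_disjoint u i j t k l v :
  redex i j -> redex k l -> (wmeasure (u ++ i :: j :: t ++ k :: l :: v) <= m)%N ->
  reduct phi u i j (t ++ k :: l :: v) = reduct phi (u ++ i :: j :: t) k l v.
Proof.
move=> hij hkl hw.
(* The coefficients [sr] and [tr] merge the two branches of [reduct]: a repeated letter has no swap
   term and the factor $1/2$. *)
pose sr a b := if a == b then 0 else sg a b.
pose tr (a b : I) : K := if a == b then 2^-1 else 1.
have redE u' a b v' : reduct phi u' a b v' =
    sr a b * phi (u' ++ b :: a :: v') + tr a b * slot phi u' [< x a, x b >] v'.
  rewrite /reduct /sr /tr; case: eqP => [->|_]; first by rewrite mul0r add0r.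
  by rewrite mul1r.
have E1 u' v' a b : redex a b -> (wmeasure (u' ++ a :: b :: v') < m)%N ->
    phi (u' ++ a :: b :: v') = reduct phi u' a b v'.
  by move=> hr hl; apply/redex_reduct => //; apply: hm.
have sw a b u' v' : redex a b -> (wmeasure (u' ++ a :: b :: v') <= m)%N ->
    a != b -> (wmeasure (u' ++ b :: a :: v') < m)%N.
  move=> hr hl hn; apply: leq_trans hl; apply: wmeasure_swap.
  by case/orP: hr => //; rewrite (negbTE hn).
have hw' : (wmeasure ((u ++ i :: j :: t) ++ k :: l :: v) <= m)%N by rewrite -catA.
have mg a : (wmeasure (u ++ a :: t ++ k :: l :: v) < m)%N.
  exact: leq_trans (wmeasure_merge _ _ _ _ _ _) hw.
have mg' a : (wmeasure ((u ++ i :: j :: t) ++ a :: v) < m)%N.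
  exact: leq_trans (wmeasure_merge _ _ _ _ _ _) hw'.
rewrite !redE.
have -> : sr i j * phi (u ++ [:: j, i & t ++ [:: k, l & v]]) =
  sr i j * reduct phi (u ++ j :: i :: t) k l v.
  rewrite /sr; case: eqP => [_|/eqP hn]; first by rewrite !mul0r.
  by rewrite -E1 // -catA //=; apply: sw.
have -> : slot phi u [< x i, x j >] (t ++ k :: l :: v) =
  \sum_a coord [< x i, x j >] a * reduct phi (u ++ a :: t) k l v.
  by apply: eq_bigr => a _; rewrite -E1 // -catA //=.
have -> : sr k l * phi ((u ++ [:: i, j & t]) ++ [:: l, k & v]) =
  sr k l * reduct phi u i j (t ++ l :: k :: v).
  rewrite /sr; case: eqP => [_|/eqP hn]; first by rewrite !mul0r.
  by rewrite -E1 // ?catA //=; have := sw _ _ _ _ hkl hw' hn; rewrite -catA.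
have -> : slot phi (u ++ [:: i, j & t]) [< x k, x l >] v =
  \sum_a coord [< x k, x l >] a * reduct phi u i j (t ++ a :: v).
  apply: eq_bigr => a _; rewrite -E1 // -?catA //=.
  by have := mg' a; rewrite -catA.
rewrite !redE.
under eq_bigr do rewrite redE.
under [in RHS]eq_bigr do rewrite redE.
rewrite -!catA /=.
have sp (c c' : K) (C F G : I -> K) : \sum_a C a * (c * F a + c' * G a) =
    c * (\sum_a C a * F a) + c' * (\sum_a C a * G a).
  rewrite !mulr_sumr -big_split /=; apply: eq_bigr => a _; ring.
rewrite !sp.
have -> : \sum_a coord [< x i, x j >] a * slot phi (u ++ a :: t) [< x k, x l >] v =
  \sum_a coord [< x k, x l >] a * slot phi u [< x i, x j >] (t ++ a :: v).
  rewrite /slot; under eq_bigr do rewrite mulr_sumr.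
  rewrite exchange_big; apply: eq_bigr => a _ /=; rewrite mulr_sumr.
  by apply: eq_bigr => b _; rewrite -catA /= mulrCA.
rewrite /slot.
have -> : \sum_a coord [< x i, x j >] a * phi ((u ++ a :: t) ++ [:: l, k & v]) =
          \sum_a coord [< x i, x j >] a * phi (u ++ a :: t ++ [:: l, k & v]).
  by apply: eq_bigr => a _; rewrite -catA.
have -> : \sum_a coord [< x k, x l >] a * phi ((u ++ [:: j, i & t]) ++ a :: v) =
          \sum_a coord [< x k, x l >] a * phi (u ++ [:: j, i & t ++ a :: v]).
  by apply: eq_bigr => a _; rewrite -catA.
ring.
Qed.

(** Both sides are reduced until no redex among the three letters is left; the double brackets that
    remain agree by the Jacobi identity. Equal neighbours are separate cases, as their reduction has
    no swap term. *)
Lemma reduct_overlap u i j k v : redex i j -> redex j k ->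
  (wmeasure (u ++ [:: i, j, k & v]) <= m)%N ->
  reduct phi u i j (k :: v) = reduct phi (u ++ [:: i]) j k v.
Proof.
move=> hij hjk hw.
have sl a b c : slot phi u [< x a, x b >] (c :: v) =
    (-1) ^+ ((par a (+) par b) && par c) * slot phi (u ++ [:: c]) [< x a, x b >] v
    + slot phi u [< [< x a, x b >], x c >] v.
  apply: slot_comm => [|d]; first exact: bracket_homog (x_homog a) (x_homog b).
  by apply: (respects_at_below hm); apply: leq_trans hw;
    apply: wmeasure_size; rewrite !size_cat /= ltn_add2l.
have R1 a b c : redex a b -> (wmeasure (u ++ [:: a, b, c & v]) < m)%N ->
    phi (u ++ [:: a, b, c & v]) =
      sg a b * phi (u ++ [:: b, a, c & v]) + slot phi u [< x a, x b >] (c :: v).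
  by move=> h h'; apply: hm.
have R2 a b c : redex a b -> (wmeasure (u ++ [:: c, a, b & v]) < m)%N ->
    phi (u ++ [:: c, a, b & v]) =
      sg a b * phi (u ++ [:: c, b, a & v]) + slot phi (u ++ [:: c]) [< x a, x b >] v.
  move=> h h'; have := @hm (u ++ [:: c]) a b v h.
  by rewrite /respects_at -!catA /=; apply.
have W1 a b c : (r b < r a)%N ->
    (wmeasure (u ++ [:: b, a, c & v]) < wmeasure (u ++ [:: a, b, c & v]))%N.
  exact: wmeasure_swap.
have W2 a b c : (r b < r a)%N ->
    (wmeasure (u ++ [:: c, b, a & v]) < wmeasure (u ++ [:: c, a, b & v]))%N.
  by move=> h; have := @wmeasure_swap _ r (u ++ [:: c]) a b v h; rewrite -!catA.
rewrite /reduct -!catA /=.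
have jac a b c : slot phi u [< [< x a, x b >], x c >] v =
  - (-1) ^+ (par a && (par b (+) par c)) * slot phi u [< [< x b, x c >], x a >] v
  + (-1) ^+ (par a && par b) * (-1) ^+ (par b && (par a (+) par c))
      * slot phi u [< [< x a, x c >], x b >] v.
  by rewrite jacobi_sorted slotD !slotZ.
have lt a b : redex a b -> a != b -> (r b < r a)%N.
  by move=> /orP [//|/andP [-> _]].
have sgE a b : sg a b = (-1) ^+ (par a && par b) by [].
have half (a b : K) : a = - a + b -> a = 2^-1 * b.
  move=> e; have -> : b = a + a by rewrite {2}e addrA subrr add0r.
  by field.
have od a : redex a a -> par a by rewrite /is_redex ltnn eqxx.
case: (eqVneq i j) hij hjk hw => [ <-|nij] hij hjk hw.
  have pi := od _ hij.
  case: (eqVneq i k) hjk hw => [ <-|nik] hik hw /=.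
    rewrite sl pi /=.
    (* For an odd letter the Jacobi identity gives $X=-2X$, that is $3X=0$. *)
    have := jac i i i; rewrite pi /= !expr0 !expr1; set X := slot _ _ _ _ => hX.
    have -> : X = 0.
      apply/eqP; rewrite -(mulrI_eq0 X (@mulfI _ (3 : K) _)) ?pnatr_eq0 //.
      by apply/eqP; move/eqP: hX; rewrite -subr_eq0 => /eqP hX; rewrite -[RHS]hX; ring.
    by rewrite addr0 mul1r.
  have lki := lt _ _ hik nik.
  rewrite (R1 i k i) // ?(leq_trans (W2 _ _ _ lki)) //.
  have -> : phi (u ++ [:: k, i, i & v]) =
      2^-1 * slot phi (u ++ [:: k]) [< x i, x i >] v.
    apply: half; rewrite {1}(R2 i i k) // ?sgE ?pi /= ?expr1 ?mulN1r //.
    by apply: (ltn_trans (W1 _ _ _ lki)); apply: leq_trans (W2 _ _ _ lki) hw.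
  rewrite !sl (jac i i k) !sgE pi.
  by case: (par k); rewrite /= ?expr0 ?expr1; field.
case: (eqVneq j k) hjk hw => [ <-|njk] hjk hw.
  have pj := od _ hjk; have lji := lt _ _ hij nij.
  rewrite (R2 i j j) // ?(leq_trans (W1 _ _ _ lji)) //.
  have -> : phi (u ++ [:: j, j, i & v]) = 2^-1 * slot phi u [< x j, x j >] (i :: v).
    apply: half; rewrite {1}(R1 j j i) // ?sgE ?pj /= ?expr1 ?mulN1r //.
    by apply: (ltn_trans (W2 _ _ _ lji)); apply: leq_trans (W1 _ _ _ lji) hw.
  have hX : slot phi u [< [< x i, x j >], x j >] v =
      2^-1 * - slot phi u [< [< x j, x j >], x i >] v.
    apply: half; rewrite {1}(jac i j j) pj.
    by case: (par i); rewrite /= ?expr0 ?expr1; ring.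
  rewrite !sl hX !sgE pj.
  by case: (par i); rewrite /= ?expr0 ?expr1; field.
(* Three distinct letters: the two ways from [i j k] to [k j i], three swaps each. *)
have lji := lt _ _ hij nij; have lkj := lt _ _ hjk njk.
have lki := ltn_trans lkj lji.
have nik : redex i k by rewrite /is_redex lki.
rewrite (R2 i k j) // ?(leq_trans (W1 _ _ _ lji)) //.
rewrite (R1 j k i) //; last first.
  by apply: (ltn_trans (W2 _ _ _ lki)); apply: leq_trans (W1 _ _ _ lji) hw.
rewrite (R1 i k j) // ?(leq_trans (W2 _ _ _ lkj)) //.
rewrite (R2 i j k) //; last first.
  by apply: (ltn_trans (W1 _ _ _ lki)); apply: leq_trans (W2 _ _ _ lkj) hw.
rewrite !sl (jac i j k) !sgE.
by case: (par i); case: (par j); case: (par k); rewrite /= ?expr0 ?expr1; ring.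
Qed.

Lemma reduct_confluent u i j v u' i' j' v' :
  u ++ i :: j :: v = u' ++ i' :: j' :: v' -> redex i j -> redex i' j' ->
  (wmeasure (u ++ i :: j :: v) <= m)%N ->
  reduct phi u i j v = reduct phi u' i' j' v'.
Proof.
wlog hs : u i j v u' i' j' v' / (size u <= size u')%N.
  move=> H e h h' hw; case: (leqP (size u) (size u')) => hs; first exact: H.
  by apply: esym; apply: H => //; rewrite -?e // ltnW.
move=> e hr hr' hw.
have eu : u = take (size u) u'.
  by have := congr1 (take (size u)) e; rewrite take_size_cat // takel_cat.
move: e hw; rewrite -(cat_take_drop (size u) u') -eu; set t := drop _ _.
rewrite -catA => /eqP; rewrite eqseq_cat // eqxx /= => /eqP.
(* The second redex starts 0, 1 or at least 2 letters after the first: the same redex, an overlap in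
   one letter, or disjoint redexes. *)
case: t => [|a [|b t]] /=.
- by case=> -> -> ->; rewrite cats0.
- by case=> <- e1 e2; rewrite e1 e2 in hr *; apply: reduct_overlap.
- by case=> <- <- ->; apply: reduct_disjoint.
Qed.

End Confluence.

Lemma reduct_ext phi phi' u i j v : redex i j ->
  (forall w, (wmeasure w < wmeasure (u ++ i :: j :: v))%N -> phi w = phi' w) ->
  reduct phi u i j v = reduct phi' u i j v.
Proof.
move=> hr h.
have hs y : slot phi u y v = slot phi' u y v.
  by apply: eq_bigr => k _; rewrite h //; apply: wmeasure_merge.
rewrite /reduct; case: eqP hr => [->|/eqP hn] hr; first by rewrite hs.
rewrite hs h //; apply: wmeasure_swap.
by case/orP: hr => //; rewrite (negbTE hn).
Qed.

(** * Extension of a functional from normal words to all words *)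

Section Extension.
Variable psi : seq I -> K.

(** Recursion on a bound for the measure. The default 0 is not reached from [extend], whose bound
    exceeds the measure of the word. *)
Fixpoint extend_rec n w : K :=
  if n is n'.+1 then
    if first_redex r par w is Some (u, i, j, v) then reduct (extend_rec n') u i j v
    else psi w
  else 0.

Definition extend w := extend_rec (wmeasure w).+1 w.

Lemma extend_recE n w : (wmeasure w < n)%N -> extend_rec n w = extend w.
Proof.
suff h n' : (wmeasure w < n)%N -> (wmeasure w < n')%N ->
    extend_rec n w = extend_rec n' w by move=> hw; apply: h.
elim: n n' w => [//|n IH] [//|n'] w hn hn' /=.
case e : (first_redex r par w) => [[[[u i] j] v]|//].
have [ew hr] := first_redexS e; rewrite ew in hn hn'.
apply: reduct_ext => // w' hw'.
by apply: IH; apply: leq_trans hw' _; rewrite -ltnS.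
Qed.

Lemma extend_normal w : normal w -> extend w = psi w.
Proof. by move=> /normal_first_redex h; rewrite /extend /= h. Qed.

Lemma extend_first w u i j v : first_redex r par w = Some (u, i, j, v) ->
  extend w = reduct extend u i j v.
Proof.
move=> e; have [ew hr] := first_redexS e.
  rewrite {1}/extend /= e; apply: reduct_ext => // w' hw'.
by apply: extend_recE; rewrite ew.
Qed.

(** By construction the relation holds at the first redex; confluence carries it to every other
    redex, by induction on the measure. *)
Lemma extend_respects : respects extend.
Proof.
suff h m : respects_below extend m.
  move=> u i j v; set N := maxn (wmeasure (u ++ i :: j :: v)) (wmeasure (u ++ j :: i ::
    v)).
  by apply: (respects_at_below (h N.+1)); rewrite ltnS ?leq_maxl ?leq_maxr.
elim: m => [//|m IH] u i j v hr; rewrite ltnS => hw.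
apply/redex_reduct => //.
case e : (first_redex r par (u ++ i :: j :: v)) => [[[[u' i'] j'] v']|].
  have [ew hr'] := first_redexS e; rewrite (extend_first e).
  by apply: (reduct_confluent IH) => //; rewrite -?ew.
have /normal_cat [_] := first_redexN e.
by rewrite normal_cons hr.
Qed.

End Extension.

(** The uniqueness half of the diamond lemma: rewriting determines a functional from its values on
    normal words. *)
Lemma respects_eq phi phi' : respects phi -> respects phi' ->
  (forall w, normal w -> phi w = phi' w) -> forall w, phi w = phi' w.
Proof.
move=> h h' hn; apply: (@word_ind _ r par) => // u i j v hr h1 h2.
rewrite !(redex_reduct _ _ _ hr).2 //.
rewrite /reduct; case: eqP h1 => [ <-|hij] h1.
  by congr (_ * _); apply: eq_bigr => k _; rewrite h2.
by rewrite h1 //; congr (_ + _); apply: eq_bigr => k _; rewrite h2.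
Qed.

End PBW.

(** * Decomposition into weight components *)

Section Eigenspaces.
Variables (K : numFieldType) (n : nat) (V : lmodType K).
Variable H : 'cV[K]_n -> V -> V.
Hypothesis H_linear : forall c a u v, H c (a *: u + v) = a *: H c u + H c v.
Implicit Types (mu nu : 'rV[K]_n) (c : 'cV[K]_n) (u : V) (W : set V).

Definition eigen mu : set V := [set v | forall c, H c v = (mu *m c) 0 0 *: v].

Lemma eigen_operator0 c : H c 0 = 0.
Proof.
by have := H_linear c (-1) 0 0; rewrite scaler0 addr0 scaleN1r addNr.
Qed.

Lemma eigen_operator_sum c (J : Type) (s : seq J) (F : J -> V) :
  H c (\sum_(j <- s) F j) = \sum_(j <- s) H c (F j).
Proof.
apply: (big_morph (H c) _ (eigen_operator0 c)) => u v.
by rewrite -[u in LHS]scale1r H_linear scale1r.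
Qed.

Lemma eigen_subspace mu : subspace (eigen mu).
Proof.
split=> [c|a u v hu hv c]; first by rewrite eigen_operator0 scaler0.
by rewrite H_linear hu hv scalerDr !scalerA mulrC.
Qed.

Lemma row_neq_ex mu nu : mu != nu -> exists c, (mu *m c) 0 0 != (nu *m c) 0 0.
Proof.
move=> neq; apply: contrapT => hc; case/eqP: neq; apply/rowP => i.
have h (r : 'rV[K]_n) : (r *m delta_mx i (0 : 'I_1)) 0 0 = r 0 i.
  rewrite mxE (bigD1 i) //= mxE !eqxx mulr1 big1 ?addr0 // => j hj.
  by rewrite mxE (negbTE hj) mulr0.
rewrite -!h; apply/eqP; apply: contrapT => /negP neq.
by apply: hc; exists (delta_mx i 0).
Qed.

(** Applying [H c - mu c] kills one component and rescales the others. *)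
Lemma eigen_component W (s : seq 'rV[K]_n) (v : 'rV[K]_n -> V) :
  subspace W -> (forall c u, W u -> W (H c u)) -> uniq s ->
  (forall mu, eigen mu (v mu)) -> W (\sum_(mu <- s) v mu) ->
  forall mu, mu \in s -> W (v mu).
Proof.
move=> hW hH; elim: s v => [//|nu s IH] v /= /andP [hnu us] hv hs.
have hrest mu : mu \in s -> W (v mu).
  move=> hmu; have /row_neq_ex [c hc] : mu != nu.
    by apply: contraNneq hnu => <-.
  pose v' k := ((k *m c) 0 0 - (nu *m c) 0 0) *: v k.
  have hv' k : eigen k (v' k) by apply: (subspaceZ _ (eigen_subspace k)).
  have hs' : W (\sum_(k <- s) v' k).
    have := subspaceB hW (hH c _ hs) (subspaceZ ((nu *m c) 0 0) hW hs).
    rewrite eigen_operator_sum scaler_sumr -sumrB big_cons hv subrr add0r.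
    by under eq_bigr do rewrite hv -scalerBl.
  have := IH _ us hv' hs' mu hmu; rewrite /v' =>
    /(subspaceZ ((mu *m c) 0 0 - (nu *m c) 0 0)^-1 hW).
  by rewrite scalerA mulVf ?scale1r // subr_eq0.
move=> mu; rewrite inE => /predU1P [->|]; last exact: hrest.
move: hs; rewrite big_cons => hs.
have hsum : W (\sum_(k <- s) v k).
  rewrite big_seq; elim/big_rec: _ => [|k u hk hu]; first by case: hW.
  by apply: subspaceD => //; apply: hrest.
by have := subspaceB hW hs hsum; rewrite addrK.
Qed.

Definition eigen_sums (F : 'rV[K]_n -> set V) : set V :=
  [set u | exists (s : seq 'rV[K]_n) (v : 'rV[K]_n -> V),
     [/\ uniq s, forall mu, F mu (v mu) & u = \sum_(mu <- s) v mu]].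

Variable F : 'rV[K]_n -> set V.
Hypothesis F_subspace : forall mu, subspace (F mu).

Lemma sub_eigen_sums mu u : F mu u -> eigen_sums F u.
Proof.
move=> hu; exists [:: mu], (fun nu => if nu == mu then u else 0); split=> //.
  by move=> nu; case: eqP => [->|_] //; case: (F_subspace nu).
by rewrite big_seq1 eqxx.
Qed.

Lemma eigen_sums_subspace : subspace (eigen_sums F).
Proof.
split=> [|a _ _ [s [v [us hv ->]]] [t [w [ut hw ->]]]].
  by exists [::], (fun _ => 0); split=> // [mu|];
    [case: (F_subspace mu) | rewrite big_nil].
(* Extension by zero lets both sums range over the union of their index lists. *)
pose p (q : seq 'rV[K]_n) (f : 'rV[K]_n -> V) mu := if mu \in q then f mu else 0.
have hp q f mu : (forall mu, F mu (f mu)) -> F mu (p q f mu).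
  by rewrite /p => h; case: ifP => _ //; case: (F_subspace mu).
have pE q f (q' : seq 'rV[K]_n) : uniq q -> uniq q' -> {subset q <= q'} ->
    \sum_(mu <- q) f mu = \sum_(mu <- q') p q f mu.
  move=> uq uq' h; rewrite /p -big_mkcond /= -[RHS]big_filter.
  apply: perm_big; apply: uniq_perm; rewrite ?filter_uniq // => mu.
  by rewrite mem_filter; case hm : (mu \in q) => //=; rewrite h.
pose q := undup (s ++ t).
exists q, (fun mu => a *: p s v mu + p t w mu); split.
- exact: undup_uniq.
- by move=> mu; case: (F_subspace mu) => _; apply; apply: hp.
rewrite big_split /= -scaler_sumr -!pE ?undup_uniq // => mu h.
  by rewrite mem_undup mem_cat h orbT.
by rewrite mem_undup mem_cat h.
Qed.

End Eigenspaces.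

(** * Functionals on the enveloping algebra *)

Section Functionals.
Variables (K : numFieldType) (g : lieSuperType K) (I : finType).
Variables (x : I -> g) (par : I -> bool) (coord : g -> I -> K) (r : I -> nat).
Hypothesis x_homog : forall i, homog (par i) (x i).
Hypothesis coordE : forall y, y = \sum_i coord y i *: x i.
Hypothesis coord_linear :
  forall a y z i, coord (a *: y + z) i = a * coord y i + coord z i.
Hypothesis coord_x : forall i j, coord (x i) j = (i == j)%:R.
Hypothesis r_inj : injective r.
Implicit Types (i j k : I) (u v w : seq I) (y z : g) (phi : seq I -> K).

Local Notation U := (enveloping g).
Local Notation iota := (@Defs.iota K g).
Local Notation respects := (respects x par coord).
Local Notation T := (term K (option g)).

(** [uev t phi] is the functional [w |-> phi (t w)]. *)
Fixpoint uev (t : T) phi : seq I -> K :=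
  match t with
  | tgen (Some y) => fun w => slot coord phi [::] y w
  | tgen None => phi
  | tzero => fun=> 0
  | tadd s t => fun w => uev s phi w + uev t phi w
  | tscale c t => fun w => c * uev t phi w
  | tmul s t => uev t (uev s phi)
  end.

Lemma slot_phiD a phi psi u y v :
  slot coord (fun w => a * phi w + psi w) u y v = a * slot coord phi u y v + slot coord
    psi u y v.
Proof.
rewrite /slot mulr_sumr -big_split; apply: eq_bigr => k _ /=; ring.
Qed.

Lemma uev_phiD (t : T) a phi psi :
  uev t (fun w => a * phi w + psi w) = fun w => a * uev t phi w + uev t psi w.
Proof.
elim: t phi psi => [[y|]||s IHs t IHt|c t IHt|s IHs t IHt] phi psi /=;
  apply/funext => w //.
- exact: slot_phiD.
- by rewrite mulr0 addr0.
- by rewrite IHs IHt; ring.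
- by rewrite IHt; ring.
- by rewrite IHs IHt.
Qed.

Lemma respects_lin a phi psi : respects phi -> respects psi ->
  respects (fun w => a * phi w + psi w).
Proof.
move=> h1 h2 u i j v; rewrite /respects_at h1 h2 slot_phiD; ring.
Qed.

Lemma respects0 : respects (fun=> 0).
Proof.
move=> u i j v; rewrite /respects_at mulr0 add0r /slot big1 // => k _.
by rewrite mulr0.
Qed.

Lemma respects_slot phi y : respects phi -> respects (fun w => slot coord phi [::] y w).
Proof.
move=> h u i j v; rewrite /respects_at.
have -> : slot coord (fun w => slot coord phi [::] y w) u [< x i, x j >] v =
    \sum_k coord y k * slot coord phi (k :: u) [< x i, x j >] v.
  rewrite /slot /=; under eq_bigr do rewrite mulr_sumr.
  rewrite exchange_big; apply: eq_bigr => k _ /=; rewrite mulr_sumr.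
  by apply: eq_bigr => l _; rewrite mulrCA.
rewrite /slot mulr_sumr -big_split; apply: eq_bigr => k _ /=.
by rewrite -cat_cons h mulrDr mulrCA.
Qed.

Lemma uev_respects t phi : respects phi -> respects (uev t phi).
Proof.
elim: t phi => [[y|]||s IHs t IHt|c t IHt|s IHs t IHt] phi h /=.
- exact: respects_slot.
- by [].
- exact: respects0.
- have := respects_lin 1 (IHs _ h) (IHt _ h).
  by congr respects; apply/funext => w; rewrite mul1r.
- have := respects_lin c (IHt _ h) respects0.
  by congr respects; apply/funext => w; rewrite addr0.
- by apply: IHt; apply: IHs.
Qed.

(** Expanding [y] and [z] in the basis reduces the claim to two letters. A nonzero coordinate
    determines the parity of its letter, so the sign is the same in all terms. *)
Lemma slot_bracket phi y z a b w : respects phi -> homog a y -> homog b z ->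
  slot coord phi [::] [< y, z >] w =
    slot coord (fun w => slot coord phi [::] y w) [::] z w
    - (-1) ^+ (a && b) * slot coord (fun w => slot coord phi [::] z w) [::] y w.
Proof.
move=> h hy hz.
have -> : slot coord (fun w => slot coord phi [::] z w) [::] y w =
    \sum_i \sum_j coord y i * (coord z j * phi [:: j, i & w]).
  by apply: eq_bigr => i _; rewrite mulr_sumr.
have -> : slot coord (fun w => slot coord phi [::] y w) [::] z w =
    \sum_i \sum_j coord y i * (coord z j * phi [:: i, j & w]).
  rewrite exchange_big; apply: eq_bigr => j _; rewrite mulr_sumr.
  by apply: eq_bigr => i _ /=; rewrite mulrCA.
rewrite {1}(coordE y) bracket_suml slot_sum // mulr_sumr -sumrB.
apply: eq_bigr => i _; rewrite bracketZl slotZ // {1}(coordE z) bracket_sumr.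
rewrite slot_sum // 2!mulr_sumr -sumrB; apply: eq_bigr => j _.
rewrite bracketZr slotZ //.
have [->|hi] := eqVneq (coord y i) 0; first by rewrite !mul0r mulr0 subr0.
have [->|hj] := eqVneq (coord z j) 0; first by rewrite !mul0r !mulr0 subr0.
have -> : phi [:: i, j & w] = (-1) ^+ (a && b) * phi [:: j, i & w]
    + slot coord phi [::] [< x i, x j >] w.
  have := h [::] i j w; rewrite /respects_at /sg.
  by rewrite (coord_par x_homog coordE coord_linear coord_x hy hi)
             (coord_par x_homog coordE coord_linear coord_x hz hj).
ring.
Qed.

(** The relations of the enveloping algebra hold for the operators [uev], so the enveloping algebra
    acts from the right on the functionals that respect the relations between letters. *)
Lemma tcong_uev (s t : T) : tcong (@urel K g) s t ->
  forall phi, respects phi -> uev s phi = uev t phi.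
Proof.
elim=> {s t} //=.
- move=> s t [{}s {}t u|{}t|{}t|a y z|a b y z hy hz] phi h //=; apply/funext => w.
    by rewrite slotD // slotZ.
  by rewrite (slot_bracket w h hy hz) mulNr.
- by move=> s t _ IH phi h; rewrite IH.
- by move=> s t u _ IH1 _ IH2 phi h; rewrite IH1 // IH2.
- by move=> s s' t t' _ IH1 _ IH2 phi h; rewrite IH1 // IH2.
- by move=> c t t' _ IH phi h; rewrite IH.
- by move=> s s' t t' _ IH1 _ IH2 phi h; rewrite IH1 // IH2 //; apply: uev_respects.
- by move=> s t u phi _; apply/funext => w; rewrite addrA.
- by move=> s t phi _; apply/funext => w; rewrite addrC.
- by move=> t phi _; apply/funext => w; rewrite add0r.
- by move=> t phi _; apply/funext => w; rewrite mulN1r addNr.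
- by move=> a b t phi _; apply/funext => w; rewrite mulrA.
- by move=> t phi _; apply/funext => w; rewrite mul1r.
- by move=> a s t phi _; apply/funext => w; rewrite mulrDr.
- by move=> a b t phi _; apply/funext => w; rewrite mulrDl.
- move=> s t u phi _; have := uev_phiD u 1 (uev s phi) (uev t phi).
  have -> : (fun w => 1 * uev s phi w + uev t phi w) =
            (fun w => uev s phi w + uev t phi w).
    by apply/funext => w; rewrite mul1r.
  by move=> ->; apply/funext => w; rewrite mul1r.
- move=> a s t phi _; have := uev_phiD t a (uev s phi) (uev tzero phi).
  have -> : (fun w => a * uev s phi w + uev tzero phi w) = (fun w => a * uev s phi w).
    by apply/funext => w; rewrite addr0.
  move=> ->; apply/funext => w.
  have := uev_phiD t (-1) (fun=> 0) (fun=> 0).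
  have -> : (fun w : seq I => -1 * 0 + 0 : K) = (fun=> 0).
    by apply/funext => w'; rewrite mulr0 addr0.
  by move=> /(congr1 (fun f => f w)) /= ->; rewrite mulN1r addNr addr0.
Qed.

Definition uact (u : U) phi : seq I -> K := uev (repr u) phi.

Lemma uact_cls t phi : respects phi ->
  uact (tcls (P := upres g) t) phi = uev t phi.
Proof. by move=> h; apply: tcong_uev => //; apply: (@tcls_repr K (upres g)). Qed.

Lemma uactD a (u v : U) phi w : respects phi ->
  uact (a *: u + v) phi w = a * uact u phi w + uact v phi w.
Proof.
elim/tcls_ind: u => s; elim/tcls_ind: v => t h.
by rewrite -tclsZ -tclsD !uact_cls.
Qed.

Lemma uactM (u v : U) phi : respects phi -> uact (u * v) phi = uact v (uact u phi).
Proof.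
elim/tcls_ind: u => s; elim/tcls_ind: v => t h.
rewrite -[_ * _](@tclsM K (upres g)) !uact_cls //.
exact: uev_respects.
Qed.

Lemma uact_iota y phi w : respects phi -> uact (iota y) phi w = slot coord phi [::] y w.
Proof. by move=> h; rewrite uact_cls. Qed.

Lemma uact1 phi : respects phi -> uact 1 phi = phi.
Proof. by move=> h; rewrite uact_cls. Qed.

Lemma uact_respects (u : U) phi : respects phi -> respects (uact u phi).
Proof. exact: uev_respects. Qed.

Definition uword w : U := \prod_(i <- w) iota (x i).

Lemma uact_uword w phi v : respects phi -> uact (uword w) phi v = phi (w ++ v).
Proof.
rewrite /uword; elim: w phi => [|i w IH] phi h; first by rewrite big_nil uact1.
rewrite big_cons uactM // IH; last exact: uact_respects.
by rewrite uact_iota // slot_x.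
Qed.

(** The action inserts letters in front of a word, so it commutes with appending a letter at the
    end. *)
Lemma uact_last phi k b : (forall w, phi (rcons w k) = b * phi w) ->
  forall (u : U) w, uact u phi (rcons w k) = b * uact u phi w.
Proof.
rewrite /uact => h u; move: (repr u) => t; elim: t phi h => //=.
- move=> [y|] phi h w //; rewrite /slot mulr_sumr; apply: eq_bigr => i _ /=.
  by rewrite -rcons_cons h mulrCA.
- by move=> phi h w; rewrite mulr0.
- by move=> s IHs t IHt phi h w; rewrite IHs // IHt // mulrDr.
- by move=> c t IHt phi h w; rewrite IHt // mulrCA.
- by move=> s IHs t IHt phi h w; apply: IHt => {}w; apply: IHs.
Qed.

(** [W] need not be stable under multiplication; the induction on terms therefore runs in the span
    of all words, which is stable under right multiplication by letters. *)
Lemma uword_span (W : set U) : subspace W -> (forall w, W (uword w)) -> forall u : U, W u.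
Proof.
move=> hW hw.
suff h (t : T) (V : set U) : subspace V -> (forall w, V (uword w)) ->
    (forall (u : U) i, V u -> V (u * iota (x i))) ->
    forall u : U, V u -> V (u * tcls (P := upres g) t).
  elim/tcls_ind => t; rewrite -(mul1r (tcls (P := upres g) t : U)).
  have hV : subspace (lspan (range uword)) by apply: lspan_subspace.
  have V1 : lspan (range uword) 1.
    by apply: sub_lspan; exists [::] => //; rewrite /uword big_nil.
  have := h t _ hV (fun w => sub_lspan (imageT _ w)) _ _ V1.
  move=> H; apply: (lspan_min hW _ (H _)) => [_ [w _ <-] //|u i].
  apply: (@lspan_min _ _ _ [set u | lspan (range uword) (u * iota (x i))]).
    split=> [|a u1 u2 h1 h2] /=; first by rewrite mul0r; case: hV.
    by rewrite mulrDl -scalerAl; case: hV => _; apply.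
  move=> _ [w _ <-]; apply: sub_lspan; exists (rcons w i) => //.
  by rewrite /uword -cats1 big_cat /= big_seq1.
move=> hV hw' hi; elim: t => [[y|]||s IHs t IHt|c t IHt|s IHs t IHt] u hu.
- rewrite -[tcls _]/(iota y) (coordE y).
  have -> : iota (\sum_i coord y i *: x i) = \sum_i coord y i *: iota (x i).
    have i0 : iota (0 : g) = 0.
      by have := iota_linear (-1) (0 : g) 0; rewrite scaler0 addr0 scaleN1r addNr.
    elim/big_rec2: _ => [//|i z z' _ <-]; exact: iota_linear.
  rewrite mulr_sumr; apply: subspace_sum => // i.
  by rewrite -scalerAr; apply: subspaceZ => //; apply: hi.
- by rewrite -[tcls _]/(1 : U) mulr1.
- by rewrite tcls0 mulr0; case: hV.
- by rewrite tclsD mulrDr; apply: subspaceD => //; [apply: IHs | apply: IHt].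
- by rewrite tclsZ -scalerAr; apply: subspaceZ => //; apply: IHt.
- by rewrite tclsM -[pres_mul _ _]/(_ * _ : U) mulrA; apply: IHt; apply: IHs.
Qed.

End Functionals.

(** * The PBW basis of a Verma module *)

Section VermaBasis.
Variables (K : numFieldType) (n : nat) (A : 'M[K]_n) (I : finType).
Local Notation g := (contragredient A).
Local Notation U := (enveloping g).
Local Notation iota := (@Defs.iota K g).
Variables (x : I -> g) (par : I -> bool) (coord : g -> I -> K) (r : I -> nat).
Hypothesis x_homog : forall i, homog (par i) (x i).
Hypothesis coordE : forall y, y = \sum_i coord y i *: x i.
Hypothesis coord_linear :
  forall a y z i, coord (a *: y + z) i = a * coord y i + coord z i.
Hypothesis coord_x : forall i j, coord (x i) j = (i == j)%:R.
Hypothesis r_inj : injective r.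
Variables (wt : I -> 'rV[K]_n) (cc : I -> 'cV[K]_n).
Variables (P : set 'rV[K]_n) (lam : 'rV[K]_n).
Hypothesis x_weight : forall i, root_space (wt i) (x i).
Hypothesis x_cartan : forall i, wt i = 0 -> x i = cartan A (cc i).
Hypothesis cartan_coord0 : forall c i, wt i != 0 -> coord (cartan A c) i = 0.
Hypothesis cartan_coord :
  forall c, c = \sum_(i | wt i == 0) coord (cartan A c) i *: cc i.
Hypothesis P0 : ~ P 0.
Hypothesis PD : forall i j k, P (wt i) -> P (wt j) -> wt k = wt i + wt j -> P (wt k).

Definition low i := (wt i != 0) && ~~ `[< P (wt i) >].

Lemma lowE i : low i = (wt i != 0) && ~~ `[< P (wt i) >].
Proof. by []. Qed.

Hypothesis r_low : forall i j, low i -> ~~ low j -> (r i < r j)%N.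

Implicit Types (i j k : I) (u v w m : seq I) (y z : g) (phi : seq I -> K).
Local Notation respects := (respects x par coord).
Local Notation redex := (is_redex r par).
Local Notation normal := (normal r par).
Local Notation uword := (uword x).
Local Notation uact := (@uact K g I coord).
Local Notation M := (verma A P lam).
Local Notation clsM := (cls (verma_rel P lam)).

Let linU := uactD x_homog coordE coord_linear coord_x.
Let mulU := uactM x_homog coordE coord_linear coord_x.
Let iotaU := uact_iota x_homog coordE coord_linear coord_x.
Let wordU := uact_uword x_homog coordE coord_linear coord_x.

Lemma coord_weight mu y k : root_space mu y -> coord y k != 0 -> wt k = mu.
Proof.
move=> hy hk; apply: contrapT => /eqP /row_neq_ex [c hc].
have := congr1 (fun z => coord z k) (hy c).
rewrite /= (coordZ coord_linear) {1}(coordE y) bracket_sumr coord_sum //.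
rewrite (bigD1 k) //= bracketZr x_weight !(coordZ coord_linear) coord_x eqxx mulr1.
rewrite big1 => [|j hj]; last first.
  by rewrite bracketZr x_weight !(coordZ coord_linear) coord_x (negbTE hj) !mulr0.
rewrite addr0 mulrC => /(mulIf hk) e.
by rewrite e eqxx in hc.
Qed.

Lemma n_plus_coord y k : n_plus P y -> coord y k != 0 -> P (wt k).
Proof.
move=> hy; apply: contraNP => hk; apply/eqP; move: y hy.
apply: (@lspan_min _ _ _ [set y | coord y k = 0]).
  split=> [|a y z hy hz] /=; first by rewrite (coord0 coord_linear).
  by rewrite coord_linear hy hz mulr0 addr0.
move=> y [mu hmu hy] /=; apply/eqP; apply: contraPT hmu => /(coord_weight hy) <-.
exact: hk.
Qed.

Lemma x_n_plus i : P (wt i) -> n_plus P (x i).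
Proof. by move=> h; apply: sub_lspan; exists (wt i). Qed.

Lemma x_neq0 i : x i != 0.
Proof.
apply/eqP => e; have := coord_x i i.
by rewrite e (coord0 coord_linear) eqxx => /eqP; rewrite eq_sym oner_eq0.
Qed.

Lemma lowPn i : ~~ low i -> wt i = 0 \/ P (wt i).
Proof. by rewrite negb_and !negbK => /orP [/eqP|/asboolP]; [left|right]. Qed.

(** The derived algebra of the Borel subalgebra lies in $\mathfrak{n}^+$. This is what makes [chi] a
    character. *)
Lemma high_bracket i j k : ~~ low i -> ~~ low j ->
  coord [< x i, x j >] k != 0 -> P (wt k).
Proof.
have h0 a b : wt a = 0 -> wt b = 0 \/ P (wt b) ->
    coord [< x a, x b >] k != 0 -> P (wt k).
  move=> ha hb; rewrite (x_cartan ha) x_weight coordZ // coord_x.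
  case: (eqVneq b k) => [ <-|_]; last by rewrite mulr0 eqxx.
  by case: hb => // ->; rewrite mul0mx mxE mul0r eqxx.
move=> /lowPn [hi|hi] /lowPn hj; first exact: h0.
case: hj => hj.
  rewrite (skewx x_homog i j) coordZ // mulf_eq0 => /norP [_].
  by apply: h0 => //; right.
move=> hk; apply: PD hi hj _; apply: coord_weight hk => c.
have := bracket_jacobi (x j) (cartan_even A c) (x_homog i).
rewrite expr0 scale1r !x_weight => ->.
by rewrite bracketZl bracketZr -scalerDl mulmxDl; congr (_ *: _); rewrite [RHS]mxE.
Qed.

(** The character of the Borel subalgebra on the letters that are not low. *)
Definition chi i : K := if wt i == 0 then (lam *m cc i) 0 0 else 0.

Lemma chi_pos i : P (wt i) -> chi i = 0.
Proof. by rewrite /chi; case: eqP => // ->. Qed.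

(** An odd letter of weight zero would be a Cartan element, thus even as well, thus zero. *)
Lemma chi_odd i : par i -> chi i = 0.
Proof.
rewrite /chi; case: eqP => // h hp; have /eqP := x_neq0 i; case.
apply: homog_cap; first by rewrite (x_cartan h); apply: cartan_even.
by rewrite -hp.
Qed.

Definition chi_word w : K := \prod_(i <- w) chi i.

Lemma normal_low_cat m u : normal m -> all low m -> normal u ->
  all (predC low) u -> normal (m ++ u).
Proof.
move=> hm am hu au; elim: m hm am => [//|i [|j m] IH] /=.
  move=> _ /andP [hi _]; case: u hu au {IH} => //= j u -> /andP [hj _].
  rewrite andbT /is_redex ltnNge (ltnW (r_low hi hj)) /=.
  by apply: contra hj => /andP [/eqP <-].
move=> /andP [h hm] /andP [hi am]; rewrite h /=.
by have := IH hm am; rewrite /=.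
Qed.

Lemma normal_high i w : normal (i :: w) -> ~~ low i -> all (predC low) w.
Proof.
elim: w i => // j w IH i; rewrite normal_cons => /andP [h hw] hi.
have hj : ~~ low j.
  by apply: contra h => hj; rewrite /is_redex r_low.
by rewrite /= hj; apply: IH hw hj.
Qed.

Lemma normal_low_split w : normal w ->
  w = filter low w ++ filter (predC low) w.
Proof.
elim: w => // i w IH hn; have [_ /IH {}IH] := @normal_cat _ _ _ [:: i] w hn.
rewrite /=; case: ifP => hi /=; first by rewrite {1}IH.
have /all_filterP -> := normal_high hn (negbT hi).
suff -> : filter low w = [::] by [].
apply/eqP; rewrite -size_eq0 size_filter -leqn0 leqNgt -has_count -all_predC.
exact: normal_high hn (negbT hi).
Qed.

(** * Functionals dual to the low words *)

Section DualVector.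
Variable m0 : seq I.

(** A normal word is its low letters followed by the others: the first part is tested against [m0],
    the second evaluated by the character. *)
Definition dual_seed w : K :=
  if filter low w == m0 then chi_word (filter (predC low) w) else 0.

Definition dual := extend x par coord r dual_seed.

Lemma dual_respects : respects dual.
Proof. exact: extend_respects. Qed.

(** The formula of the seed persists for an unsorted tail [u]: a swap preserves the product of
    characters, a sign appears only between odd letters, where [chi] is 0, and the bracket terms
    contain a positive letter, where [chi] is 0 too. *)
Lemma dual_cat m u : normal m -> all low m -> all (predC low) u ->
  dual (m ++ u) = (m == m0)%:R * chi_word u.
Proof.
move=> hm am; move: u; apply: (@word_ind _ r par) => [u hu au|u i j v hr h1 h2 au].
  rewrite /dual extend_normal; last exact: normal_low_cat.
  rewrite /dual_seed !filter_cat (all_filterP am) (all_filterP au).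
  have -> : filter low u = [::].
    by apply/eqP; rewrite -size_eq0 size_filter -leqn0 leqNgt -has_count -all_predC.
  have -> : filter (predC low) m = [::].
    apply/eqP; rewrite -size_eq0 size_filter -leqn0 leqNgt -has_count.
    by rewrite -all_predC; apply: sub_all am => k /= ->.
  by rewrite cats0; case: eqP; rewrite ?mul1r ?mul0r.
move: au; rewrite all_cat /= => /and4P [au hi hj av].
have hs : slot coord dual (m ++ u) [< x i, x j >] v = 0.
  apply: big1 => k _; have [->|hk] := eqVneq (coord [< x i, x j >] k) 0.
    by rewrite mul0r.
  have pk := high_bracket hi hj hk.
  have lk : ~~ low k by rewrite /low negb_and !negbK orbC asboolT.
  rewrite -catA h2 ?all_cat /= ?au ?lk ?av //.
  rewrite /chi_word big_cat big_cons /= (chi_pos pk) mul0r !mulr0 //.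
have -> : dual (m ++ u ++ [:: i, j & v]) = reduct x par coord dual (m ++ u) i j v.
  rewrite catA; apply/(redex_reduct _ _ _ _ _ hr).
  exact: dual_respects.
have cw a b : chi_word (u ++ [:: a, b & v]) = chi a * chi b * chi_word (u ++ v).
  by rewrite /chi_word !big_cat !big_cons /=; ring.
rewrite /reduct cw; case: (eqVneq i j) hr h1 hs => [ <-|nij] hr h1 hs.
  have hp : par i by move: hr; rewrite /is_redex ltnn eqxx.
  by rewrite hs (chi_odd hp) !(mul0r, mulr0).
rewrite hs addr0 -catA h1 // ?all_cat /= ?au ?hi ?hj ?av // cw /sg.
have [hp|hp] := boolP (par i); last by rewrite expr0; ring.
by rewrite (chi_odd hp); ring.
Qed.

(** As functions of [w] both sides respect the relations, so they are compared on normal words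
    only. *)
Lemma dual_rcons i w : ~~ low i -> dual (rcons w i) = chi i * dual w.
Proof.
move=> hi; move: w.
apply: (respects_eq (r := r) (phi := fun w => dual (rcons w i))
  (phi' := fun w => chi i * dual w)).
- move=> u a b v; have := dual_respects u a b (rcons v i).
  rewrite /respects_at !rcons_cat /= => ->; congr (_ + _).
  by apply: eq_bigr => k _; rewrite rcons_cat.
- move=> u a b v; rewrite /respects_at dual_respects mulrDr mulrCA.
  by congr (_ + _); rewrite /slot mulr_sumr; apply: eq_bigr => k _; rewrite mulrCA.
move=> w hw; rewrite (normal_low_split hw) -cats1 -catA.
have [hl hh] : normal (filter low w) /\ normal (filter (predC low) w).
  by apply: normal_cat; rewrite -normal_low_split.
have al : all low (filter low w) by apply: filter_all.
have ah : all (predC low) (filter (predC low) w) by apply: filter_all.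
rewrite !dual_cat // ?all_cat ?ah /= ?hi //.
rewrite /chi_word big_cat big_seq1 /=; ring.
Qed.

Definition dual_form (u : U) : K := uact u dual [::].

(** Appending a letter that is not low scales [dual] by [chi]; hence right multiplication by
    $\mathfrak{h}\oplus\mathfrak{n}^+$ acts by the highest weight, and the functional descends to
    the Verma module. *)
Lemma dual_form_rel (u : U) : lspan (verma_rel P lam) u -> dual_form u = 0.
Proof.
move: u; apply: (@lspan_min _ _ _ [set u : U | dual_form u = 0]).
  rewrite /dual_form; split=> [|a u v hu hv] /=.
    have := linU (-1) (0 : U) 0 [::] dual_respects.
    by rewrite scaler0 addr0 mulN1r addNr.
  by rewrite linU; [rewrite hu hv mulr0 addr0 | exact: dual_respects].
move=> _ [u [c [y [hy ->]]]] /=; rewrite /dual_form.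
have -> : u * iota (cartan A c + y) - (lam *m c) 0 0 *: u =
  (- (lam *m c) 0 0) *: u + u * iota (cartan A c + y) by rewrite addrC scaleNr.
have hd := dual_respects.
rewrite linU // mulU // iotaU; last exact: uact_respects.
have hz i : wt i == 0 -> ~~ low i by rewrite /low => ->.
rewrite slotD // [X in _ + (_ + X)]big1 => [|k _]; last first.
  have [->|hk] := eqVneq (coord y k) 0; first by rewrite mul0r.
  have pk := n_plus_coord hy hk.
  have lk : ~~ low k by rewrite /low negb_and !negbK orbC asboolT.
  rewrite -[[:: k]]/(rcons [::] k) (uact_last coord (b := chi k)) ?chi_pos ?mul0r
    ?mulr0 //.
  by move=> w; rewrite dual_rcons // chi_pos.
have e : (lam *m c) 0 0 = \sum_i coord (cartan A c) i * chi i.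
  rewrite {1}(cartan_coord c) mulmx_sumr summxE big_mkcond; apply: eq_bigr => i _.
  case: eqP => [h|/eqP h]; first by rewrite /chi h eqxx -scalemxAr mxE.
  by rewrite cartan_coord0 // mul0r.
rewrite addr0 e mulNr mulr_suml /slot; apply/eqP.
rewrite addrC subr_eq0; apply/eqP; apply: eq_bigr => k _.
have [hk|hk] := eqVneq (wt k) 0; last by rewrite cartan_coord0 // !mul0r.
rewrite -mulrA -[[:: k]]/(rcons [::] k) (uact_last coord (b := chi k)) // => w.
by rewrite dual_rcons ?hz ?hk.
Qed.

Lemma dual_form_word w : normal w -> all low w -> dual_form (uword w) = (w == m0)%:R.
Proof.
move=> hw aw; rewrite /dual_form wordU //; last exact: dual_respects.
by rewrite dual_cat // /chi_word big_nil mulr1.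
Qed.

End DualVector.

Definition low_words : set (seq I) := [set w | normal w && all low w].

Lemma dual_formD m0 a (u v : U) :
  dual_form m0 (a *: u + v) = a * dual_form m0 u + dual_form m0 v.
Proof. by rewrite /dual_form linU //; apply: dual_respects. Qed.

Lemma verma_free (s : seq (seq I)) (a : seq I -> K) : uniq s ->
  {in s, forall w, low_words w} ->
  \sum_(w <- s) a w *: clsM (uword w) = 0 -> {in s, forall w, a w = 0}.
Proof.
move=> us hs.
have -> : \sum_(w <- s) a w *: clsM (uword w) = clsM (\sum_(w <- s) a w *: uword w).
  elim/big_rec2: _ => [|w u v _ ->]; first by rewrite cls0.
  by rewrite [RHS]clsD clsZ.
move=> /cls_eq0 h w0 hw0; have := dual_form_rel w0 h.
have -> : dual_form w0 (\sum_(w <- s) a w *: uword w) =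
    \sum_(w <- s) a w * dual_form w0 (uword w).
  elim/big_rec2: _ => [|w u v _ <-]; last by rewrite dual_formD.
  have := dual_formD w0 (-1) 0 0.
  by rewrite scaler0 addr0 mulN1r addNr.
rewrite (bigD1_seq w0) //= big_seq_cond big1 => [|w /andP [/hs /andP [h1 h2] hn]].
  have /andP [h1 h2] := hs _ hw0.
  by rewrite dual_form_word // eqxx mulr1 addr0.
by rewrite dual_form_word // (negbTE hn) mulr0.
Qed.

Lemma clsM_sum (J : Type) (s : seq J) (F : J -> U) :
  clsM (\sum_(i <- s) F i) = \sum_(i <- s) clsM (F i).
Proof. by elim/big_rec2: _ => [|i u v _ <-]; rewrite ?cls0 ?clsD. Qed.

Lemma n_plus0 : @n_plus _ _ A P 0.
Proof. by have [] := lspan_subspace (\bigcup_(mu in P) @root_space K n A mu). Qed.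

Lemma iota0 : iota 0 = 0.
Proof. by have := iota_linear (-1) (0 : g) 0; rewrite scaler0 addr0 scaleN1r addNr. Qed.

Lemma iota_coord y : iota y = \sum_i coord y i *: iota (x i).
Proof.
rewrite {1}(coordE y); elim/big_rec2: _ => [|i z z' _ <-]; first exact: iota0.
exact: iota_linear.
Qed.

Lemma cls_high (u : U) i : ~~ low i -> clsM (u * iota (x i)) = chi i *: clsM u.
Proof.
have n0 := n_plus0.
have cartan0 : cartan A 0 = 0 :> g.
  by rewrite /cartan /pre_cartan big1 // => j _; rewrite mxE scale0r.
move=> hi; rewrite -clsZ; apply/clsP; apply: sub_lspan.
case/lowPn: hi => hi.
  exists u, (cc i), 0; split=> //; rewrite addr0 (x_cartan hi) /chi hi eqxx //.
exists u, 0, (x i); split; first exact: x_n_plus.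
by rewrite cartan0 add0r chi_pos // mulmx0 mxE !scale0r.
Qed.

Lemma uword_cat v w : uword (v ++ w) = uword v * uword w.
Proof. exact: big_cat. Qed.

Lemma uword_cons i w : uword (i :: w) = iota (x i) * uword w.
Proof. exact: big_cons. Qed.

Lemma uword_swap u i j v : uword (u ++ i :: j :: v) =
  (-1) ^+ (par i && par j) *: uword (u ++ j :: i :: v)
  + \sum_k coord [< x i, x j >] k *: uword (u ++ k :: v).
Proof.
rewrite !uword_cat !uword_cons.
have -> : \sum_k coord [< x i, x j >] k *: uword (u ++ k :: v) =
    uword u * iota [< x i, x j >] * uword v.
  rewrite iota_coord mulr_sumr mulr_suml; apply: eq_bigr => k _.
  by rewrite uword_cat uword_cons -scalerAr -scalerAl mulrA.
rewrite (iota_bracket (x_homog i) (x_homog j)) mulrBr mulrBl !mulrA.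
by rewrite -scalerAr -scalerAl !mulrA addrC subrK.
Qed.

Lemma uword_diag u i v : par i ->
  uword (u ++ i :: i :: v) =
  2^-1 *: \sum_k coord [< x i, x i >] k *: uword (u ++ k :: v).
Proof.
move=> hp; have := uword_swap u i i v; rewrite hp /= expr1 scaleN1r.
set a := uword _; set s := \sum_k _ => e.
have -> : s = 2 *: a by rewrite scaler_nat mulr2n {2}e addrA subrr add0r.
by rewrite scalerA mulVf ?scale1r // pnatr_eq0.
Qed.

(** In a normal word the letters that are not low stand at the end, where they are stripped off one
    by one as scalars; the other words are rewritten. *)
Lemma verma_span (W : set M) : subspace W ->
  (forall w, low_words w -> W (clsM (uword w))) -> forall t : M, W t.
Proof.
move=> hW hl; elim/cls_ind.
apply: (uword_span coordE (W := [set u : U | W (clsM u)])) => [|w].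
  split=> [|a u v hu hv] /=; first by case: hW.
  by rewrite clsD clsZ; case: hW => _; apply.
move: w; apply: (@word_ind _ r par) => [w hw|u i j v hr h1 h2] /=.
  rewrite (normal_low_split hw).
  have [hn _] : normal (filter low w) /\ normal (filter (predC low) w).
    by apply: normal_cat; rewrite -normal_low_split.
  have := filter_all (predC low) w; move: (filter (predC low) w) => h.
  elim/last_ind: h => [_|h i IH].
    by rewrite cats0; apply: hl; rewrite /low_words /= hn filter_all.
  rewrite all_rcons => /andP [hi /IH hh].
  rewrite -rcons_cat -cats1 uword_cat uword_cons [uword [::]]big_nil mulr1.
  by rewrite cls_high //; apply: subspaceZ.
have hs : W (clsM (\sum_k coord [< x i, x j >] k *: uword (u ++ k :: v))).
  rewrite clsM_sum; apply: subspace_sum => // k.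
  by rewrite clsZ; apply: subspaceZ => //; apply: h2.
case: (eqVneq i j) hr h1 hs => [ <-|nij] hr h1 hs.
  rewrite uword_diag; first by rewrite clsZ; apply: subspaceZ.
  by move: hr; rewrite /is_redex ltnn eqxx.
by rewrite uword_swap clsD clsZ; apply: subspaceD => //; apply: subspaceZ => //;
  apply: h1.
Qed.

(** * Weights and parities of the basis vectors *)

Definition wt_word w := \sum_(i <- w) wt i.
Definition par_word w := \big[addb/false]_(i <- w) par i.

Lemma clsM_weight w : weight_space (M := M) (wt_word w + lam) (clsM (uword w)).
Proof.
move=> c; rewrite [act _ _]verma_actE.
have -> : iota (cartan A c) * uword w =
    uword w * iota (cartan A c) + (wt_word w *m c) 0 0 *: uword w.
  rewrite /wt_word; elim: w => [|i w IH].
    by rewrite [uword _]big_nil big_nil mul0mx mxE scale0r addr0 mulr1 mul1r.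
  have hc := iota_bracket (cartan_even A c) (x_homog i).
  rewrite x_weight expr0 scale1r in hc.
  have e : iota (cartan A c) * iota (x i) =
      iota (x i) * iota (cartan A c) + (wt i *m c) 0 0 *: iota (x i).
    have := iota_linear ((wt i *m c) 0 0) (x i) 0; rewrite addr0 iota0 addr0 hc.
    by move=> <-; rewrite addrC subrK.
  have -> : ((\sum_(j <- i :: w) wt j) *m c) 0 0 =
      (wt i *m c) 0 0 + ((\sum_(j <- w) wt j) *m c) 0 0.
    by rewrite big_cons mulmxDl [LHS]mxE.
  rewrite uword_cons mulrA e mulrDl -mulrA IH mulrDr mulrA.
  rewrite -scalerAr -scalerAl scalerDl -!addrA; congr (_ + _).
  by rewrite addrC.
rewrite [LHS]clsD clsZ mulmxDl [in RHS]mxE scalerDl addrC; congr (_ + _).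
rewrite -clsZ; apply/clsP; apply: sub_lspan.
exists (uword w), c, 0; split; last by rewrite addr0.
exact: n_plus0.
Qed.

Lemma clsM_homog w : homog (s := M) (par_word w) (clsM (uword w)).
Proof.
exists (uword w) => //; elim: w => [|i w IH].
  rewrite [uword _]big_nil [par_word _]big_nil.
  by exists (tgen None) => //; constructor.
rewrite uword_cons [par_word _]big_cons; apply: umul_homog => //.
exact: iota_homog.
Qed.

Lemma act_operator_linear c a (u v : M) :
  act (cartan A c) (a *: u + v) = a *: act (cartan A c) u + act (cartan A c) v.
Proof. exact: act_linearr. Qed.

Lemma set0_subspace (V : lmodType K) : subspace [set (0 : V)].
Proof. by split=> // a u v -> ->; rewrite scaler0 addr0. Qed.

(** A subspace of the weight space by construction. The two coincide because weight vectors of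
    distinct weights are independent. *)
Definition weight_words mu : set M :=
  lspan [set clsM (uword w) | w in [set w | low_words w /\ wt_word w + lam = mu]].

Lemma weight_words_sub mu : weight_words mu `<=` weight_space (M := M) mu.
Proof.
apply: lspan_min; first exact: (eigen_subspace act_operator_linear).
by move=> _ [w [_ <-] <-]; apply: clsM_weight.
Qed.

Lemma verma_eigen_sums t : eigen_sums weight_words t.
Proof.
have hs := eigen_sums_subspace (fun mu => lspan_subspace _ : subspace (weight_words mu)).
apply: (verma_span hs) => w hw.
apply: (@sub_eigen_sums _ _ _ _ _ (wt_word w + lam)) => [mu|].
  exact: lspan_subspace.
by apply: sub_lspan; exists w.
Qed.

Lemma verma_component s (v : 'rV[K]_n -> M) : uniq s ->
  (forall mu, weight_space (M := M) mu (v mu)) -> \sum_(mu <- s) v mu = 0 ->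
  forall mu, mu \in s -> v mu = 0.
Proof.
move=> us hv h0; apply: (eigen_component act_operator_linear (set0_subspace M)) => //.
by move=> c u ->; rewrite (eigen_operator0 act_operator_linear).
Qed.

Lemma verma_weight_module : weight_module M.
Proof.
split=> [t|]; last exact: verma_component.
have [s [v [_ hv ->]]] := verma_eigen_sums t.
by exists s, v; split=> // mu; apply: weight_words_sub.
Qed.

Lemma weight_space_words mu : weight_space (M := M) mu `<=` weight_words mu.
Proof.
move=> t ht; have [s [v [us hv e]]] := verma_eigen_sums t.
have h0 nu : weight_words nu 0 by case: (lspan_subspace _ : subspace (weight_words nu)).
(* Subtracting [t] in weight [mu] leaves weight vectors with sum zero, so each vanishes, and [t] is
   its own component. If [mu] is not in [s], that component is the default 0. *)
pose v' nu := (if nu \in s then v nu else 0) - (if nu == mu then t else 0).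
have hv' nu : weight_space (M := M) nu (v' nu).
  apply: (subspaceB (eigen_subspace act_operator_linear nu)).
    by apply: weight_words_sub; case: ifP.
  by case: eqP => [->|_] //; apply: weight_words_sub.
have sum0 : \sum_(nu <- undup (mu :: s)) v' nu = 0.
  have := undup_uniq (mu :: s); have := mem_undup (mu :: s).
  move: (undup _) => q hq uq; rewrite sumrB [X in X - _](_ : _ = t); last first.
    rewrite e -big_mkcond /= -big_filter; apply: perm_big.
    apply: uniq_perm => [|//|nu]; first by rewrite filter_uniq.
    by rewrite mem_filter hq inE; case: (nu \in s); rewrite ?orbT.
  rewrite -big_mkcond /= -big_filter (perm_big [:: mu]) ?big_seq1 ?subrr //=.
  apply: uniq_perm => [|//|nu]; first by rewrite filter_uniq.
  by rewrite mem_filter hq !inE; case: eqP.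
have := verma_component (undup_uniq _) hv' sum0 (mu := mu).
rewrite mem_undup mem_head /v' eqxx => /(_ isT) /eqP; rewrite subr_eq0 => /eqP <-.
by case: ifP.
Qed.

Lemma lspan_imageP (V : lmodType K) (J : eqType) (f : J -> V) (B : seq J)
    (S : set J) (t : V) : uniq B -> (forall q, S q -> q \in B) -> lspan (f @` S) t ->
  exists a : J -> K, t = \sum_(q <- B) a q *: f q.
Proof.
move=> uB hS; move: t.
apply: (@lspan_min _ _ _ [set t | exists a : J -> K, t = \sum_(q <- B) a q *: f q]).
  split=> [|a _ _ [b ->] [c ->]] /=.
    by exists (fun=> 0); rewrite big1 // => q _; rewrite scale0r.
  exists (fun q => a * b q + c q).
  rewrite scaler_sumr -big_split; apply: eq_bigr => q _.
  by rewrite scalerDl scalerA.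
move=> _ [q /hS hq <-]; exists (fun q' => (q' == q)%:R).
rewrite (bigD1_seq q) //= eqxx scale1r big1 ?addr0 // => q' /negbTE ->.
by rewrite scale0r.
Qed.

Lemma verma_has_dim mu (B : seq (seq I)) : uniq B ->
  (forall w, w \in B <-> low_words w /\ wt_word w + lam = mu) ->
  has_dim (weight_space (M := M) mu) (size B).
Proof.
move=> uB hB; pose b (q : 'I_(size B)) := nth [::] B q.
have bB q : b q \in B by apply: mem_nth.
have sumB (V : lmodType K) (F : seq I -> V) :
    \sum_(w <- B) F w = \sum_(q < size B) F (b q).
  by rewrite (big_nth [::]) big_mkord.
exists (fun q => clsM (uword (b q)) : M); split.
- by move=> q; have /hB [_ <-] := bB q; apply: clsM_weight.
- move=> a e q.
  pose a' w := if insub (index w B) is Some q' then a q' else 0.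
  have ha q' : a' (b q') = a q'.
    rewrite /a' /b index_uniq //; case: insubP => [p _ hp|]; last by rewrite ltn_ord.
    by congr a; apply: val_inj.
  rewrite -ha; apply: (verma_free uB (a := a')) (bB q) => [w /hB [] //|].
  by rewrite sumB -[RHS]e; apply: eq_bigr => q' _; rewrite ha.
move=> t /weight_space_words ht.
have [a ->] := lspan_imageP uB (fun w h => (hB w).2 h) ht.
by exists (fun q => a (b q)); rewrite sumB.
Qed.

(** When all words of weight [mu] have parity [p], the weight space is contained in one graded part
    and meets the other in 0. *)
Lemma verma_graded_has_dim (q p : bool) mu (B : seq (seq I)) : uniq B ->
  (forall w, w \in B <-> low_words w /\ wt_word w + lam = mu) ->
  (forall w, w \in B -> par_word w = p) ->
  has_dim (graded_weight_space (M := M) q mu) (if q == p then size B else 0).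
Proof.
move=> uB hB hp.
have hom t : weight_space (M := M) mu t -> homog (s := M) p t.
  move=> /weight_space_words; move: t; apply: lspan_min; first exact: homog_subspace.
  by move=> _ [w /hB /hp <- <-]; apply: clsM_homog.
case: eqP => [->|hi].
  have -> : graded_weight_space (M := M) p mu = weight_space (M := M) mu.
    by apply/seteqP; split=> t; [case | move=> ht; split=> //; apply: hom].
  exact: verma_has_dim.
exists (fun=> 0); split=> [[]//|a _ []//|t [h1 /hom h2]].
exists (fun=> 0); rewrite big_ord0.
by case: q p hi {hp hom} h1 h2 => -[] // _ h1 h2; apply: homog_cap.
Qed.

End VermaBasis.

(** * An explicit model of D(2,1,alpha) *)

(** The basis of D(2,1,alpha) is numbered by 0, ..., 16: the letters 0-2 are the
    [h_i], 3-5 the [e_i], 9 is the root vector [E] of weight [b_0 + b_1 + b_2],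
    and [6 + k] is [[e_i, e_j]] with [{i, j, k} = {0, 1, 2}]; adding 7 to the code
    of a positive root vector gives its opposite. A structure constant
    [p + q alpha] is stored as the pair [(p, q)]. *)
Definition D21_parity (i : nat) : bool :=
  i \in [:: 3; 4; 5; 9; 10; 11; 12; 16]%N.

(** Coordinates in the simple roots [b_0], [b_1], [b_2]. *)
Definition D21_root (i k : nat) : int :=
  if (i < 3)%N then 0
  else if (i < 6)%N then (i == 3 + k)%N%:Z
  else if (i < 9)%N then (i != 6 + k)%N%:Z
  else if (i < 10)%N then 1
  else if (i < 13)%N then - (i == 10 + k)%N%:Z
  else if (i < 16)%N then - (i != 13 + k)%N%:Z
  else -1.

(** Only nonzero brackets of root vectors with increasing codes are listed. Skew-symmetry gives the
    opposite order, and the weights give the brackets with the [h_i]. *)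
Definition D21_table : seq (nat * nat * seq (nat * (int * int))) :=
  [:: (3, 4, [:: (8, (1, 0)%Z)]); (3, 5, [:: (7, (1, 0)%Z)]);
   (3, 6, [:: (9, (1, 1)%Z)]); (3, 10, [:: (0, (1, 0)%Z)]);
   (3, 14, [:: (12, (0, -1)%Z)]); (3, 15, [:: (11, (-1, 0)%Z)]);
   (3, 16, [:: (13, (1, 0)%Z)]); (4, 5, [:: (6, (1, 0)%Z)]);
   (4, 7, [:: (9, (0, -1)%Z)]); (4, 11, [:: (1, (1, 0)%Z)]);
   (4, 13, [:: (12, (1, 1)%Z)]); (4, 15, [:: (10, (-1, 0)%Z)]);
   (4, 16, [:: (14, (1, 0)%Z)]); (5, 8, [:: (9, (-1, 0)%Z)]);
   (5, 12, [:: (2, (1, 0)%Z)]); (5, 13, [:: (11, (1, 1)%Z)]);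
   (5, 14, [:: (10, (0, -1)%Z)]); (5, 16, [:: (15, (1, 0)%Z)]);
   (6, 11, [:: (5, (1, 1)%Z)]); (6, 12, [:: (4, (1, 1)%Z)]);
   (6, 13, [:: (1, (1, 1)%Z); (2, (1, 1)%Z)]); (6, 16, [:: (10, (-1, -1)%Z)]);
   (7, 10, [:: (5, (0, -1)%Z)]); (7, 12, [:: (3, (0, -1)%Z)]);
   (7, 14, [:: (0, (0, -1)%Z); (2, (0, -1)%Z)]); (7, 16, [:: (11, (0, 1)%Z)]);
   (8, 10, [:: (4, (-1, 0)%Z)]); (8, 11, [:: (3, (-1, 0)%Z)]);
   (8, 15, [:: (0, (-1, 0)%Z); (1, (-1, 0)%Z)]); (8, 16, [:: (12, (1, 0)%Z)]);
   (9, 10, [:: (6, (1, 0)%Z)]); (9, 11, [:: (7, (1, 0)%Z)]);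
   (9, 12, [:: (8, (1, 0)%Z)]); (9, 13, [:: (3, (-1, -1)%Z)]);
   (9, 14, [:: (4, (0, 1)%Z)]); (9, 15, [:: (5, (1, 0)%Z)]);
   (9, 16, [:: (0, (-1, 0)%Z); (1, (-1, 0)%Z); (2, (-1, 0)%Z)]);
   (10, 11, [:: (15, (1, 0)%Z)]); (10, 12, [:: (14, (1, 0)%Z)]);
   (10, 13, [:: (16, (-1, -1)%Z)]); (11, 12, [:: (13, (1, 0)%Z)]);
   (11, 14, [:: (16, (0, 1)%Z)]); (12, 15, [:: (16, (1, 0)%Z)])]%N.

Definition D21_mat (i j : nat) : int * int :=
  nth (0, 0) (nth [::] [:: [:: (0, 0)%Z; (1, 0)%Z; (0, 1)%Z];
                           [:: (1, 0)%Z; (0, 0)%Z; (-1, -1)%Z];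
                           [:: (0, 1)%Z; (-1, -1)%Z; (0, 0)%Z]] i) j.

Definition pair_scale (s : int) (c : int * int) := (s * c.1, s * c.2).

Definition D21_value (i j : nat) : int * int :=
  foldr (fun k c => (D21_root j k * (D21_mat i k).1 + c.1,
                     D21_root j k * (D21_mat i k).2 + c.2)) (0, 0) [:: 0; 1; 2]%N.

Definition D21_lookup (i j : nat) : seq (nat * (int * int)) :=
  flatten [seq t.2 | t <- D21_table & t.1 == (i, j)].

Definition seq_scale (s : int) (l : seq (nat * (int * int))) :=
  [seq (t.1, pair_scale s t.2) | t <- l].

Definition D21_bracket (i j : nat) : seq (nat * (int * int)) :=
  if (i < 3)%N then if (j < 3)%N then [::] else [:: (j, D21_value i j)]
  else if (j < 3)%N then [:: (i, pair_scale (-1) (D21_value j i))]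
  else if (i <= j)%N then D21_lookup i j
  else seq_scale (- (-1) ^+ (D21_parity i && D21_parity j)) (D21_lookup j i).

(** The coefficients of a polynomial of degree at most 2 in [alpha], the degree reached by the
    products of two structure constants in the Jacobi identity. *)
Definition triple := (int * int * int)%type.
Definition tadd3 (a b : triple) : triple :=
  (a.1.1 + b.1.1, a.1.2 + b.1.2, a.2 + b.2).
Definition lift_pair (s : int) (c : int * int) : triple := (s * c.1, s * c.2, 0).
Definition mul_pair (s : int) (c d : int * int) : triple :=
  (s * (c.1 * d.1), s * (c.1 * d.2 + c.2 * d.1), s * (c.2 * d.2)).

Definition total (s : seq (nat * triple)) (k : nat) : triple :=
  foldr (fun t a => if t.1 == k then tadd3 t.2 a else a) (0, 0, 0) s.

(** Equality as polynomials in [alpha], which covers every value of the parameter. The bound on the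
    codes is required because [inord] sends a code out of range to 0. *)
Definition same_sum (s t : seq (nat * triple)) : bool :=
  all (fun p => p.1 < 17)%N (s ++ t) &&
  all (fun k => total s k == total t k) (seq.iota 0 17).

Definition sum1 s (l : seq (nat * (int * int))) : seq (nat * triple) :=
  [seq (t.1, lift_pair s t.2) | t <- l].
(** [sum_left s l j] expands [s [l, x_j]], and [sum_right s i l] expands
    [s [x_i, l]]. *)
Definition sum_left s (l : seq (nat * (int * int))) j : seq (nat * triple) :=
  flatten [seq [seq (d.1, mul_pair s c.2 d.2) | d <- D21_bracket c.1 j] | c <- l].
Definition sum_right s i (l : seq (nat * (int * int))) : seq (nat * triple) :=
  flatten [seq [seq (d.1, mul_pair s c.2 d.2) | d <- D21_bracket i c.1] | c <- l].

Definition sign2 (i j : nat) : int := if D21_parity i && D21_parity j then -1 else 1.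

Definition D21_skew_check := all (fun i => all (fun j =>
  same_sum (sum1 1 (D21_bracket i j)) (sum1 (- sign2 i j) (D21_bracket j i)))
  (seq.iota 0 17)) (seq.iota 0 17).

Definition D21_jacobi_check := all (fun i => all (fun j => all (fun k =>
  same_sum (sum_right 1 i (D21_bracket j k))
    (sum_left 1 (D21_bracket i j) k ++ sum_right (sign2 i j) j (D21_bracket i k)))
  (seq.iota 0 17)) (seq.iota 0 17)) (seq.iota 0 17).

Lemma D21_skewP : D21_skew_check.
Proof. by vm_compute. Qed.

Lemma D21_jacobiP : D21_jacobi_check.
Proof. by vm_compute. Qed.

#[local] Opaque D21_bracket D21_parity.

Lemma D21_skew_at (i j : nat) : (i < 17)%N -> (j < 17)%N ->
  same_sum (sum1 1 (D21_bracket i j)) (sum1 (- sign2 i j) (D21_bracket j i)).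
Proof.
move=> hi hj; have /allP /(_ i) := D21_skewP.
by rewrite mem_iota => /(_ hi) /allP /(_ j); rewrite mem_iota => /(_ hj).
Qed.

Lemma D21_jacobi_at (i j k : nat) : (i < 17)%N -> (j < 17)%N -> (k < 17)%N ->
  same_sum (sum_right 1 i (D21_bracket j k))
    (sum_left 1 (D21_bracket i j) k ++ sum_right (sign2 i j) j (D21_bracket i k)).
Proof.
move=> hi hj hk; have /allP /(_ i) := D21_jacobiP.
rewrite mem_iota => /(_ hi) /allP /(_ j); rewrite mem_iota => /(_ hj) /allP /(_ k).
by rewrite mem_iota => /(_ hk).
Qed.

Section Model.
Variables (K : numFieldType) (alpha : K).
Local Notation V := 'rV[K]_17.
Implicit Types (u v w : V) (i j k : 'I_17).

Definition eval3 (c : triple) : K :=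
  c.1.1%:~R + c.1.2%:~R * alpha + c.2%:~R * alpha ^+ 2.
Definition eval2 (c : int * int) : K := c.1%:~R + c.2%:~R * alpha.

Definition basis (i : nat) : V := delta_mx 0 (inord i).

Definition vec3 (s : seq (nat * triple)) : V := \sum_(t <- s) eval3 t.2 *: basis t.1.
Definition vec2 (s : seq (nat * (int * int))) : V :=
  \sum_(t <- s) eval2 t.2 *: basis t.1.

Lemma eval3D a b : eval3 (tadd3 a b) = eval3 a + eval3 b.
Proof. by rewrite /eval3 /tadd3 /= !rmorphD /=; ring. Qed.

Lemma eval3_pair s c : eval3 (lift_pair s c) = s%:~R * eval2 c.
Proof. by rewrite /eval3 /eval2 /lift_pair /= !rmorphM /=; ring. Qed.

Lemma eval3_mul s c d : eval3 (mul_pair s c d) = s%:~R * (eval2 c * eval2 d).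
Proof. by rewrite /eval3 /eval2 /mul_pair /= !(rmorphM, rmorphD) /=; ring. Qed.

Lemma basisE (i : nat) k : (i < 17)%N -> basis i 0 k = (k == i :> nat)%:R.
Proof. by move=> hi; rewrite mxE eqxx -val_eqE /= inordK. Qed.

Lemma vec3_total s : all (fun p => p.1 < 17)%N s ->
  forall k, vec3 s 0 k = eval3 (total s k).
Proof.
rewrite /vec3; elim: s => [_ k|[a c] s IH /= /andP [ha hs] k].
  by rewrite big_nil mxE /eval3 /= !mul0r !addr0.
rewrite big_cons mxE IH // mxE basisE // eq_sym /=.
by case: eqP => _; rewrite ?eval3D ?mulr1 // mulr0 add0r.
Qed.

Lemma same_sumP s t : same_sum s t -> vec3 s = vec3 t.
Proof.
case/andP; rewrite all_cat => /andP [hs ht] /allP h; apply/rowP => k.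
by rewrite !vec3_total // (eqP (h k _)) // mem_iota /=.
Qed.

Definition model_bracket u v : V :=
  locked (\sum_i \sum_j (u 0 i * v 0 j) *: vec2 (D21_bracket i j)).

Lemma model_bracketDl a u v w :
  model_bracket (a *: u + v) w = a *: model_bracket u w + model_bracket v w.
Proof.
rewrite /model_bracket -!lock.
rewrite scaler_sumr -big_split; apply: eq_bigr => i _ /=.
rewrite scaler_sumr -big_split; apply: eq_bigr => j _ /=.
by rewrite !mxE scalerA -scalerDl; congr (_ *: _); ring.
Qed.

Lemma model_bracketDr a u v w :
  model_bracket w (a *: u + v) = a *: model_bracket w u + model_bracket w v.
Proof.
rewrite /model_bracket -!lock.
rewrite scaler_sumr -big_split; apply: eq_bigr => i _ /=.
rewrite scaler_sumr -big_split; apply: eq_bigr => j _ /=.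
by rewrite !mxE scalerA -scalerDl; congr (_ *: _); ring.
Qed.

Lemma model_basis (i j : nat) : (i < 17)%N -> (j < 17)%N ->
  model_bracket (basis i) (basis j) = vec2 (D21_bracket i j).
Proof.
move=> hi hj.
have sum1 (W : lmodType K) (l : nat) (hl : (l < 17)%N) (F : 'I_17 -> W) :
    \sum_k basis l 0 k *: F k = F (Ordinal hl).
  rewrite (bigD1 (Ordinal hl)) //= basisE //= eqxx scale1r big1 ?addr0 // => k hk.
  by rewrite basisE // (negbTE (hk : (k : nat) != l)) scale0r.
rewrite /model_bracket -lock -[RHS](sum1 _ i hi (fun k => vec2 (D21_bracket k j))).
apply: eq_bigr => k _.
transitivity (basis i 0 k *: \sum_l basis j 0 l *: vec2 (D21_bracket k l)).
  by rewrite scaler_sumr; apply: eq_bigr => l _; rewrite scalerA.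
congr (_ *: _); exact: (sum1 _ j hj (fun l => vec2 (D21_bracket k l))).
Qed.

Lemma model_bracket0l u : model_bracket 0 u = 0.
Proof.
have := model_bracketDl (-1) 0 0 u.
by rewrite scaler0 addr0 scaleN1r addNr.
Qed.
Lemma model_bracket0r u : model_bracket u 0 = 0.
Proof.
have := model_bracketDr (-1) 0 0 u.
by rewrite scaler0 addr0 scaleN1r addNr.
Qed.
Lemma model_bracketZl a u v : model_bracket (a *: u) v = a *: model_bracket u v.
Proof. by rewrite -[a *: u]addr0 model_bracketDl model_bracket0l addr0. Qed.
Lemma model_bracketZr a u v : model_bracket v (a *: u) = a *: model_bracket v u.
Proof. by rewrite -[a *: u]addr0 model_bracketDr model_bracket0r addr0. Qed.
Lemma model_bracket_suml (J : Type) (s : seq J) (F : J -> V) v :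
  model_bracket (\sum_(t <- s) F t) v = \sum_(t <- s) model_bracket (F t) v.
Proof.
elim/big_rec2: _ => [|t y z _ <-]; first exact: model_bracket0l.
by rewrite -[F t]scale1r model_bracketDl !scale1r.
Qed.
Lemma model_bracket_sumr (J : Type) (s : seq J) (F : J -> V) v :
  model_bracket v (\sum_(t <- s) F t) = \sum_(t <- s) model_bracket v (F t).
Proof.
elim/big_rec2: _ => [|t y z _ <-]; first exact: model_bracket0r.
by rewrite -[F t]scale1r model_bracketDr !scale1r.
Qed.

Lemma row_basis u : u = \sum_i u 0 i *: basis i.
Proof.
rewrite {1}[u]row_sum_delta; apply: eq_bigr => i _.
by rewrite /basis inord_val.
Qed.

Lemma D21_bracket_range (i j : nat) : (i < 17)%N -> (j < 17)%N ->
  {in D21_bracket i j, forall t, (t.1 < 17)%N}.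
Proof.
move=> hi hj t ht.
have : all (fun i : nat => all (fun j : nat => all (fun t =>
  t.1 < 17)%N (D21_bracket i j))
  (seq.iota 0 17)) (seq.iota 0 17) by vm_compute.
move=> /allP /(_ i); rewrite mem_iota => /(_ hi) /allP /(_ j).
by rewrite mem_iota => /(_ hj) /allP /(_ t ht).
Qed.

Lemma vec3_sum1 s l : vec3 (sum1 s l) = s%:~R *: vec2 l.
Proof.
rewrite /vec3 /sum1 big_map scaler_sumr; apply: eq_bigr => t _.
by rewrite eval3_pair scalerA.
Qed.

Lemma vec3_cat s t : vec3 (s ++ t) = vec3 s + vec3 t.
Proof. exact: big_cat. Qed.

Lemma vec3_right s (i j k : nat) : (i < 17)%N -> (j < 17)%N -> (k < 17)%N ->
  vec3 (sum_right s i (D21_bracket j k)) =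
  s%:~R *: model_bracket (basis i) (model_bracket (basis j) (basis k)).
Proof.
move=> hi hj hk; rewrite (model_basis hj hk) model_bracket_sumr scaler_sumr.
rewrite /sum_right /vec3 big_flatten big_map !big_seq; apply: eq_bigr => c hc.
rewrite big_map model_bracketZr model_basis ?(D21_bracket_range hj hk) //.
rewrite !scaler_sumr; apply: eq_bigr => d _.
by rewrite eval3_mul !scalerA; congr (_ *: _); ring.
Qed.

Lemma vec3_left s (i j k : nat) : (i < 17)%N -> (j < 17)%N -> (k < 17)%N ->
  vec3 (sum_left s (D21_bracket i j) k) =
  s%:~R *: model_bracket (model_bracket (basis i) (basis j)) (basis k).
Proof.
move=> hi hj hk; rewrite (model_basis hi hj) model_bracket_suml scaler_sumr.
rewrite /sum_left /vec3 big_flatten big_map !big_seq; apply: eq_bigr => c hc.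
rewrite big_map model_bracketZl model_basis ?(D21_bracket_range hi hj) //.
rewrite !scaler_sumr; apply: eq_bigr => d _.
by rewrite eval3_mul !scalerA; congr (_ *: _); ring.
Qed.

Definition model_homog (b : bool) u := forall i, u 0 i != 0 -> D21_parity i = b.

Lemma sign2E i j : (sign2 i j)%:~R = (-1) ^+ (D21_parity i && D21_parity j) :> K.
Proof. by rewrite /sign2; case: ifP. Qed.

Lemma model_skew a b u v : model_homog a u -> model_homog b v ->
  model_bracket u v = - ((-1) ^+ (a && b) *: model_bracket v u).
Proof.
move=> hu hv; rewrite /model_bracket -!lock [in RHS]exchange_big -scaleNr scaler_sumr.
apply: eq_bigr => i _; rewrite scaler_sumr; apply: eq_bigr => j _.
have := same_sumP (D21_skew_at (ltn_ord i) (ltn_ord j)).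
rewrite !vec3_sum1 rmorph1 scale1r => ->.
rewrite mulrNz sign2E !scalerA; congr (_ *: _).
have [->|ui] := eqVneq (u 0 i) 0; first by ring.
have [->|vj] := eqVneq (v 0 j) 0; first by ring.
by rewrite (hu i ui) (hv j vj); ring.
Qed.

Lemma model_expand_right u v w : model_bracket u (model_bracket v w) =
  \sum_i \sum_j \sum_k (u 0 i * v 0 j * w 0 k) *:
    model_bracket (basis i) (model_bracket (basis j) (basis k)).
Proof.
rewrite {1}(row_basis u) model_bracket_suml; apply: eq_bigr => i _.
rewrite {1}(row_basis v) model_bracket_suml model_bracket_sumr; apply: eq_bigr => j _.
rewrite {1}(row_basis w) !model_bracket_sumr; apply: eq_bigr => k _.
by rewrite !(model_bracketZl, model_bracketZr) !scalerA; congr (_ *: _); ring.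
Qed.

Lemma model_expand_left u v w : model_bracket (model_bracket u v) w =
  \sum_i \sum_j \sum_k (u 0 i * v 0 j * w 0 k) *:
    model_bracket (model_bracket (basis i) (basis j)) (basis k).
Proof.
rewrite {1}(row_basis u) !model_bracket_suml; apply: eq_bigr => i _.
rewrite {1}(row_basis v) model_bracket_sumr model_bracket_suml; apply: eq_bigr => j _.
rewrite {1}(row_basis w) !model_bracket_sumr; apply: eq_bigr => k _.
by rewrite !(model_bracketZl, model_bracketZr) !scalerA; congr (_ *: _); ring.
Qed.

Lemma model_jacobi a b u v w : model_homog a u -> model_homog b v ->
  model_bracket u (model_bracket v w) =
  model_bracket (model_bracket u v) w
  + (-1) ^+ (a && b) *: model_bracket v (model_bracket u w).
Proof.
move=> hu hv; rewrite !model_expand_right model_expand_left.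
rewrite [X in _ *: X]exchange_big scaler_sumr -big_split; apply: eq_bigr => i _.
rewrite scaler_sumr -big_split; apply: eq_bigr => j _.
rewrite scaler_sumr -big_split; apply: eq_bigr => k _.
have := same_sumP (D21_jacobi_at (ltn_ord i) (ltn_ord j) (ltn_ord k)).
rewrite vec3_cat !(vec3_right, vec3_left) ?ltn_ord // mulr1z !scale1r => ->.
rewrite sign2E !scalerDr !scalerA; congr (_ + _ *: _).
have [->|ui] := eqVneq (u 0 i) 0; first by ring.
have [->|vj] := eqVneq (v 0 j) 0; first by ring.
by rewrite (hu i ui) (hv j vj); ring.
Qed.

End Model.

(** * The contragredient superalgebra is the model *)

Definition D21_generator_check := all (fun i => all (fun j =>
  [&& D21_bracket i j == [::],
      D21_bracket (3 + i) (10 + j) == (if i == j then [:: (i, (1, 0))] else [::]),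
      D21_bracket i (3 + j) == [:: (3 + j, D21_mat i j)]%N
    & D21_bracket i (10 + j) == [:: (10 + j, pair_scale (-1) (D21_mat i j))]%N])
  (seq.iota 0 3)) (seq.iota 0 3).

Lemma D21_generatorP : D21_generator_check.
Proof. by vm_compute. Qed.

Definition D21_parity_check := all (fun i => all (fun j => all (fun t =>
  D21_parity t.1 == D21_parity i (+) D21_parity j) (D21_bracket i j))
  (seq.iota 0 17)) (seq.iota 0 17).

Lemma D21_parityP : D21_parity_check.
Proof. by vm_compute. Qed.

Definition D21_opp (k : nat) : nat :=
  if (k < 3)%N then k else if (k < 10)%N then (k + 7)%N else (k - 7)%N.

Lemma D21_opp_lt k : (k < 17)%N -> (D21_opp k < 17)%N.
Proof. by rewrite /D21_opp; case: ifP => // h1; case: ifP => // h2 h3; lia. Qed.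

Section Interpretation.
Variables (K : numFieldType) (alpha : K).
Local Notation A := (D21_matrix alpha).
Local Notation V := 'rV[K]_17.
Local Notation T := (term K (cgen 3)).
Local Notation basis := (basis K).
Local Notation mbr := (model_bracket alpha).
Local Notation gt := (pre_contragredient A).
Implicit Types (u v w : V) (y z : gt).

Lemma D21_matrixE (i j : 'I_3) : A i j = eval2 alpha (D21_mat i j).
Proof.
rewrite mxE /eval2; case: i => [[|[|[|//]]] ?]; case: j => [[|[|[|//]]] ?];
  rewrite /D21_mat /=; ring.
Qed.

Lemma D21_generator_at (i j : 'I_3) :
  [/\ mbr (basis i) (basis j) = 0,
      mbr (basis (3 + i)) (basis (10 + j)) = (if i == j then basis i else 0),
      mbr (basis i) (basis (3 + j)) = A i j *: basis (3 + j)
    & mbr (basis i) (basis (10 + j)) = - A i j *: basis (10 + j)].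
Proof.
have lt (k : 'I_3) d : (d <= 14)%N -> (d + k < 17)%N.
  by move=> hd; apply: (@leq_trans (14 + 3)); rewrite // -addnS leq_add // ltn_ord.
have l0 k := lt k 0%N isT.
have /allP /(_ i) := D21_generatorP; rewrite mem_iota => /(_ (ltn_ord i)) /allP /(_ j).
rewrite mem_iota => /(_ (ltn_ord j)) /and4P [/eqP e1 /eqP e2 /eqP e3 /eqP e4].
rewrite !model_basis ?l0 ?lt // e1 e2 e3 e4 /vec2 !big_seq1 big_nil /=.
rewrite !D21_matrixE; split=> //.
  by rewrite -val_eqE; case: eqP => _;
    rewrite ?big_nil // big_seq1 /eval2 /= mul0r addr0 scale1r.
by congr (_ *: _); rewrite /eval2 /pair_scale /= !rmorphM /=; ring.
Qed.

Fixpoint model_term (t : T) : V :=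
  match t with
  | tgen (gen_e i) => basis (3 + i)
  | tgen (gen_f i) => basis (10 + i)
  | tgen (gen_h i) => basis i
  | tzero => 0
  | tadd s t => model_term s + model_term t
  | tscale c t => c *: model_term t
  | tmul s t => mbr (model_term s) (model_term t)
  end.

Lemma model_homogD b a u v : model_homog b u -> model_homog b v ->
  model_homog b (a *: u + v).
Proof.
move=> hu hv i; rewrite !mxE => h; have [/eqP ui|/hu //] := boolP (u 0 i == 0).
by apply: hv; move: h; rewrite ui mulr0 add0r.
Qed.

Lemma model_homog0 b : model_homog b (0 : V).
Proof. by move=> i; rewrite mxE eqxx. Qed.

Lemma model_homog_sum b (J : Type) (s : seq J) (F : J -> V) :
  (forall t, model_homog b (F t)) -> model_homog b (\sum_(t <- s) F t).
Proof.
move=> h; elim/big_rec: _ => [|t u _ hu]; first exact: model_homog0.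
by rewrite -[F t]scale1r; apply: model_homogD.
Qed.

Lemma model_homog_basis (i : nat) : (i < 17)%N -> model_homog (D21_parity i) (basis i).
Proof.
move=> hi k; rewrite basisE //; case: (eqVneq (k : nat) i) => [-> //|_].
by rewrite eqxx.
Qed.

Lemma model_homogZ b a u : model_homog b u -> model_homog b (a *: u).
Proof. by move=> hu; rewrite -[a *: u]addr0; apply: model_homogD => //;
  apply: model_homog0. Qed.

Lemma model_homog_bracket a b u v : model_homog a u -> model_homog b v ->
  model_homog (a (+) b) (mbr u v).
Proof.
move=> hu hv; rewrite (row_basis u) model_bracket_suml; apply: model_homog_sum => i.
rewrite (row_basis v) model_bracket_sumr; apply: model_homog_sum => j.
rewrite model_bracketZl model_bracketZr.
have [->|/hu <-] := eqVneq (u 0 i) 0; first by rewrite scale0r; apply: model_homog0.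
have [->|/hv <-] := eqVneq (v 0 j) 0.
  by rewrite scale0r scaler0; apply: model_homog0.
do 2!apply: model_homogZ; rewrite model_basis // /vec2 big_seq big_mkcond.
apply: model_homog_sum => t; case: ifP => [ht|_]; last exact: model_homog0.
have /allP /(_ i) := D21_parityP; rewrite mem_iota => /(_ (ltn_ord i)) /allP /(_ j).
rewrite mem_iota => /(_ (ltn_ord j)) /allP /(_ t ht) /eqP <-.
apply/model_homogZ/model_homog_basis; apply: D21_bracket_range ht => //; exact: ltn_ord.
Qed.

Lemma D21_parity_generator (i : 'I_3) :
  [/\ D21_parity (3 + i), D21_parity (10 + i) & ~~ D21_parity i].
Proof.
have : all (fun i => [&& D21_parity (3 + i), D21_parity (10 + i) & ~~ D21_parity i])
  (seq.iota 0 3) by vm_compute.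
by move=> /allP /(_ i); rewrite mem_iota => /(_ (ltn_ord i)) /and3P.
Qed.

Lemma code_lt (i : 'I_3) : [/\ 3 + i < 17, 10 + i < 17 & i < 17]%N.
Proof. by case: i => [[|[|[|//]]] ?]. Qed.

Lemma model_term_homog b t : thomog (@cgen_par 3) b t -> model_homog b (model_term t).
Proof.
elim=> {b t} /= [b [i|i|i] /= ->|b|b s t _ hs _ ht|b c t _ ht|a b s t _ hs _ ht].
- have [ <- _ _] := D21_parity_generator i; apply: model_homog_basis.
  by case: (code_lt i).
- have [_ <- _] := D21_parity_generator i; apply: model_homog_basis.
  by case: (code_lt i).
- have [_ _ /negbTE <-] := D21_parity_generator i; apply: model_homog_basis.
  by case: (code_lt i).
- exact: model_homog0.
- by rewrite -[model_term s]scale1r; apply: model_homogD.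
- exact: model_homogZ.
- exact: model_homog_bracket.
Qed.

(** The model satisfies the defining relations, so evaluation of terms descends to the presented
    superalgebra. *)
Lemma model_term_cong s t : tcong (@crel K 3 A) s t -> model_term s = model_term t.
Proof.
elim=> {s t} //=.
- move=> s t [a b {}s {}t hs ht|a b {}s {}t u hs ht|i j|i j|i j|i j] /=.
  + by rewrite (model_skew alpha (model_term_homog hs) (model_term_homog ht)) scaleNr.
  + exact: (model_jacobi _ _ (model_term_homog hs) (model_term_homog ht)).
  + by have [] := D21_generator_at i j.
  + by have [_ -> _ _] := D21_generator_at i j; case: eqP.
  + by have [] := D21_generator_at i j.
  + by have [] := D21_generator_at i j.
- by move=> s t u _ -> _ ->.
- by move=> s s' t t' _ -> _ ->.
- by move=> c t t' _ ->.
- by move=> s s' t t' _ -> _ ->.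
- by move=> *; rewrite addrA.
- by move=> *; rewrite addrC.
- by move=> *; rewrite add0r.
- by move=> *; rewrite scaleN1r addNr.
- by move=> *; rewrite scalerA.
- by move=> *; rewrite scale1r.
- by move=> *; rewrite scalerDr.
- by move=> *; rewrite scalerDl.
- by move=> s t u; rewrite -[model_term s]scale1r model_bracketDl !scale1r.
- by move=> s t u; rewrite -[model_term s]scale1r model_bracketDr !scale1r.
- by move=> *; rewrite model_bracketZl.
- by move=> *; rewrite model_bracketZr.
Qed.

Definition model_map (y : gt) : V := model_term (repr y).

Lemma model_map_cls t : model_map (tcls (P := cpres A) t : gt) = model_term t.
Proof. exact: (model_term_cong (@tcls_repr K (cpres A) t)). Qed.

Lemma model_map_linear a y z : model_map (a *: y + z) = a *: model_map y + model_map z.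
Proof.
elim/tcls_ind: y => s; elim/tcls_ind: z => t.
by rewrite -tclsZ -tclsD !model_map_cls.
Qed.

Lemma model_map0 : model_map 0 = 0.
Proof. exact: (model_map_cls tzero). Qed.

Lemma model_mapD y z : model_map (y + z) = model_map y + model_map z.
Proof. by rewrite -[y in LHS]scale1r model_map_linear scale1r. Qed.

Lemma model_mapZ a y : model_map (a *: y) = a *: model_map y.
Proof. by rewrite -[a *: y]addr0 model_map_linear model_map0 addr0. Qed.

Lemma model_map_sum (J : Type) (s : seq J) (F : J -> gt) :
  model_map (\sum_(j <- s) F j) = \sum_(j <- s) model_map (F j).
Proof. exact: (big_morph model_map model_mapD model_map0). Qed.

Lemma model_map_bracket y z : model_map [< y, z >] = mbr (model_map y) (model_map z).
Proof.
elim/tcls_ind: y => s; elim/tcls_ind: z => t.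
by rewrite -[[< _, _ >]](@tclsM K (cpres A)) !model_map_cls.
Qed.

Lemma model_map_homog b y : homog b y -> model_homog b (model_map y).
Proof. by move=> [t ht <-]; rewrite model_map_cls; apply: model_term_homog. Qed.

Local Notation gen_vec z := (tcls (P := cpres A) (@tgen K _ z) : gt).

Lemma model_map_cartan (c : 'cV[K]_3) :
  model_map (pre_cartan A c) = \sum_i c i 0 *: basis i.
Proof.
rewrite /pre_cartan model_map_sum; apply: eq_bigr => i _.
by rewrite model_mapZ model_map_cls.
Qed.

(** As [A] is symmetric, this row lists the values on the [h_i] of the root with the given
    coordinates in the simple roots. *)
Definition D21_wt (k : nat) : 'rV[K]_3 :=
  (\row_l (D21_root k l)%:~R) *m A.

Lemma D21_matrix_sym (i j : 'I_3) : A i j = A j i.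
Proof. by rewrite !mxE; case: i => [[|[|[|//]]] ?]; case: j => [[|[|[|//]]] ?]. Qed.

Lemma D21_value_wt (i : 'I_3) (k : nat) : eval2 alpha (D21_value i k) = D21_wt k 0 i.
Proof.
have e (l : 'I_3) : A l i = eval2 alpha (D21_mat i l) by rewrite D21_matrix_sym
  D21_matrixE.
rewrite mxE; under eq_bigr do rewrite e mxE.
rewrite !big_ord_recl big_ord0 /bump /= /D21_value /eval2 /=.
rewrite !(rmorphD, rmorphM) /= !rmorph0 /=; ring.
Qed.

Lemma model_bracket_cartan (i : 'I_3) (k : 'I_17) :
  mbr (basis i) (basis k) = D21_wt k 0 i *: basis k.
Proof.
have : all (fun i => all (fun k => D21_bracket i k ==
    if (k < 3)%N then [::] else [:: (k, D21_value i k)]) (seq.iota 0 17)) (seq.iota 0 3).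
  by vm_compute.
move=> /allP /(_ i); rewrite mem_iota => /(_ (ltn_ord i)) /allP /(_ k).
rewrite mem_iota => /(_ (ltn_ord k)) /eqP e; rewrite model_basis //; last first.
  by case: (code_lt i).
rewrite e; case: ltnP => hk; last by rewrite /vec2 big_seq1 D21_value_wt.
rewrite /vec2 big_nil /D21_wt (_ : \row_l _ = 0) ?mul0mx ?mxE ?scale0r //.
by apply/rowP => l; rewrite !mxE /D21_root hk.
Qed.

Lemma model_cartan_weight (c : 'cV[K]_3) (k : 'I_17) :
  mbr (\sum_i c i 0 *: basis i) (basis k) = (D21_wt k *m c) 0 0 *: basis k.
Proof.
rewrite model_bracket_suml [in RHS]mxE scaler_suml; apply: eq_bigr => i _.
by rewrite model_bracketZl model_bracket_cartan scalerA mulrC.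
Qed.

Lemma scale_basisE a (i k : 'I_17) : (a *: basis i) 0 k = a * (k == i)%:R.
Proof. by rewrite mxE basisE. Qed.

Lemma model_map_weight c y k : model_map [< pre_cartan A c, y >] 0 k =
  (D21_wt k *m c) 0 0 * model_map y 0 k.
Proof.
rewrite model_map_bracket model_map_cartan {1}(row_basis (model_map y)).
rewrite model_bracket_sumr summxE (bigD1 k) //= model_bracketZr model_cartan_weight.
rewrite scalerA scale_basisE eqxx mulr1 big1 ?addr0 => [|i hi]; first by rewrite mulrC.
rewrite model_bracketZr model_cartan_weight scalerA scale_basisE eq_sym.
by rewrite (negbTE hi) mulr0.
Qed.

Hypothesis alpha_neq0 : alpha != 0.
Hypothesis alpha_neqN1 : alpha != -1.

Lemma D21_matrix_inj (u : 'rV[K]_3) : u *m A = 0 -> u = 0.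
Proof.
move=> h; have e (i : 'I_3) : \sum_l u 0 l * A l i = 0.
  by have /rowP /(_ i) := h; rewrite !mxE.
pose a0 : 'I_3 := Ordinal (isT : 0 < 3)%N; pose a1 : 'I_3 := Ordinal (isT : 1 < 3)%N.
pose a2 : 'I_3 := Ordinal (isT : 2 < 3)%N.
have S (F : 'I_3 -> K) : \sum_l F l = F a0 + F a1 + F a2.
  rewrite !big_ord_recl big_ord0 addr0 addrA.
  by congr (F _ + F _ + F _); apply: val_inj.
have := e a0; have := e a1; have := e a2; rewrite !S !mxE /= => e2 e1 e0.
have alpha1 : alpha + 1 != 0 by rewrite addr_eq0.
have u2 : u 0 a2 = 0.
  (* The factor is the determinant of [A] up to sign; the combination of the three equations
     eliminates the other two unknowns. *)
  have : (2 * alpha * (alpha + 1)) * u 0 a2 = 0.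
    have -> : 2 * alpha * (alpha + 1) * u 0 a2 =
      (u 0 a0 * 0 + u 0 a1 * 1 + u 0 a2 * alpha) * (alpha + 1)
      - (u 0 a0 * 1 + u 0 a1 * 0 + u 0 a2 * (- alpha - 1)) * alpha
      + (u 0 a0 * alpha + u 0 a1 * (- alpha - 1) + u 0 a2 * 0) by ring.
    by rewrite e0 e1 e2 !mul0r subr0 addr0.
  move=> /eqP; rewrite !mulf_eq0 pnatr_eq0 (negbTE alpha_neq0) (negbTE alpha1) /=.
  by move=> /eqP.
have u1 : u 0 a1 = 0 by move: e0; rewrite u2 mulr0 mulr1 mul0r add0r addr0.
have u0 : u 0 a0 = 0 by move: e1; rewrite u2 mulr0 mulr1 mul0r !addr0.
apply/rowP => i; rewrite mxE; case: i => [[|[|[|//]]] hi].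
- by rewrite -u0; congr (u 0 _); apply: val_inj.
- by rewrite -u1; congr (u 0 _); apply: val_inj.
- by rewrite -u2; congr (u 0 _); apply: val_inj.
Qed.

(** Injectivity of [A] reduces this to the integral coordinates: distinct roots of the model stay
    distinct for every admissible [alpha]. *)
Lemma D21_wt_inj (k l : 'I_17) : (3 <= k)%N -> (3 <= l)%N -> D21_wt k = D21_wt l -> k = l.
Proof.
move=> hk hl /eqP; rewrite -subr_eq0 -mulmxBl => /eqP /D21_matrix_inj /rowP h.
have : all (fun k => all (fun l => ((3 <= k)%N && (3 <= l)%N &&
    all (fun t => D21_root k t == D21_root l t) (seq.iota 0 3)) ==> (k == l))
  (seq.iota 0 17)) (seq.iota 0 17) by vm_compute.
move=> /allP /(_ k); rewrite mem_iota => /(_ (ltn_ord k)) /allP /(_ l).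
rewrite mem_iota => /(_ (ltn_ord l)); rewrite hk hl /= => /implyP H.
have r t : (t < 3)%N -> D21_root k t == D21_root l t.
  by move=> ht; have := h (Ordinal ht); rewrite !mxE => /eqP; rewrite subr_eq0 eqr_int.
by apply: val_inj; apply/eqP/H; rewrite !r.
Qed.

Lemma D21_wt_eq0 (k : 'I_17) : (D21_wt k == 0) = (k < 3)%N.
Proof.
apply/eqP/idP => [/D21_matrix_inj /rowP h|hk]; last first.
  by rewrite /D21_wt (_ : \row_l _ = 0) ?mul0mx //; apply/rowP => l;
    rewrite !mxE /D21_root hk.
have : all (fun k => all (fun t => D21_root k t == 0) (seq.iota 0 3) ==> (k < 3)%N)
  (seq.iota 0 17) by vm_compute.
move=> /allP /(_ k); rewrite mem_iota => /(_ (ltn_ord k)) /implyP; apply.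
have r t : (t < 3)%N -> D21_root k t == 0.
  by move=> ht; have := h (Ordinal ht); rewrite !mxE => /eqP; rewrite intr_eq0.
by rewrite /= !r.
Qed.

Definition has_preimage v := exists y : gt, model_map y = v.

(** The chosen brackets of generators have structure constant 1 or -1, so no division by an
    expression in [alpha] occurs. *)
Lemma has_preimage_basis (k : 'I_17) : has_preimage (basis k).
Proof.
have P3 (i : 'I_3) : has_preimage (basis i) by exists (gen_vec (gen_h i));
  rewrite model_map_cls.
have Pe (i : 'I_3) : has_preimage (basis (3 + i)) by exists (gen_vec (gen_e i));
  rewrite model_map_cls.
have Pf (i : 'I_3) : has_preimage (basis (10 + i)) by exists (gen_vec (gen_f i));
  rewrite model_map_cls.
have Pb (i j l : nat) s : has_preimage (basis i) -> has_preimage (basis j) ->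
    (i < 17)%N -> (j < 17)%N -> D21_bracket i j = [:: (l, (s, 0))] -> s * s = 1 ->
    has_preimage (basis l).
  move=> [y hy] [z hz] hi hj e hs; exists (s%:~R *: [< y, z >]).
  rewrite model_mapZ model_map_bracket hy hz model_basis // e /vec2 big_seq1 /eval2 /=.
  by rewrite mul0r addr0 scalerA -rmorphM hs scale1r.
have q0 : has_preimage (basis 0) by apply: (P3 (Ordinal (isT : 0 < 3)%N)).
have q1 : has_preimage (basis 1) by apply: (P3 (Ordinal (isT : 1 < 3)%N)).
have q2 : has_preimage (basis 2) by apply: (P3 (Ordinal (isT : 2 < 3)%N)).
have q3 : has_preimage (basis 3) by apply: (Pe (Ordinal (isT : 0 < 3)%N)).
have q4 : has_preimage (basis 4) by apply: (Pe (Ordinal (isT : 1 < 3)%N)).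
have q5 : has_preimage (basis 5) by apply: (Pe (Ordinal (isT : 2 < 3)%N)).
have q10 : has_preimage (basis 10) by apply: (Pf (Ordinal (isT : 0 < 3)%N)).
have q11 : has_preimage (basis 11) by apply: (Pf (Ordinal (isT : 1 < 3)%N)).
have q12 : has_preimage (basis 12) by apply: (Pf (Ordinal (isT : 2 < 3)%N)).
have q8 : has_preimage (basis 8) by apply: (Pb 3 4 8 1 q3 q4)%N => //; vm_compute.
have q7 : has_preimage (basis 7) by apply: (Pb 3 5 7 1 q3 q5)%N => //; vm_compute.
have q6 : has_preimage (basis 6) by apply: (Pb 4 5 6 1 q4 q5)%N => //; vm_compute.
have q9 : has_preimage (basis 9) by apply: (Pb 5 8 9 (-1)%R q5 q8)%N => //; vm_compute.
have q15 : has_preimage (basis 15) by apply: (Pb 10 11 15 1 q10 q11)%N => //; vm_compute.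
have q14 : has_preimage (basis 14) by apply: (Pb 10 12 14 1 q10 q12)%N => //; vm_compute.
have q13 : has_preimage (basis 13) by apply: (Pb 11 12 13 1 q11 q12)%N => //; vm_compute.
have q16 : has_preimage (basis 16) by apply: (Pb 12 15 16 1 q12 q15)%N => //; vm_compute.
by case: k => m /=; do 17!(case: m => [//|m]).
Qed.

(** * Triangular decomposition of the presented superalgebra *)

Definition simple_vec (s : bool) (i : 'I_3) : gt :=
  if s then gen_vec (gen_e i) else gen_vec (gen_f i).
Definition simple_wt (s : bool) (i : 'I_3) : 'rV[K]_3 :=
  if s then row i A else - row i A.
(** The sign [s] selects the [e_i] or the [f_i], so that one argument treats both halves; [i] is the
    innermost letter, which keeps the word nonempty. *)
Definition simple_word s i (w : seq 'I_3) : gt :=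
  foldr (fun j y => [< simple_vec s j, y >]) (simple_vec s i) w.

Let ad (c : 'cV[K]_3) y : gt := [< pre_cartan A c, y >].

Let ad_linear c a y z : ad c (a *: y + z) = a *: ad c y + ad c z.
Proof. exact: bracket_linearr. Qed.

Lemma simple_vec_odd s i : homog true (simple_vec s i).
Proof. by case: s; eexists; try reflexivity; apply: thomog_gen. Qed.

Lemma gen_rel s t : crel A s t -> tcls (P := cpres A) s = tcls (P := cpres A) t.
Proof. by move=> h; apply/tclsP/tcong_rel. Qed.

Lemma pre_cartan_linear a (c d : 'cV[K]_3) :
  pre_cartan A (a *: c + d) = a *: pre_cartan A c + pre_cartan A d.
Proof.
rewrite scaler_sumr -big_split; apply: eq_bigr => i _ /=.
by rewrite !mxE scalerDl scalerA.
Qed.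

Lemma range_pre_cartan_subspace : subspace (range (pre_cartan A)).
Proof.
split=> [|a _ _ [c _ <-] [d _ <-]]; last by exists (a *: c + d);
  rewrite ?pre_cartan_linear.
by exists 0; rewrite // /pre_cartan big1 // => i _; rewrite mxE scale0r.
Qed.

Lemma pre_cartan_gen i : pre_cartan A (delta_mx i 0) = gen_vec (gen_h i).
Proof.
rewrite /pre_cartan (bigD1 i) //= mxE !eqxx scale1r big1 ?addr0 // => j hj.
by rewrite mxE (negbTE hj) scale0r.
Qed.

Lemma simple_vec_eigen s i : eigen ad (simple_wt s i) (simple_vec s i).
Proof.
move=> c; rewrite /ad /pre_cartan bracket_suml.
have -> : (simple_wt s i *m c) 0 0 = \sum_j c j 0 * (if s then A j i else - A j i).
  rewrite mxE; apply: eq_bigr => j _; rewrite mulrC D21_matrix_sym; congr (_ * _).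
  by rewrite /simple_wt; case: (s); rewrite !mxE.
rewrite scaler_suml; apply: eq_bigr => j _; rewrite bracketZl -scalerA; congr (_ *: _).
have he := gen_rel (crel_he A j i); have hf := gen_rel (crel_hf A j i).
by rewrite /simple_vec; case: (s); [move: he | move: hf]; rewrite tclsM tclsZ.
Qed.

Lemma pre_cartan_comm c d : [< pre_cartan A c, pre_cartan A d >] = 0.
Proof.
rewrite /pre_cartan bracket_suml big1 // => i _;
  rewrite bracketZl bracket_sumr big1 ?scaler0 // => j _.
rewrite bracketZr -[[< _, _ >]](@tclsM K (cpres A)) (gen_rel (crel_hh A i j)).
by rewrite tcls0 scaler0.
Qed.

Lemma simple_vec_bracket s i j :
  range (pre_cartan A) [< simple_vec (~~ s) i, simple_vec s j >].
Proof.
have ef k l : range (pre_cartan A) [< simple_vec true k, simple_vec false l >].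
  rewrite -[[< _, _ >]](@tclsM K (cpres A)) (gen_rel (crel_ef A k l)).
  case: eqP => _; last by case: range_pre_cartan_subspace.
  by exists (delta_mx k 0); rewrite ?pre_cartan_gen.
case: s => /=; last exact: ef.
rewrite (bracket_skew (simple_vec_odd false i) (simple_vec_odd true j)) /=.
by rewrite expr1 scaleN1r opprK; apply: ef.
Qed.

Lemma simple_word_eigen s i (w : seq _) :
  eigen ad (\sum_(j <- rcons w i) simple_wt s j) (simple_word s i w).
Proof.
elim: w => [|j w IH] /=; first by rewrite big_seq1; apply: simple_vec_eigen.
move=> c; rewrite big_cons mulmxDl mxE /ad.
have := bracket_jacobi (simple_word s i w) (pre_cartan_even A c) (simple_vec_odd s j).
rewrite expr0 scale1r => ->.
have := simple_vec_eigen s j c; rewrite /ad => ->; have := IH c; rewrite /ad => ->.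
by rewrite bracketZl bracketZr -scalerDl.
Qed.

(** All letters have the same sign, so the multiplicity of [i], which is positive, is up to sign a
    coordinate in the simple roots; [A] is injective. *)
Lemma simple_word_wt s i (w : seq _) : \sum_(j <- rcons w i) simple_wt s j != 0.
Proof.
have -> : \sum_(j <- rcons w i) simple_wt s j =
    ((-1) ^+ (~~ s) *: \sum_(j <- rcons w i) delta_mx 0 j) *m A.
  rewrite -scalemxAl mulmx_suml scaler_sumr; apply: eq_bigr => j _.
  by rewrite -rowE /simple_wt; case: (s); rewrite ?scale1r ?scaleN1r.
apply/eqP => /D21_matrix_inj /eqP; rewrite scaler_eq0 signr_eq0 /= => /eqP /rowP /(_ i).
rewrite summxE mxE => /eqP; apply/negP.
have -> : \sum_(j <- rcons w i) (delta_mx 0 j : 'rV[K]_3) 0 i =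
    (count (pred1 i) (rcons w i))%:R.
  elim: (rcons w i) => [|j v IH]; first by rewrite big_nil.
  by rewrite big_cons IH mxE eqxx /= natrD eq_sym.
by rewrite pnatr_eq0 -lt0n -has_count has_rcons /= eqxx.
Qed.

Definition half_part s : set gt := lspan (range (pre_cartan A) `|`
  [set y | exists i (w : seq _), y = simple_word s i w]).

Definition triangular : set gt := lspan (range (pre_cartan A) `|`
  [set y | exists s i (w : seq _), y = simple_word s i w]).

Lemma half_triangular s : half_part s `<=` triangular.
Proof.
apply: lspan_min; first exact: lspan_subspace.
move=> y [h|[i [w ->]]]; apply: sub_lspan; first by left.
by right; exists s, i, w.
Qed.

Lemma simple_cartan s i c : [< simple_vec s i, pre_cartan A c >] =
  - (simple_wt s i *m c) 0 0 *: simple_vec s i.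
Proof.
rewrite (bracket_skew (simple_vec_odd s i) (pre_cartan_even A c)) expr0 scale1r.
by have := simple_vec_eigen s i c; rewrite /ad => ->; rewrite scaleNr.
Qed.

Lemma half_part_same s i y : half_part s y -> half_part s [< simple_vec s i, y >].
Proof.
have hS : subspace (half_part s) by apply: lspan_subspace.
have hw j (w : seq _) : half_part s (simple_word s j w) by apply: sub_lspan; right;
  exists j, w.
move: y; apply: (@lspan_min _ _ _ [set y | half_part s [< simple_vec s i, y >]]).
  split=> [|a y z hy hz] /=; first by rewrite bracket0r; case: hS.
  by rewrite bracket_linearr; case: hS => _; apply.
move=> y [[c _ <-]|[j [w ->]]] /=; last exact: (hw j (i :: w)).
by rewrite simple_cartan; apply: (subspaceZ _ hS); apply: (hw i [::]).
Qed.

(** By the Jacobi identity an opposite generator either meets the outermost letter, giving a Cartan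
    element that acts on the rest by a scalar, or passes on to a shorter word. *)
Lemma half_part_opp s i j (w : seq _) : half_part s [< simple_vec (~~ s) i,
  simple_word s j w >].
Proof.
have hS : subspace (half_part s) by apply: lspan_subspace.
elim: w => [|k w IH] /=.
  by apply: sub_lspan; left; apply: simple_vec_bracket.
rewrite (bracket_jacobi _ (simple_vec_odd _ i) (simple_vec_odd s k)).
apply: (subspaceD hS); last by apply: (subspaceZ _ hS); apply: half_part_same.
have [c _ <-] := simple_vec_bracket s i k.
have := simple_word_eigen s j w c; rewrite /ad => ->; apply: (subspaceZ _ hS).
by apply: sub_lspan; right; exists j, w.
Qed.

Lemma triangular_simple s i y : triangular y -> triangular [< simple_vec s i, y >].
Proof.
have hS : subspace triangular by apply: lspan_subspace.
have hw t j (w : seq _) : triangular (simple_word t j w).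
  by apply: sub_lspan; right; exists t, j, w.
move: y; apply: (@lspan_min _ _ _ [set y | triangular [< simple_vec s i, y >]]).
  split=> [|a y z hy hz] /=; first by rewrite bracket0r; case: hS.
  by rewrite bracket_linearr; case: hS => _; apply.
move=> y [[c _ <-]|[t [j [w ->]]]] /=.
  by rewrite simple_cartan; apply: (subspaceZ _ hS); apply: (hw s i [::]).
have [->|neq] := eqVneq s t; first exact: (hw t j (i :: w)).
have -> : s = ~~ t by case: (s) (t) neq => -[].
apply: (@half_triangular t). exact: half_part_opp.
Qed.

Lemma triangular_cartan c y : triangular y -> triangular [< pre_cartan A c, y >].
Proof.
have hS : subspace triangular by apply: lspan_subspace.
move: y; apply: (@lspan_min _ _ _ [set y | triangular [< pre_cartan A c, y >]]).
  split=> [|a y z hy hz] /=; first by rewrite bracket0r; case: hS.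
  by rewrite bracket_linearr; case: hS => _; apply.
move=> y [[d _ <-]|[t [j [w ->]]]] /=; first by rewrite pre_cartan_comm; case: hS.
have := simple_word_eigen t j w c; rewrite /ad => ->; apply: (subspaceZ _ hS).
by apply: sub_lspan; right; exists t, j, w.
Qed.

(** The span contains the generators and is stable under bracketing with them; the Jacobi identity
    extends both properties to brackets. Homogeneous terms are used so that its signs are
    defined. *)
Lemma triangular_full y : triangular y.
Proof.
have hS : subspace triangular by apply: lspan_subspace.
suff h b (t : T) : thomog (@cgen_par 3) b t ->
    triangular (tcls (P := cpres A) t : gt) /\
    forall z, triangular z -> triangular [< tcls (P := cpres A) t : gt, z >].
  have [y0 [y1 [[t0 h0 <-] [t1 h1 <-] ->]]] := homog_sum y.
  by apply: (subspaceD hS); [case: (h _ _ h0) | case: (h _ _ h1)].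
elim=> {b t} [b [i|i|i] _|b|b s t _ [s1 s2] _ [t1 t2]|b c t _ [t1 t2]|a b s t hs [s1
  s2] ht [t1 t2]].
- split=> [|z]; last exact: (@triangular_simple true).
  by apply: sub_lspan; right; exists true, i, [::].
- split=> [|z]; last exact: (@triangular_simple false).
  by apply: sub_lspan; right; exists false, i, [::].
- rewrite -[tcls _]pre_cartan_gen; split=> [|z]; last exact: triangular_cartan.
  by apply: sub_lspan; left; exists (delta_mx i 0).
- by rewrite tcls0; split=> [|z _]; rewrite ?bracket0l; case: hS.
- rewrite tclsD; split=> [|z hz]; first exact: (subspaceD hS).
  by rewrite bracketDl; apply: (subspaceD hS); [apply: s2 | apply: t2].
- rewrite tclsZ; split=> [|z hz]; first exact: (subspaceZ _ hS).
  by rewrite bracketZl; apply: (subspaceZ _ hS); apply: t2.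
rewrite tclsM -[pres_mul _ _]/([< tcls (P := cpres A) s : gt,
  tcls (P := cpres A) t : gt >]); split=> [|z hz]; first exact: s2.
have [hs' ht'] : homog a (tcls (P := cpres A) s : gt) /\ homog b (tcls (P := cpres A) t
  : gt).
  by split; [exists s | exists t].
have := bracket_jacobi z hs' ht' => /esym /(canRL (addrK _)) ->.
apply: (subspaceB hS); first by apply: s2; apply: t2.
by apply: (subspaceZ _ hS); apply: t2; apply: s2.
Qed.

(** * The kernel of the map to the model *)

Definition gt_part mu : set gt := if mu == 0 then range (pre_cartan A) else eigen ad mu.

Lemma gt_part_subspace mu : subspace (gt_part mu).
Proof.
rewrite /gt_part; case: ifP => _; first exact: range_pre_cartan_subspace.
exact: (eigen_subspace ad_linear).
Qed.

Lemma gt_part_eigen mu : gt_part mu `<=` eigen ad mu.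
Proof.
rewrite /gt_part; case: eqP => [->|_] // _ [c _ <-] d.
by rewrite /ad pre_cartan_comm mul0mx mxE scale0r.
Qed.

(** The gain over a plain weight decomposition is that the component of weight zero is a Cartan
    element; it holds because the words in the triangular decomposition have nonzero weight. *)
Lemma gt_part_sums y : eigen_sums gt_part y.
Proof.
have hS := eigen_sums_subspace gt_part_subspace.
apply: (lspan_min hS _ (triangular_full y)) => z [hz|[s [i [w ->]]]].
  by apply: (sub_eigen_sums gt_part_subspace (mu := 0)); rewrite /gt_part eqxx.
apply: (sub_eigen_sums gt_part_subspace (mu := \sum_(j <- rcons w i) simple_wt s j)).
by rewrite /gt_part (negbTE (simple_word_wt s i w)); apply: simple_word_eigen.
Qed.

Lemma model_map_eigen mu y (k : 'I_17) : eigen ad mu y -> model_map y 0 k != 0 ->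
  D21_wt k = mu.
Proof.
move=> hy hk; apply: contrapT => /eqP /row_neq_ex [c hc].
have := congr1 (fun z => model_map z 0 k) (hy c).
rewrite /ad /= model_map_weight model_mapZ [RHS]mxE => /(mulIf hk) e.
by rewrite e eqxx in hc.
Qed.

(** The pairing of opposite root vectors is nondegenerate: one Cartan coordinate of the bracket is
    $\pm1$, $\pm\alpha$ or $\pm(1+\alpha)$. *)
Lemma D21_opp_bracket (k : 'I_17) : (3 <= k)%N ->
  exists2 l : 'I_17, (l < 3)%N & mbr (basis (D21_opp k)) (basis k) 0 l != 0.
Proof.
move=> hk.
have : all (fun k => (3 <= k)%N ==> has (fun l =>
    let c := (total (sum1 1 (D21_bracket (D21_opp k) k)) l) in
    (c.2 == 0) && (c.1 \in [:: (1, 0); (-1, 0); (0, 1); (0, -1); (1, 1); (-1, -1)]))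
    (seq.iota 0 3)) (seq.iota 0 17) by vm_compute.
move=> /allP /(_ k); rewrite mem_iota => /(_ (ltn_ord k)); rewrite hk.
move=> /hasP [l]; rewrite mem_iota => /= hl.
set c := total _ _ => /andP [/eqP c2 hc].
have hl' : (l < 17)%N by apply: ltn_trans hl _.
exists (Ordinal hl') => //; rewrite model_basis ?D21_opp_lt //.
have -> : vec2 alpha (D21_bracket (D21_opp k) k) =
    vec3 alpha (sum1 1 (D21_bracket (D21_opp k) k)).
  by rewrite vec3_sum1 scale1r.
rewrite vec3_total -/c; last first.
  rewrite all_map; apply/allP => t ht /=.
  by apply: D21_bracket_range ht => //; apply: D21_opp_lt.
have alpha1 : alpha + 1 != 0 by rewrite addr_eq0.
rewrite /eval3 c2 mul0r addr0; move: hc; rewrite !inE.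
do !case/orP; move=> /eqP -> /=; rewrite ?mul0r ?mul1r ?addr0 ?add0r ?oner_eq0 //.
- by rewrite oppr_eq0 oner_eq0.
- by rewrite mulN1r oppr_eq0.
- by rewrite addrC.
- by rewrite mulN1r -opprD oppr_eq0 addrC.
Qed.

(** The ideal contains the weight components of its elements, and the one of weight zero is a Cartan
    element, hence 0. A component with nonzero image maps to a multiple of one root vector; its
    bracket with a lift of the opposite root vector would be an element of [J] with a nonzero Cartan
    coordinate. *)
Lemma null_ideal_map (J : set gt) y : is_ideal J -> cartan_free J -> J y -> model_map y
  = 0.
Proof.
move=> [hJ _ hbr] hfree.
have parts z : J z -> exists (s : seq 'rV[K]_3) (v : 'rV[K]_3 -> gt),
    [/\ forall mu, gt_part mu (v mu), forall mu, mu \in s -> J (v mu),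
        (0 \in s -> v 0 = 0) & z = \sum_(mu <- s) v mu].
  move=> hz; have [s [v [us hv e]]] := gt_part_sums z; exists s, v.
  have hs mu : mu \in s -> J (v mu).
    apply: (eigen_component ad_linear hJ) => //.
    - by move=> c t ht; have [] := hbr (pre_cartan A c) t ht.
    - by move=> nu; apply: gt_part_eigen.
    - by rewrite -e.
  split=> // /hs h0; apply: hfree; split=> //.
  by have := hv 0; rewrite /gt_part eqxx.
have cart z (l : 'I_17) : J z -> (l < 3)%N -> model_map z 0 l = 0.
  move=> /parts [s [v [hv hs h0 ->]]] hl.
  rewrite model_map_sum summxE big_seq big1 // => mu hmu.
  apply/eqP; apply: contraT => hne.
  have := model_map_eigen (gt_part_eigen (hv mu)) hne => e.
  have mu0 : mu = 0 by rewrite -e; apply/eqP; rewrite D21_wt_eq0.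
  by move: hne; rewrite mu0 h0 -?mu0 // model_map0 mxE eqxx.
move=> hy; have [s [v [hv hs h0 ->]]] := parts y hy.
rewrite model_map_sum big_seq big1 // => mu hmu; apply/rowP => k; rewrite mxE.
apply/eqP; apply: contraT => hne; have hw := gt_part_eigen (hv mu).
have hmu_k := model_map_eigen hw hne.
have hk : (3 <= k)%N.
  by rewrite leqNgt; apply: contra hne => hk; rewrite cart //; apply: hs.
have vE : model_map (v mu) = model_map (v mu) 0 k *: basis k.
  rewrite {1}(row_basis (model_map (v mu))) (bigD1 k) //= big1 ?addr0 // => i hi.
  have [->|hi'] := eqVneq (model_map (v mu) 0 i) 0; first by rewrite scale0r.
  have ei := model_map_eigen hw hi'.
  have i3 : (3 <= i)%N by rewrite leqNgt -D21_wt_eq0 ei -hmu_k D21_wt_eq0 -leqNgt.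
  by move: hi; rewrite (D21_wt_inj i3 hk) ?eqxx // ei.
have [l hl hbl] := D21_opp_bracket hk.
have [z hz] := has_preimage_basis (Ordinal (D21_opp_lt (ltn_ord k))).
have hzv : J [< z, v mu >] by have [] := hbr z (v mu) (hs mu hmu).
have := cart _ l hzv hl; rewrite model_map_bracket hz vE model_bracketZr mxE.
by move=> /eqP; rewrite mulf_eq0 (negbTE hne) (negbTE hbl).
Qed.

(** Conversely the kernel is one of these ideals: it is graded since the map preserves parity, and
    it is free of Cartan elements since the [h_i] are independent in the model. *)
Lemma model_map_ker y : lspan (@null_ideals K 3 A) y <-> model_map y = 0.
Proof.
have ker_sub : subspace [set y | model_map y = 0].
  split=> [|a z t /= hz ht]; first exact: model_map0.
  by rewrite /= model_map_linear hz ht scaler0 addr0.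
split=> [|h].
  apply: (lspan_min ker_sub) => z [J [hJ hc] hz]; exact: null_ideal_map hJ hc hz.
apply: sub_lspan; exists [set y | model_map y = 0] => //; split.
  split=> // [b z hz|z t ht] /=.
    have := hz; rewrite /= {1}[z]part_sum model_mapD => e.
    have h0 := model_map_homog (part_homog false z).
    have h1 := model_map_homog (part_homog true z).
    have e1 : model_map (part false z) = - model_map (part true z).
      by apply/eqP; rewrite -addr_eq0 e.
    have z0 : model_map (part false z) = 0.
      apply/rowP => i; rewrite mxE; apply/eqP; apply: contraT => hi.
      have := h0 i hi; rewrite (h1 i) //.
      by move: hi; rewrite e1 mxE oppr_eq0.
    by case: b; rewrite // -[LHS]opprK -e1 z0 oppr0.
  by rewrite !model_map_bracket ht model_bracket0l model_bracket0r.
move=> z [hz hr]; case: hr hz => c _ <- /=; rewrite model_map_cartan => e.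
rewrite /pre_cartan big1 // => i _.
have lt3 (j : 'I_3) : (j < 17)%N by case: (code_lt j).
have := congr1 (fun u : V => u 0 (Ordinal (lt3 i))) e.
rewrite /= summxE mxE (bigD1 i) //= mxE basisE //= eqxx mulr1.
rewrite big1 ?addr0 => [->|j hj]; first by rewrite scale0r.
by rewrite mxE basisE //= eq_sym (negbTE (hj : (j : nat) != i)) mulr0.
Qed.

(** * The basis carried over to the contragredient superalgebra *)

Section Basis.
Local Notation g := (contragredient A).

Definition coord (y : g) (i : 'I_17) : K := model_map (repr y) 0 i.

Lemma coord_cls y i : coord (cls (@null_ideals K 3 A) y) i = model_map y 0 i.
Proof.
rewrite /coord; have /model_map_ker := cls_repr (S := @null_ideals K 3 A) y.
set z := repr _ => h.
by rewrite -(subrK y z) model_mapD h add0r.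
Qed.

Lemma coord_linear a (y z : g) i : coord (a *: y + z) i = a * coord y i + coord z i.
Proof.
elim/cls_ind: y => y; elim/cls_ind: z => z.
by rewrite -clsZ -clsD !coord_cls model_map_linear mxE mxE.
Qed.

Lemma coord_inj (y z : g) : (forall i, coord y i = coord z i) -> y = z.
Proof.
elim/cls_ind: y => y; elim/cls_ind: z => z h; apply/clsP/model_map_ker.
rewrite -scaleN1r model_mapD model_mapZ scaleN1r; apply/eqP; rewrite subr_eq0.
by apply/eqP/rowP => i; have := h i; rewrite !coord_cls.
Qed.

Lemma coord_bracket (y z : g) i : coord [< y, z >] i =
  mbr (\row_j coord y j) (\row_j coord z j) 0 i.
Proof.
elim/cls_ind: y => y; elim/cls_ind: z => z.
rewrite [[< _, _ >]]contra_bracketE coord_cls model_map_bracket.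
by congr (mbr _ _ 0 i); apply/rowP => j; rewrite mxE coord_cls.
Qed.

(** A preimage need not be homogeneous, but its part of the right parity has the same image. *)
Lemma basis_lift_ex (i : 'I_17) : exists2 y : g, homog (D21_parity i) y &
  forall j, coord y j = (i == j)%:R.
Proof.
have [y hy] := has_preimage_basis i.
exists (cls (@null_ideals K 3 A) (part (D21_parity i) y)).
  by exists (part (D21_parity i) y) => //; apply: part_homog.
move=> j; rewrite coord_cls.
have e : model_map (part false y) 0 j + model_map (part true y) 0 j = (i == j)%:R.
  have := congr1 (fun u : V => u 0 j) (model_mapD (part false y) (part true y)).
  by rewrite /= -part_sum hy basisE // [RHS]mxE eq_sym.
have hz b : b != D21_parity i -> model_map (part b y) 0 j = 0.
  move=> hb; apply/eqP; apply: contraT => hne.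
  have hj := model_map_homog (part_homog b y) hne.
  have h0 : model_map (part (~~ b) y) 0 j = 0.
    apply/eqP; apply: contraT => hne'.
    by have := model_map_homog (part_homog (~~ b) y) hne'; rewrite hj; case: (b).
  have eb : model_map (part b y) 0 j = (i == j)%:R.
    by move: e h0; case: (b) => /= <- ->; rewrite ?add0r ?addr0.
  move: hne; rewrite eb pnatr_eq0 eqb0 negbK => /eqP eij.
  by rewrite eij hj eqxx in hb.
have := hz (~~ D21_parity i); case: (D21_parity i) => /(_ isT) h.
  by rewrite -e h add0r.
by rewrite -e h addr0.
Qed.

Definition root_vec (i : 'I_17) : g := s2val (cid2 (basis_lift_ex i)).

Lemma root_vec_homog (i : 'I_17) : homog (D21_parity i) (root_vec i).
Proof. by rewrite /root_vec; case: cid2. Qed.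

Lemma coord_root_vec i j : coord (root_vec i) j = (i == j)%:R.
Proof. by rewrite /root_vec; case: cid2 => y _ /= ->. Qed.

Let coord_add (y z : g) i : coord (y + z) i = coord y i + coord z i.
Proof. by rewrite -[y]scale1r coord_linear mul1r scale1r. Qed.
Let coord_scale a (y : g) i : coord (a *: y) i = a * coord y i.
Proof.
have c0 : coord 0 i = 0 by apply: (addIr (coord 0 i)); rewrite -coord_add !add0r.
by rewrite -[a *: y]addr0 coord_linear c0 addr0.
Qed.

Lemma root_vec_span (y : g) : y = \sum_i coord y i *: root_vec i.
Proof.
apply: coord_inj => j.
have -> : coord (\sum_i coord y i *: root_vec i) j =
    \sum_i coord y i * coord (root_vec i) j.
  elim/big_rec2: _ => [|i z c _ <-]; last by rewrite coord_linear.
  by apply: (addIr (coord 0 j)); rewrite -coord_add !add0r.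
rewrite (bigD1 j) //= coord_root_vec eqxx mulr1 big1 ?addr0 // => i hi.
by rewrite coord_root_vec (negbTE hi) mulr0.
Qed.

Lemma row_coord_root_vec (i : 'I_17) : \row_j coord (root_vec i) j = basis i.
Proof. by apply/rowP => j; rewrite mxE coord_root_vec basisE // eq_sym. Qed.

Lemma coord_cartan c (i : 'I_17) : coord (cartan A c) i = \sum_l c l 0 * (i == l :>
  nat)%:R.
Proof.
rewrite /cartan coord_cls model_map_cartan summxE; apply: eq_bigr => l _.
by rewrite mxE basisE //; case: (code_lt l).
Qed.

Lemma root_vec_weight (i : 'I_17) : root_space (D21_wt i) (root_vec i).
Proof.
move=> c; apply: coord_inj => j; rewrite coord_bracket coord_scale row_coord_root_vec.
have -> : \row_j coord (cartan A c) j = \sum_l c l 0 *: basis l.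
  apply/rowP => k; rewrite mxE coord_cartan summxE; apply: eq_bigr => l _.
  by rewrite mxE basisE //; case: (code_lt l).
by rewrite model_cartan_weight mxE basisE // coord_root_vec eq_sym.
Qed.

Definition cartan_col (i : 'I_17) : 'cV[K]_3 := \col_l (i == l :> nat)%:R.

Lemma root_vec_cartan (i : 'I_17) : D21_wt i = 0 -> root_vec i = cartan A (cartan_col i).
Proof.
move=> /eqP; rewrite D21_wt_eq0 => hi; apply: coord_inj => j.
rewrite coord_root_vec coord_cartan (bigD1 (Ordinal hi)) //= mxE eqxx mul1r.
rewrite big1 ?addr0 => [|l hl]; first by rewrite eq_sym.
by rewrite mxE eq_sym (negbTE (hl : (l : nat) != i)) mul0r.
Qed.

Lemma coord_cartan0 c (i : 'I_17) : D21_wt i != 0 -> coord (cartan A c) i = 0.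
Proof.
rewrite D21_wt_eq0 -leqNgt => hi; rewrite coord_cartan big1 // => l _.
by rewrite gtn_eqF ?mulr0 // (leq_trans (ltn_ord l)).
Qed.

Lemma cartan_coord c :
  c = \sum_(i : 'I_17 | D21_wt i == 0) coord (cartan A c) i *: cartan_col i.
Proof.
apply/colP => l; rewrite summxE.
have hl : (l < 17)%N by case: (code_lt l).
rewrite (bigD1 (Ordinal hl)) /=; last by rewrite (D21_wt_eq0 (Ordinal hl));
  apply: (ltn_ord l).
rewrite !mxE eqxx mulr1 coord_cartan (bigD1 l) //= eqxx mulr1.
rewrite big1 ?addr0 => [|k hk]; last first.
  by rewrite eq_sym (negbTE (hk : (k : nat) != l)) mulr0.
rewrite big1 ?addr0 // => k /andP [_ hk].
by rewrite !mxE (negbTE (hk : (k : nat) != l)) mulr0.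
Qed.

End Basis.
End Interpretation.

(** * Counting the low words of a given weight *)

Section NormalWords.
Variables (I : finType) (r : I -> nat) (par : I -> bool).
Hypothesis r_inj : injective r.
Implicit Types (i j k : I) (w : seq I).
Local Notation ord := (fun i j => ~~ is_redex r par i j).

Lemma normal_sorted w : normal r par w = sorted ord w.
Proof. by elim: w => [//|i [//|j w] IH]; rewrite normal_cons IH. Qed.

Lemma ord_le i j : ord i j -> (r i <= r j)%N.
Proof. by rewrite /is_redex negb_or -leqNgt => /andP []. Qed.

Lemma ord_trans : transitive ord.
Proof.
move=> j i k hij hjk; have h1 := ord_le hij; have h2 := ord_le hjk.
rewrite /is_redex negb_or -leqNgt (leq_trans h1 h2) /=.
case: eqP hjk => //= <- hji; have e : i = j by apply: r_inj; apply/eqP;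
  rewrite eqn_leq h1 ord_le.
by move: hij; rewrite -e /is_redex ltnn eqxx.
Qed.

Lemma ord_anti : antisymmetric ord.
Proof.
move=> i j /andP [/ord_le h1 /ord_le h2].
by apply: r_inj; apply/eqP; rewrite eqn_leq h1.
Qed.

(** Normal words are the words sorted for [ord], which is reflexive on even letters and strict on
    odd ones, so the multiset of letters determines the word. *)
Lemma normal_perm_eq w w' : normal r par w -> normal r par w' -> perm_eq w w' -> w = w'.
Proof. by rewrite !normal_sorted; apply: sorted_eq;
  [apply: ord_trans | apply: ord_anti]. Qed.

Lemma normal_uniq_odd w : normal r par w -> uniq (filter par w).
Proof.
elim: w => //= i w IH hn; have [_ /IH uw] := @normal_cat _ _ _ [:: i] w hn.
case: ifP => //= hi; rewrite uw andbT mem_filter hi /=.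
apply/negP => hw; move: hn; rewrite -/(normal r par (i :: w)) normal_sorted /=.
move=> /(order_path_min ord_trans) /allP /(_ i hw).
by rewrite /is_redex eqxx hi orbT.
Qed.

Lemma sorted_normal w : sorted (fun i j => r i <= r j)%N w ->
  (forall i, par i -> count_mem i w <= 1)%N -> normal r par w.
Proof.
elim: w => [//|i [//|j w] IH] hs hc; rewrite normal_cons; apply/andP; split.
  move: hs => /= /andP [hij _]; rewrite /is_redex negb_or -leqNgt hij /=.
  by apply/negP => /andP [/eqP eij hi]; have := hc i hi; rewrite -eij /= eqxx.
apply: IH => [|k hk]; first by move: hs => /= /andP [].
by apply: leq_trans (hc k hk); rewrite /= leq_addl.
Qed.

Lemma par_word_count w : par_word par w = odd (count par w).
Proof.
rewrite /par_word; elim: w => [|i w IH]; first by rewrite big_nil.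
by rewrite big_cons IH /= oddD; case: (par i).
Qed.

End NormalWords.

(** Toggling a fixed element of [A] is an involution that exchanges the two parities. *)
Lemma card_parity_subsets (T : finType) (A : {set T}) (b : bool) : A != finset.set0 ->
  (#|[set S : {set T} | (S \subset A) && (odd #|S| == b)]%SET| * 2 = 2 ^ #|A|)%N.
Proof.
move=> /finset.set0Pn [x xA].
pose E b := [set S : {set T} | (S \subset A) && (odd #|S| == b)]%SET.
pose f (S : {set T}) := if x \in S then S :\ x else x |: S.
have fK : involutive f.
  move=> S; rewrite /f; case: (boolP (x \in S)) => hx;
    first by rewrite finset.setD11 finset.setD1K.
  by rewrite finset.setU11 finset.setU1K ?hx.
have fE c S : S \in E c -> f S \in E (~~ c).
  rewrite !inE /f => /andP [hS /eqP <-]; case: ifP => hx.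
    rewrite (fintype.subset_trans (subD1set _ _) hS) /= [in X in _ == X](cardsD1 x S)
      hx /=.
    by rewrite negbK.
  by rewrite finset.subUset finset.sub1set xA hS /= cardsU1 hx /=.
have le c : (#|E c| <= #|E (~~ c)|)%N.
  rewrite -(card_imset (mem (E c)) (inv_inj fK)); apply: subset_leq_card.
  by apply/fintype.subsetP => _ /imsetP [S hS ->]; apply: fE.
have eq : #|E b| = #|E (~~ b)|.
  by apply/eqP; rewrite eqn_leq le; have := le (~~ b); rewrite negbK.
rewrite muln2 -addnn -/(E b) {2}eq -card_powerset.
rewrite -(cardsID [set S : {set T} | odd #|S| == b]%SET (powerset A)); congr (_ + _)%N.
  by apply: eq_card => S; rewrite !inE.
by apply: eq_card => S; rewrite !inE andbC; case: (odd _) (b) => -[].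
Qed.

(** Coordinates of a root in the basis [eps_0], [eps_1], [eps_2] for which the
    even roots are the [2 eps_k] and [- 2 eps_k] and the odd ones have all
    coordinates equal to 1 or -1. *)
Definition D21_eps (i l : nat) : int :=
  D21_root i 0 + D21_root i 1 + D21_root i 2 - 2 * D21_root i l.

Lemma D21_eps_odd (i : 'I_17) l : (l < 3)%N -> D21_parity i ->
  D21_eps i l = 1 \/ D21_eps i l = -1.
Proof.
move=> hl hi; have : all (fun i => all (fun l => D21_parity i ==>
  (D21_eps i l \in [:: 1; -1])) (seq.iota 0 3)) (seq.iota 0 17) by vm_compute.
move=> /allP /(_ i); rewrite mem_iota => /(_ (ltn_ord i)) /allP /(_ l).
by rewrite mem_iota hi => /(_ hl); rewrite !inE => /orP [] /eqP; [left|right].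
Qed.

(** The two even root vectors of weight [2 eps_k] and [- 2 eps_k]. *)
Definition even_code (s : bool) (k : nat) : nat := if s then (6 + k)%N else (13 + k)%N.

Lemma D21_eps_even s k l : (k < 3)%N -> (l < 3)%N ->
  D21_eps (even_code s k) l = (if s then 2 else -2) * (k == l)%N%:Z.
Proof.
move=> hk hl; have : all (fun s => all (fun k => all (fun l =>
  D21_eps (even_code s k) l == (if s then 2 else -2) * (k == l)%N%:Z)
  (seq.iota 0 3)) (seq.iota 0 3)) [:: true; false] by vm_compute.
move=> /allP /(_ s); rewrite !inE => /(_ (ltac:(by case: (s)))) /allP /(_ k).
by rewrite mem_iota => /(_ hk) /allP /(_ l); rewrite mem_iota => /(_ hl) /eqP.
Qed.

Lemma even_codeP (i : 'I_17) : (3 <= i)%N -> ~~ D21_parity i ->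
  exists s k, (k < 3)%N /\ i = even_code s k :> nat.
Proof.
move=> h3 hp; have : all (fun i => ((3 <= i)%N && ~~ D21_parity i) ==>
  has (fun s => has (fun k => i == even_code s k) (seq.iota 0 3)) [:: true; false])
  (seq.iota 0 17) by vm_compute.
move=> /allP /(_ i); rewrite mem_iota h3 hp => /(_ (ltn_ord i)) /hasP [s _] /hasP [k].
by rewrite mem_iota => hk /eqP e; exists s, k.
Qed.

Lemma even_code_props s k : (k < 3)%N ->
  [/\ (even_code s k < 17)%N, (3 <= even_code s k)%N, ~~ D21_parity (even_code s k)
    & D21_opp (even_code s k) = even_code (~~ s) k].
Proof.
move=> hk; have : all (fun s => all (fun k => [&& (even_code s k < 17)%N,
  (3 <= even_code s k)%N, ~~ D21_parity (even_code s k)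
    & D21_opp (even_code s k) == even_code (~~ s) k]) (seq.iota 0 3)) [:: true; false].
  by vm_compute.
move=> /allP /(_ s); rewrite !inE => /(_ (ltac:(by case: (s)))) /allP /(_ k).
by rewrite mem_iota => /(_ hk) /and4P [? ? ? /eqP].
Qed.

Lemma D21_opp_props (k : nat) : (k < 17)%N -> (3 <= k)%N ->
  [/\ (3 <= D21_opp k)%N, D21_opp (D21_opp k) = k, D21_parity (D21_opp k) = D21_parity k
    & forall l, (l < 3)%N -> D21_root (D21_opp k) l = - D21_root k l].
Proof.
move=> hk h3; have : all (fun k => (3 <= k)%N ==> [&& (3 <= D21_opp k)%N,
  D21_opp (D21_opp k) == k, D21_parity (D21_opp k) == D21_parity k &
  all (fun l => D21_root (D21_opp k) l == - D21_root k l) (seq.iota 0 3)])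
  (seq.iota 0 17) by vm_compute.
move=> /allP /(_ k); rewrite mem_iota h3 => /(_ hk) /and4P [h1 /eqP h2 /eqP h3' /allP h4].
by split=> // l hl; apply/eqP/h4; rewrite mem_iota.
Qed.

Lemma card_odd_codes : #|[set i : 'I_17 | D21_parity i]%SET| = 8%N.
Proof.
by rewrite cardsE -sum1_card big_mkcond !big_ord_recl big_ord0; vm_compute.
Qed.

(** * Low letters and low words for an arbitrary set of positive roots *)

Section PositiveSystem.
Variables (K : numFieldType) (alpha : K).
Hypothesis alpha_neq0 : alpha != 0.
Hypothesis alpha_neqN1 : alpha != -1.
Variable P : set 'rV[K]_3.
Local Notation A := (D21_matrix alpha).
Hypothesis hP : is_positive_roots A P.
Implicit Types (i j k : 'I_17) (mu : 'rV[K]_3).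
Local Notation wt := (fun i : 'I_17 => D21_wt alpha i).
Local Notation x := (root_vec alpha_neq0 alpha_neqN1).
Local Notation low := (low wt P).

Let coordE := root_vec_span alpha_neq0 alpha_neqN1.
Let coord_lin := coord_linear alpha_neq0 alpha_neqN1.
Let coord_x := coord_root_vec alpha_neq0 alpha_neqN1.

Lemma D21_is_root mu : is_root A mu -> exists2 k : 'I_17, (3 <= k)%N & wt k = mu.
Proof.
move=> [mu0 [y y0 hy]]; have [k hk] : exists k, coord y k != 0.
  apply: contrapT => h; case/eqP: y0; rewrite (coordE y) big1 // => k _.
  have [->|hk] := eqVneq (coord y k) 0; first by rewrite scale0r.
  by case: h; exists k.
have e := coord_weight coordE coord_lin coord_x (root_vec_weight alpha_neq0
  alpha_neqN1) hy hk.
exists k => //; rewrite leqNgt -(D21_wt_eq0 alpha_neq0 alpha_neqN1) /=.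
by move: e => /= ->.
Qed.

Lemma is_root_wt k : (3 <= k)%N -> is_root A (wt k).
Proof.
move=> hk; split; first by rewrite (D21_wt_eq0 alpha_neq0 alpha_neqN1) -leqNgt.
exists (x k); last exact: root_vec_weight.
exact: (x_neq0 coord_lin coord_x).
Qed.

Lemma wt_opp k : (3 <= k)%N -> D21_wt alpha (D21_opp k) = - wt k.
Proof.
move=> hk; rewrite /D21_wt -mulNmx; congr (_ *m _); apply/rowP => l; rewrite !mxE.
by have [_ _ _ ->] := D21_opp_props (ltn_ord k) hk; rewrite // mulrNz.
Qed.

Lemma nat_spanD (Pi : seq 'rV[K]_3) mu nu :
  nat_span Pi mu -> nat_span Pi nu -> nat_span Pi (mu + nu).
Proof.
move=> [a ->] [b ->]; exists (fun t => a t + b t)%N.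
by rewrite -big_split; apply: eq_bigr => t _; rewrite mulrnDr.
Qed.

(** Adding the two expansions gives a vanishing combination with coefficients in the natural
    numbers; by freeness each sum of two coefficients is 0, hence each coefficient. *)
Lemma nat_span_pointed (Pi : seq 'rV[K]_3) mu : free Pi ->
  nat_span Pi mu -> nat_span Pi (- mu) -> mu = 0.
Proof.
move=> fPi [a ha] [b hb]; have : \sum_(t <- Pi) t *+ (a t + b t) = 0.
  under eq_bigr do rewrite mulrnDr.
  by rewrite big_split /= -ha -hb subrr.
have bigE (F : 'rV[K]_3 -> 'rV[K]_3) :
    \sum_(t <- Pi) F t = \sum_(i < size Pi) F (Pi`_i).
  by rewrite (big_nth 0) big_mkord.
rewrite bigE; under eq_bigr do rewrite -scaler_nat.
move=> h; have hk := elimT (@freeP _ _ _ (in_tuple Pi)) fPi (fun i : 'I_(size Pi) =>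
  (a Pi`_i + b Pi`_i)%:R) h.
rewrite ha bigE big1 // => i _.
by have /eqP := hk i; rewrite pnatr_eq0 addn_eq0 => /andP [/eqP -> _].
Qed.

(** The opposite root vector shows that [- mu] is a root. One of the two is positive by the
    definition of simple roots, and not both by [nat_span_pointed]. *)
Lemma positive_xor mu : is_root A mu -> P mu <-> ~ P (- mu).
Proof.
move=> hmu; have [Pi [fPi _ hPi] ->] := hP.
have hmuN : is_root A (- mu).
  have [k hk <-] := D21_is_root hmu; rewrite -wt_opp //.
  have [h3 _ _ _] := D21_opp_props (ltn_ord k) hk.
  exact: (is_root_wt (k := Ordinal (D21_opp_lt (ltn_ord k))) h3).
split=> [[_ h1] [_ h2]|h].
  by case: hmu => /eqP h _; apply: h; apply: nat_span_pointed fPi h1 h2.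
by case: (hPi mu hmu) => h'; split=> //; case: h.
Qed.

Lemma positive_neq0 : ~ P 0.
Proof. by have [Pi _ ->] := hP; move=> [[/eqP]]. Qed.

(** The sum is not 0, since two opposite roots are not both positive; so [k] is the code of a root
    vector. *)
Lemma positive_closed i j k :
  P (wt i) -> P (wt j) -> wt k = wt i + wt j -> P (wt k).
Proof.
move=> hi hj e.
have hk : (3 <= k)%N.
  rewrite leqNgt -(D21_wt_eq0 alpha_neq0 alpha_neqN1); apply/eqP => k0.
  have hr : is_root A (wt i) by have [Pi _ eP] := hP; move: hi; rewrite eP => -[].
  have /positive_xor [/(_ hi) h _] := hr; apply: h.
  suff -> : - wt i = wt j by [].
  by apply/eqP; rewrite eq_sym -addr_eq0 addrC -e k0.
have [Pi _ eP] := hP; move: hi hj; rewrite eP => -[_ h1] [_ h2].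
split; first exact: is_root_wt.
by rewrite e; apply: nat_spanD.
Qed.

Lemma low_ge3 k : low k -> (3 <= k)%N.
Proof. by move=> /andP []; rewrite (D21_wt_eq0 alpha_neq0 alpha_neqN1) -leqNgt. Qed.

Definition opp_letter k : 'I_17 := Ordinal (D21_opp_lt (ltn_ord k)).

Lemma low_opp k : (3 <= k)%N -> low (opp_letter k) = ~~ low k.
Proof.
move=> hk; have [h3 _ _ _] := D21_opp_props (ltn_ord k) hk.
have e (l : 'I_17) : (3 <= l)%N -> low l = ~~ `[< P (wt l) >].
  by move=> hl; rewrite lowE (D21_wt_eq0 alpha_neq0 alpha_neqN1) ltnNge hl.
rewrite !e //= wt_opp // negbK.
have h := positive_xor (is_root_wt hk).
by apply/idP/idP => [/asboolPn/h/asboolP|/asboolP/h h']; last by apply/asboolPn.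
Qed.

(** The shift by 17, the number of letters, places every other letter after the low ones. *)
Definition letter_rank k : nat := if low k then val k else (17 + k)%N.

Lemma letter_rank_inj : injective letter_rank.
Proof.
move=> i j; rewrite /letter_rank; case: ifP => _; case: ifP => _ e; apply: val_inj => //=.
- by have := ltn_ord i; rewrite /= e ltnNge leq_addr.
- by have := ltn_ord j; rewrite /= -e ltnNge leq_addr.
by apply/eqP; rewrite -(eqn_add2l 17) e.
Qed.

Lemma letter_rank_low i j : low i -> ~~ low j -> (letter_rank i < letter_rank j)%N.
Proof.
by move=> hi /negbTE hj; rewrite /letter_rank hi hj ltn_addr ?ltn_ord.
Qed.

Local Notation par := (fun i : 'I_17 => D21_parity i).
Local Notation low_words := (low_words par letter_rank wt P).

Implicit Types (w : seq 'I_17) (S : {set 'I_17}).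

Definition root_total w l : int := \sum_(i <- w) D21_root i l.
Definition eps_total w l : int := \sum_(i <- w) D21_eps i l.

Lemma eps_root_total w l : eps_total w l =
  root_total w 0 + root_total w 1 + root_total w 2 - 2 * root_total w l.
Proof.
by rewrite /eps_total /root_total mulr_sumr -!big_split -sumrB.
Qed.

Lemma wt_word_root w : wt_word wt w = (\row_l (root_total w l)%:~R) *m A.
Proof.
rewrite /wt_word /root_total -mulmx_suml; congr (_ *m _); apply/rowP => l.
by rewrite summxE mxE rmorph_sum; apply: eq_bigr => i _; rewrite mxE.
Qed.

(** [A] is injective, and the passage from simple root coordinates to eps coordinates is invertible
    over the rationals, so weights are compared through integers. *)
Lemma wt_word_eps w w' : wt_word wt w = wt_word wt w' <->
  forall l, (l < 3)%N -> eps_total w l = eps_total w' l.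
Proof.
have root_eps : (forall l, (l < 3)%N -> root_total w l = root_total w' l) <->
    forall l, (l < 3)%N -> eps_total w l = eps_total w' l.
  split=> h l hl; first by rewrite !eps_root_total !h.
  have := h 0%N isT; have := h 1%N isT; have := h 2%N isT.
  rewrite !eps_root_total; case: l hl => [|[|[|//]]] _; lia.
rewrite -root_eps !wt_word_root; split=> [h l hl|h]; last first.
  by congr (_ *m _); apply/rowP => l; rewrite !mxE h.
have /eqP : (\row_l (root_total w l)%:~R - \row_l (root_total w' l)%:~R) *m A = 0.
  by rewrite mulmxBl h subrr.
move=> /eqP /(D21_matrix_inj alpha_neq0 alpha_neqN1) /rowP /(_ (Ordinal hl)).
by rewrite !mxE => /eqP; rewrite subr_eq0 eqr_int => /eqP.
Qed.

Definition odd_set w : {set 'I_17} := [set i | (i \in w) && D21_parity i]%SET.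

Lemma low_word_odd_sum w (F : 'I_17 -> int) : low_words w ->
  \sum_(i <- w | D21_parity i) F i = \sum_(i in odd_set w) F i.
Proof.
move=> /andP [hn _]; rewrite -big_filter big_uniq /=.
  by apply: eq_bigl => i; rewrite inE mem_filter andbC.
exact: normal_uniq_odd letter_rank_inj _ hn.
Qed.

(** The two even root vectors with a nonzero coordinate [k] are opposite, so only one of them is
    low. *)
Lemma low_even_code s (k : nat) i j : (k < 3)%N -> low i -> low j ->
  i = even_code s k :> nat -> ~~ D21_parity j -> D21_eps j k != 0 -> j = i.
Proof.
move=> hk hi hj ei hp; have [t [l [hl ej]]] := even_codeP (low_ge3 hj) hp.
rewrite ej D21_eps_even //; have [elk|] := eqVneq l k; last by rewrite mulr0 eqxx.
move=> _; apply: val_inj; rewrite /= ej ei elk; congr even_code.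
apply/eqP; apply: contraT => ts; have e : j = opp_letter i.
  apply: val_inj; rewrite /= ej ei elk.
  by have [_ _ _ ->] := even_code_props s hk; congr even_code;
    case: t s ts {ej ei} => -[].
by move: hj; rewrite e low_opp ?hi //; apply: low_ge3.
Qed.

(** A single even low letter contributes to coordinate [k], so its multiplicity can be read off the
    weight once the odd letters are known. *)
Lemma low_word_eps w s (k : nat) i : low_words w -> (k < 3)%N -> low i ->
  i = even_code s k :> nat ->
  eps_total w k = \sum_(j in odd_set w) D21_eps j k
    + (if s then 2 else -2) * (count_mem i w)%:Z.
Proof.
move=> hw hk hi ei; rewrite /eps_total (bigID (fun j : 'I_17 => D21_parity j)) /=.
rewrite low_word_odd_sum //; congr (_ + _).
have hpi : ~~ D21_parity i by rewrite ei; have [] := even_code_props s hk.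
have e_i : D21_eps i k = if s then 2 else -2 by rewrite ei D21_eps_even // eqxx mulr1.
have /andP [_ /allP aw] := hw.
transitivity (\sum_(j <- w | j == i) D21_eps i k).
  rewrite big_seq_cond [RHS]big_seq_cond [LHS]big_mkcond [RHS]big_mkcond.
  apply: eq_bigr => j _; have [hj|//] := boolP (j \in w); rewrite /=.
  have [->|nij] := eqVneq j i; first by rewrite hpi.
  case: ifP => // hp; apply/eqP; apply: contraNT nij => hne.
  by apply/eqP; apply: (low_even_code hk hi (aw j hj) ei hp hne).
rewrite big_const_seq iter_addr addr0 e_i -[LHS]mulr_natr natz.
by congr (_ * Posz _); apply: eq_count => j.
Qed.

Lemma low_word_inj w w' : low_words w -> low_words w' ->
  wt_word wt w = wt_word wt w' -> odd_set w = odd_set w' -> w = w'.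
Proof.
move=> hw hw' /wt_word_eps he ho.
have [/andP [nw /allP aw] /andP [nw' /allP aw']] := (hw, hw').
apply: (normal_perm_eq letter_rank_inj nw nw'); rewrite /perm_eq; apply/allP => i.
rewrite mem_cat => hi; have li : low i by case/orP: hi => [/aw|/aw'].
have [hp|hp] := boolP (D21_parity i).
  have cnt v : normal letter_rank par v -> count_mem i v = (i \in odd_set v).
    move=> /(normal_uniq_odd letter_rank_inj) /(count_uniq_mem i).
    rewrite inE mem_filter hp /= andbT => <-; rewrite count_filter;
      apply: eq_count => j /=.
    by case: eqP => // ->; rewrite hp.
  by rewrite /= !cnt // ho.
have [s [k [hk ei]]] := even_codeP (low_ge3 li) hp.
have := he k hk; rewrite (low_word_eps hw hk li ei) (low_word_eps hw' hk li ei) ho.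
have ne : (if s then 2 else -2 : int) != 0 by case: (s).
by move=> /addrI /(mulfI ne) [e]; apply/eqP.
Qed.

Definition low_odd : {set 'I_17} := [set i | low i && D21_parity i]%SET.

Lemma odd_set_low w : low_words w -> odd_set w \subset low_odd.
Proof.
move=> /andP [_ /allP aw]; apply/fintype.subsetP => i.
by rewrite !inE => /andP [/aw -> ->].
Qed.

(** Opposition exchanges the odd letters that are low with those that are not, and there are eight
    odd letters. *)
Lemma card_low_odd : #|low_odd| = 4%N.
Proof.
have oppK i : (3 <= i)%N -> opp_letter (opp_letter i) = i.
  by move=> h3; apply: val_inj; have [_ e _ _] := D21_opp_props (ltn_ord i) h3.
have odd3 i : D21_parity i -> (3 <= i)%N.
  move=> hi; have : all (fun i : nat =>
    D21_parity i ==> (3 <= i)%N) (seq.iota 0 17) by vm_compute.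
  by move=> /allP /(_ i); rewrite mem_iota hi => /(_ (ltn_ord i)).
have oppP i : D21_parity i -> D21_parity (opp_letter i).
  by move=> hi; have [_ _ -> _] := D21_opp_props (ltn_ord i) (odd3 i hi).
have h8 : #|[set i : 'I_17 | D21_parity i]%SET| = (#|low_odd| + #|low_odd|)%N.
  rewrite -[LHS](cardsID low_odd); congr (_ + _)%N.
    by apply: eq_card => i; rewrite !inE; case: (D21_parity i); rewrite ?andbT ?andbF.
  have inj : {in low_odd &, injective opp_letter}.
    move=> i j; rewrite !inE => /andP [_ /odd3 hi] /andP [_ /odd3 hj] e.
    by rewrite -(oppK i hi) e oppK.
  rewrite -(card_in_imset inj); apply: eq_card => i; rewrite !inE.
  apply/andP/imsetP => [[hl hp]|[j]].
    exists (opp_letter i); last by rewrite oppK ?odd3.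
    by rewrite inE oppP // low_opp ?odd3 //; move: hl; rewrite hp andbT => ->.
  rewrite inE => /andP [hj pj] ->; split; last exact: oppP.
  by rewrite low_opp ?odd3 // hj.
by apply/eqP; rewrite -(eqn_pmul2r (isT : 0 < 2)%N) muln2 -addnn -h8 card_odd_codes.
Qed.

(** [m] counts the letters with coordinate -1. This form of the sum shows its parity and its bounds
    at once. *)
Lemma eps_odd_sum S (l : nat) : (l < 3)%N -> S \subset low_odd ->
  exists2 m, (m <= #|S|)%N & \sum_(i in S) D21_eps i l = #|S|%:Z - 2 * m%:Z.
Proof.
move=> hl hS; pose neg i : nat := D21_eps i l == -1; exists (\sum_(i in S) neg i)%N.
  by rewrite -sum1_card; apply: leq_sum => i _; rewrite /neg; case: eqP.
have -> : #|S|%:Z = \sum_(i in S) 1 by rewrite sumr_const natz.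
rewrite -(natz (\sum_(i in S) neg i)) natr_sum mulr_sumr -sumrB; apply: eq_bigr => i hi.
have := fintype.subsetP hS i hi; rewrite inE => /andP [_ hp].
by rewrite /neg; case: (D21_eps_odd hl hp) => ->.
Qed.

Lemma even_low_ex (k : nat) : (k < 3)%N -> exists s i, low i /\ i = even_code s k :> nat.
Proof.
move=> hk; have [h17 h3 _ ho] := even_code_props true hk.
pose i : 'I_17 := Ordinal h17; case: (boolP (low i)) => hi; first by exists true, i.
exists false, (opp_letter i); split; last by rewrite /= ho.
by rewrite low_opp.
Qed.

(** The words of weight [nu] are counted by subsets [S] of the odd low letters
    of the parity of [nu]; deep enough inside the cone all of them occur. *)
Lemma low_word_ex (b : bool) (sgn : nat -> bool) (e : nat -> 'I_17) S :
  (forall k : nat, (k < 3)%N -> low (e k) /\ e k = even_code (sgn k) k :> nat) ->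
  S \subset low_odd -> odd #|S| = b ->
  exists w, [/\ low_words w, odd_set w = S &
    forall k : nat, (k < 3)%N -> eps_total w k = (if sgn k then 1 else -1) * (8 +
      b)%N%:Z].
Proof.
move=> he hS hb.
have S4 : (#|S| <= 4)%N by have := subset_leq_card hS; rewrite card_low_odd.
have even_e (k : nat) : (k < 3)%N -> ~~ D21_parity (e k).
  by move=> hk; have [_ ->] := he k hk; have [] := even_code_props (sgn k) hk.
have /choice [c hc] : forall k : nat, exists c : nat, (k < 3)%N ->
    \sum_(i in S) D21_eps i k + (if sgn k then 2 else -2) * c%:Z =
    (if sgn k then 1 else -1) * (8 + b)%N%:Z.
  move=> k; case: (ltnP k 3) => hk; last by exists 0%N.
  have [m hm ->] := eps_odd_sum hk hS.
  (* The exponent of the even letter is half of what the odd letters leave to the target. That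
     remainder is even since [#|S|] has parity [b], and the truncated subtractions are exact since
     [m] and [#|S|] are at most 4. *)
  exists (if sgn k then 4 + m - #|S|./2 else 4 + b + #|S|./2 - m)%N => _.
  have := odd_double_half #|S|; rewrite hb; case: (sgn k); lia.
pose s := enum S ++ flatten [seq nseq (c k) (e k) | k : nat <- seq.iota 0 3].
pose w := sort (fun i j => letter_rank i <= letter_rank j)%N s.
have e_inj (k l : nat) : (k < 3)%N -> (l < 3)%N -> e k = e l -> k = l.
  move=> hk hl ekl; have [_ ek] := he k hk; have [_ el] := he l hl.
  have := D21_eps_even (sgn k) hk hk; have := D21_eps_even (sgn l) hl hk.
  by rewrite -ek -el ekl => -> ; rewrite eqxx; case: eqP => // _; rewrite mulr0;
    case: (sgn k).
have mem_w i : (i \in w) = (i \in S) || has (fun k : nat =>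
  (0 < c k)%N && (i == e k)) (seq.iota 0 3).
  rewrite mem_sort mem_cat mem_enum; congr orb.
  by rewrite /= !mem_cat !mem_nseq.
have count_s i : count_mem i w =
    ((i \in S) + \sum_(l <- seq.iota 0 3) (i == e l) * c l)%N.
  rewrite (permP (permEl (perm_sort _ s))) count_cat; congr (_ + _)%N.
    by rewrite count_uniq_mem ?enum_uniq // mem_enum.
  rewrite count_flatten -map_comp sumnE big_map; apply: eq_bigr => k _ /=.
  by rewrite count_nseq /= eq_sym.
have low_w : low_words w.
  apply/andP; split.
    apply: sorted_normal => [|i hi].
      by apply: sort_sorted => i j; apply: leq_total.
    rewrite count_s big_seq big1 ?addn0 ?leq_b1 // => k; rewrite mem_iota => /= hk.
    by case: eqP => // eik; have := even_e k hk; rewrite -eik hi.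
  apply/allP => i; rewrite mem_w => /orP [/(fintype.subsetP hS)|/hasP [k]].
    by rewrite inE => /andP [].
  by rewrite mem_iota => /= hk /andP [_ /eqP ->]; have [] := he k hk.
have odd_w : odd_set w = S.
  apply/setP => i; rewrite inE mem_w; have [iS|iS] := boolP (i \in S).
    by have := fintype.subsetP hS i iS; rewrite inE => /andP [_ ->].
  apply/negP => /andP [/hasP [k]]; rewrite mem_iota => /= hk /andP [_ /eqP ->].
  by apply/negP; apply: even_e.
exists w; split=> // k hk; have [lk ek] := he k hk.
rewrite (low_word_eps low_w hk lk ek) odd_w -hc // count_s; congr (_ + _ * Posz _).
rewrite (_ : (e k \in S) = false) ?add0n; last first.
  apply: contraNF (even_e k hk) => /(fintype.subsetP hS); rewrite inE.
  by case/andP.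
rewrite (bigD1_seq k) ?mem_iota ?iota_uniq //= eqxx mul1n.
rewrite big_seq_cond big1 ?addn0 // => l /andP [hl nkl].
have hl3 : (l < 3)%N by move: hl; rewrite !inE => /or3P [] /eqP ->.
by case: eqP => // /e_inj ekl; rewrite ekl ?eqxx in nkl.
Qed.

(** * Dimensions of the weight spaces *)

Section Dims.
Variable lam : 'rV[K]_3.
Let M : lieSuperModType (contragredient A) := verma A P lam.

(** A low word of weight [mu - lam] is recovered from its odd letters by [low_word_inj], so the size
    of this set is the dimension of the weight space. *)
Definition weight_subsets mu : {set {set 'I_17}} :=
  [set S : {set 'I_17} | `[< exists w,
    [/\ low_words w, wt_word wt w + lam = mu & odd_set w = S] >]]%SET.

(** An even low letter changes an eps coordinate by 0 or $\pm2$ and an odd one by $\pm1$, so a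
    single coordinate fixes the parity of the number of odd letters. *)
Lemma weight_subsets_parity mu : exists p : bool,
  weight_subsets mu \subset
    [set S : {set 'I_17} | (S \subset low_odd) && (odd #|S| == p)]%SET.
Proof.
have [->|/finset.set0Pn [S0]] := eqVneq (weight_subsets mu) finset.set0.
  by exists false; apply: finset.sub0set.
rewrite inE => /asboolP [w0 [l0 e0 o0]]; exists (odd #|S0|).
apply/fintype.subsetP => S; rewrite inE => /asboolP [w [l e o]].
rewrite inE -o odd_set_low //=.
have : wt_word wt w = wt_word wt w0 by apply: (addIr lam); rewrite e e0.
have [s [i [li ei]]] := even_low_ex (isT : 0 < 3)%N.
move=> /wt_word_eps /(_ 0%N isT);
  rewrite (low_word_eps (k := 0) l isT li ei) (low_word_eps (k := 0) l0 isT li ei).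
have [m _ ->] := eps_odd_sum (isT : 0 < 3)%N (odd_set_low l).
have [m0 _ ->] := eps_odd_sum (isT : 0 < 3)%N (odd_set_low l0).
rewrite -o0; move: #|_| #|_| => a a0.
have := odd_double_half a; have := odd_double_half a0.
by case: (odd a) (odd a0) (s) => -[] []; lia.
Qed.

Lemma card_low_odd_parity (p : bool) :
  #|[set S : {set 'I_17} | (S \subset low_odd) && (odd #|S| == p)]%SET| = 8%N.
Proof.
have ne : low_odd != finset.set0 by rewrite -card_gt0 card_low_odd.
by apply/eqP; rewrite -(eqn_pmul2r (isT : 0 < 2)%N) card_parity_subsets // card_low_odd.
Qed.

Lemma weight_subsets_le mu : (#|weight_subsets mu| <= 8)%N.
Proof.
have [p hp] := weight_subsets_parity mu.
by have := subset_leq_card hp; rewrite card_low_odd_parity.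
Qed.

Lemma weight_words_list mu : exists B : seq (seq 'I_17),
  [/\ uniq B, size B = #|weight_subsets mu|,
      forall w, w \in B <-> low_words w /\ wt_word wt w + lam = mu
    & forall w, w \in B -> odd_set w \in weight_subsets mu].
Proof.
have /choice [f hf] : forall S, exists w, S \in weight_subsets mu ->
    [/\ low_words w, wt_word wt w + lam = mu & odd_set w = S].
  move=> S; case: (boolP (S \in weight_subsets mu)) => [|_]; last by exists [::].
  by rewrite inE => /asboolP [w hw]; exists w.
exists [seq f T | T <- enum (weight_subsets mu)]; split.
- rewrite map_inj_in_uniq ?enum_uniq // => S S'; rewrite !mem_enum => hS hS' e.
  by have [_ _ <-] := hf S hS; have [_ _ <-] := hf S' hS'; rewrite e.
- by rewrite size_map -cardE.
- move=> w; split=> [/mapP [S]|[hl hw]].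
    by rewrite mem_enum => hS ->; have [] := hf S hS.
  have hT : odd_set w \in weight_subsets mu by rewrite inE; apply/asboolP; exists w.
  apply/mapP; exists (odd_set w); first by rewrite mem_enum.
  have [h1 h2 h3] := hf _ hT; apply: low_word_inj => //.
  by apply: (addIr lam); rewrite hw h2.
- by move=> w /mapP [S]; rewrite mem_enum => hS ->; have [_ _ ->] := hf S hS.
Qed.

(** The coordinates reached in [low_word_ex] do not depend on [S], so all subsets of parity [b]
    occur in one and the same weight. *)
Lemma weight_subsets_full (b : bool) : exists mu,
  weight_subsets mu = [set S : {set 'I_17} | (S \subset low_odd) && (odd #|S| == b)]%SET.
Proof.
have /choice [se hse] : forall k : nat, exists t : bool * 'I_17, (k < 3)%N ->
    low t.2 /\ t.2 = even_code t.1 k :> nat.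
  move=> k; case: (ltnP k 3) => hk; last by exists (true, ord0).
  by have [s [i h]] := even_low_ex hk; exists (s, i).
have hex := @low_word_ex b (fun k : nat => (se k).1) (fun k : nat => (se k).2).
have ne : [set S : {set 'I_17} | (S \subset low_odd) && (odd #|S| == b)]%SET !=
  finset.set0.
  by rewrite -card_gt0 card_low_odd_parity.
have /finset.set0Pn [S0] := ne; rewrite inE => /andP [h0 /eqP b0].
have [w0 [l0 o0 e0]] := hex S0 hse h0 b0.
exists (wt_word wt w0 + lam).
have [p hp] := weight_subsets_parity (wt_word wt w0 + lam).
have hpb : p = b.
  have : S0 \in weight_subsets (wt_word wt w0 + lam) by rewrite inE; apply/asboolP;
    exists w0.
  by move=> /(fintype.subsetP hp); rewrite inE b0 => /andP [_ /eqP].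
apply/eqP; rewrite finset.eqEsubset -{1}hpb hp /=; apply/fintype.subsetP => S.
rewrite inE => /andP [hS /eqP bS]; have [w [l o e]] := hex S hse hS bS.
rewrite inE; apply/asboolP; exists w; split=> //; congr (_ + _).
by apply/wt_word_eps => k hk; rewrite e // e0.
Qed.

Lemma D21_verma_dim mu (B : seq (seq 'I_17)) : uniq B ->
  (forall w, w \in B <-> low_words w /\ wt_word wt w + lam = mu) ->
  has_dim (weight_space (M := M) mu) (size B).
Proof.
apply: (verma_has_dim (root_vec_homog alpha_neq0 alpha_neqN1) coordE coord_lin coord_x
  letter_rank_inj (root_vec_weight alpha_neq0 alpha_neqN1)
  (root_vec_cartan alpha_neq0 alpha_neqN1) (coord_cartan0 alpha_neq0 alpha_neqN1)
  (cartan_coord alpha_neq0 alpha_neqN1)).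
- exact: positive_neq0.
- exact: positive_closed.
- exact: letter_rank_low.
Qed.

Lemma D21_verma_graded_dim (q p : bool) mu (B : seq (seq 'I_17)) : uniq B ->
  (forall w, w \in B <-> low_words w /\ wt_word wt w + lam = mu) ->
  (forall w, w \in B -> par_word par w = p) ->
  has_dim (graded_weight_space (M := M) q mu) (if q == p then size B else 0).
Proof.
apply: (verma_graded_has_dim (root_vec_homog alpha_neq0 alpha_neqN1) coordE coord_lin
  coord_x
  letter_rank_inj (root_vec_weight alpha_neq0 alpha_neqN1)
  (root_vec_cartan alpha_neq0 alpha_neqN1) (coord_cartan0 alpha_neq0 alpha_neqN1)
  (cartan_coord alpha_neq0 alpha_neqN1)).
- exact: positive_neq0.
- exact: positive_closed.
- exact: letter_rank_low.
Qed.

Lemma D21_verma_weight_module : weight_module M.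
Proof.
apply: (verma_weight_module (root_vec_homog alpha_neq0 alpha_neqN1) coordE lam
  (root_vec_weight alpha_neq0 alpha_neqN1) (root_vec_cartan alpha_neq0 alpha_neqN1)).
- exact: positive_neq0.
- exact: letter_rank_low.
Qed.

Lemma par_word_odd_set w : low_words w -> par_word par w = odd #|odd_set w|.
Proof.
move=> /andP [hn _]; rewrite par_word_count; congr odd.
rewrite -size_filter; apply: esym; have := normal_uniq_odd letter_rank_inj hn.
move=> /card_uniqP <-; apply: eq_card => i.
by rewrite !inE mem_filter andbC.
Qed.

Lemma D21_verma_spaces mu : exists p : bool,
  [/\ has_dim (weight_space (M := M) mu) #|weight_subsets mu|,
      forall q : bool, has_dim (graded_weight_space (M := M) q mu)
        (if q == p then #|weight_subsets mu| else 0%N)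
    & forall S, S \in weight_subsets mu -> odd #|S| = p].
Proof.
have [p hp] := weight_subsets_parity mu; exists p.
have hpS S : S \in weight_subsets mu -> odd #|S| = p.
  by move=> /(fintype.subsetP hp); rewrite inE => /andP [_ /eqP].
have [B [uB <- hB hBo]] := weight_words_list mu; split=> // [|q].
  exact: D21_verma_dim.
apply: D21_verma_graded_dim => // w hw; have [lw _] := (hB w).1 hw.
by rewrite par_word_odd_set // hpS // hBo.
Qed.

Lemma D21_verma_degree :
  bounded_module M /\ has_degree M 8 /\ has_graded_degree M 8 8.
Proof.
split; [split; first exact: D21_verma_weight_module|split; [split|]].
(* The bound in [bounded_module] is strict, hence 9. *)
- exists 9 => mu; have [p [h _ _]] := D21_verma_spaces mu.
  by exists #|weight_subsets mu|; rewrite // ltnS weight_subsets_le.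
- move=> mu; have [p [h _ _]] := D21_verma_spaces mu.
  by exists #|weight_subsets mu|; rewrite ?weight_subsets_le.
- have [mu e] := weight_subsets_full false; exists mu.
  by have [p [h _ _]] := D21_verma_spaces mu; rewrite e card_low_odd_parity in h.
(* A weight space lies in one graded part; [weight_subsets_full] supplies one of dimension 8 for
   each parity, so both graded degrees are 8. *)
have graded q : max_dim (graded_weight_space (M := M) q) 8.
  split=> [mu|].
    have [p [_ h _]] := D21_verma_spaces mu.
    exists (if q == p then #|weight_subsets mu| else 0%N); first exact: h.
    by case: ifP => // _; apply: weight_subsets_le.
  have [mu e] := weight_subsets_full q; exists mu.
  have [p [_ h hp]] := D21_verma_spaces mu; have := h q.
  have qp : q == p.
    have : (0 < #|weight_subsets mu|)%N by rewrite e card_low_odd_parity.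
    case/card_gt0P => S hS; rewrite -(hp S hS).
    by move: hS; rewrite e inE => /andP [_ /eqP ->].
  by rewrite qp e card_low_odd_parity.
by split.
Qed.

End Dims.
End PositiveSystem.

Theorem theorem3p3 (R : realType) (alpha : R[i])
    (alpha_neq0 : alpha != 0) (alpha_neqN1 : alpha != -1)
    (P : set 'rV[R[i]]_3) (hP : is_positive_roots (D21_matrix alpha) P)
    (lam : 'rV[R[i]]_3) :
  let M : lieSuperModType (contragredient (D21_matrix alpha)) :=
    verma (D21_matrix alpha) P lam in
  bounded_module M /\ has_degree M 8 /\ has_graded_degree M 8 8.
Proof. exact: (D21_verma_degree alpha_neq0 alpha_neqN1 hP lam). Qed.
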